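(* Let $N\ge2$ and $q\in(1,\infty)$. Assume that $\mu_*>0$, $\nu_*>0$, $\gamma_*\in(-\infty,\infty)$, $\kappa_*>0$ are constants, and that $\eta_*^w\ne0$ and $\kappa_*\ne\mu_*\nu_*$. Let $\sigma_*\in(\sigma_*^w,\pi/2)$ and $c(\delta,\sigma)$ be the constants furnished by the result for the case $\gamma_*=0$ recalled in the context. Let $\delta=1/2$, $\sigma\in(\sigma_*,\pi/2)$, and $c_0=c(\delta,\sigma)$. Then there is a constant $\lambda_0\ge1$, depending only on $c_0$, $q$, and $\gamma_*$, such that the following assertions hold. (1) For any $\lambda\in\Sigma_{\sigma,\lambda_0}$ there are operators $\mathcal A(\lambda)$ and $\mathcal B(\lambda)$, with $$\mathcal A(\lambda)\in \mathrm{Hol}(\Sigma_{\sigma,\lambda_0},\mathcal L(\mathfrak X_q(\mathbf R_+^N),W_q^3(\mathbf R_+^N))),\qquad \mathcal B(\lambda)\in \mathrm{Hol}(\Sigma_{\sigma,\lambda_0},\mathcal L(\mathfrak X_q(\mathbf R_+^N),W_q^2(\mathbf R_+^N)^N)),$$ such that, for every $\mathbf F=(d,\mathbf f,\mathbf g,h)\in X_q(\mathbf R_+^N)$, $(\rho,\mathbf u)=(\mathcal A(\lambda)\mathcal F_\lambda\mathbf F,\mathcal B(\lambda)\mathcal F_\lambda\mathbf F)$ is a unique solution, in $W_q^3(\mathbf R_+^N)\times W_q^2(\mathbf R_+^N)^N$, of $$(\ast)_{\gamma_*}\quad\left\{\begin{aligned} \lambda\rho+\operatorname{div}\mathbf u&=d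 &&\text{in }\mathbf R_+^N,\\ \lambda\mathbf u-\mu_*\Delta\mathbf u-\nu_*\nabla\operatorname{div}\mathbf u+(\gamma_*-\kappa_*\Delta)\nabla\rho&=\mathbf f&&\text{in }\mathbf R_+^N,\\ \{\mu_*\mathbf D(\mathbf u)+(\nu_*-\mu_* )\operatorname{div}\mathbf u\,\mathbf I-(\gamma_*-\kappa_*\Delta)\rho\,\mathbf I\}\mathbf n&=\mathbf g&&\text{on }\mathbf R_0^N,\\ \mathbf n\cdot\nabla\rho&=h&&\text{on }\mathbf R_0^N. \end{aligned}\right.$$ (2) For $n=0,1$, $$\mathcal R_{\mathcal L(\mathfrak X_q(\mathbf R_+^N),\mathfrak A_q(\mathbf R_+^N))}\Big(\Big\{\Big(\lambda\frac{d}{d\lambda}\Big)^n(\mathcal S_\lambda\mathcal A(\lambda))\ \Big|\ \lambda\in\Sigma_{\sigma,\lambda_0}\Big\}\Big)\le 4c_0,$$ $$\mathcal R_{\mathcal L(\mathfrak X_q(\mathbf R_+^N),\mathfrak B_q(\mathbf R_+^N))}\Big(\Big\{\Big(\lambda\frac{d}{d\lambda}\Big)^n(\mathcal T_\lambda\mathcal B(\lambda))\ \Big|\ \lambda\in\Sigma_{\sigma,\lambda_0}\Big\}\Big)\le 4c_0.$$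
   Context: $\mathbf R_+^N=\{x=(x',x_N): x'\in\mathbf R^{N-1},x_N>0\}$, $\mathbf R_0^N=\{x=(x',x_N): x'\in\mathbf R^{N-1},x_N=0\}$; $\mathbf n=(0,\dots,0,-1)^{T}$ is the unit outer normal; $\mathbf I$ is the $N\times N$ identity matrix; $\mathbf D(\mathbf u)$ is the matrix with $(i,j)$-entry $\partial_iu_j+\partial_ju_i$. $\nabla^k$ denotes the collection of all $k$-th order partial derivatives. For $\sigma\in(0,\pi/2)$, $\delta\ge0$: $\Sigma_{\sigma,\delta}=\{\lambda\in\mathbf C: |\arg\lambda|<\pi-\sigma,\ |\lambda|>\delta\}$; $\lambda^{1/2}$ is the principal branch. Constants: $\eta_*^w=\big(\frac{\mu_*+\nu_*}{2\kappa_*}\big)^2-\frac1{\kappa_*}$; $\sigma_*^w\in[0,\pi/2)$ is $\sigma_*^w=0$ if $\eta_*^w\ge0$ and $\sigma_*^w=\arg\big(\frac{\mu_*+\nu_*}{2\kappa_*}+i\sqrt{|\eta_*^w|}\big)$ if $\eta_*^w<0$. Spaces (complex-valued functions; $L_q$, $W_q^m$ are the usual Lebesgue and Sobolev spaces), for a domain $G\subset\mathbf R^N$: $X_q(G)=W_q^1(G)\times L_q(G)^N\times W_q^1(G)^N\times W_q^2(G)$; $\mathfrak X_q(G)=W_q^1(G)\times L_q(G)^{\mathcal N}$ with $\mathcal N=N+N^2+N+N^2+N+1$; for $\mathbf F=(d,\mathbf f,\mathbf g,h)\in X_q(G)$, $\mathcal F_\lambda\mathbf F=(d,\mathbf f,\nabla\mathbf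 g,\lambda^{1/2}\mathbf g,\nabla^2h,\nabla\lambda^{1/2}h,\lambda h)\in\mathfrak X_q(G)$. $\mathfrak A_q(G)=L_q(G)^{N^3+N^2}\times W_q^1(G)$, $\mathcal S_\lambda\rho=(\nabla^3\rho,\lambda^{1/2}\nabla^2\rho,\lambda\rho)$; $\mathfrak B_q(G)=L_q(G)^{N^3+N^2+N}$, $\mathcal T_\lambda\mathbf u=(\nabla^2\mathbf u,\lambda^{1/2}\nabla\mathbf u,\lambda\mathbf u)$. For Banach spaces $X,Y$, $\mathcal L(X,Y)$ is the space of bounded linear operators, and $\mathrm{Hol}(U,\mathcal L(X,Y))$ is the set of $\mathcal L(X,Y)$-valued analytic functions on $U\subset\mathbf C$. $\mathcal R$-boundedness: with Rademacher functions $r_j(u)=\operatorname{sign}\sin(2^j\pi u)$, $0\le u\le1$, a family $\mathcal T\subset\mathcal L(X,Y)$ is $\mathcal R$-bounded on $\mathcal L(X,Y)$ if for some $p\in[1,\infty)$ there is $C>0$ such that for all $m\in\mathbf N$, $T_1,\dots,T_m\in\mathcal T$, $f_1,\dots,f_m\in X$, $\big(\int_0^1\|\sum_{j=1}^m r_j(u)T_jf_j\|_Y^p\,du\big)^{1/p}\le C\big(\int_0^1\|\sum_{j=1}^m r_j(u)f_j\|_X^p\,du\big)^{1/p}$; the smallest such $C$ is the $\mathcal R$-bound $\mathcal R_{\mathcal L(X,Y)}(\mathcal T)$ (the property does not depend on the choice of $p$; the same $p$ is used for all $\mathcal R$-bounds in the statement). The case $\gamma_*=0$ (an existing result to which the claim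 refers): if $\mu_*,\nu_*,\kappa_*>0$, $\eta_*^w\neq0$, $\kappa_*\ne\mu_*\nu_*$, then there is $\sigma_*\in(\sigma_*^w,\pi/2)$, independent of $q\in(1,\infty)$ and $\delta>0$, such that for every $q\in(1,\infty)$, $\delta>0$ and $\sigma\in(\sigma_*,\pi/2)$: there are $\mathcal A_0\in\mathrm{Hol}(\Sigma_{\sigma,\delta},\mathcal L(\mathfrak X_q(\mathbf R_+^N),W_q^3(\mathbf R_+^N)))$ and $\mathcal B_0\in\mathrm{Hol}(\Sigma_{\sigma,\delta},\mathcal L(\mathfrak X_q(\mathbf R_+^N),W_q^2(\mathbf R_+^N)^N))$ such that for every $\mathbf F\in X_q(\mathbf R_+^N)$ and $\lambda\in\Sigma_{\sigma,\delta}$ the pair $(\mathcal A_0(\lambda)\mathcal F_\lambda\mathbf F,\mathcal B_0(\lambda)\mathcal F_\lambda\mathbf F)$ is the unique solution in $W_q^3(\mathbf R_+^N)\times W_q^2(\mathbf R_+^N)^N$ of the system $(\ast)_0$ (the displayed system with $\gamma_*$ replaced by $0$), and there is a constant $c(\delta,\sigma)>0$, depending on at most $N,q,\delta,\sigma,\mu_*,\nu_*,\kappa_*$, such that for $n=0,1$ the $\mathcal R$-bounds of $\{(\lambda\frac{d}{d\lambda})^n(\mathcal S_\lambda\mathcal A_0(\lambda)):\lambda\in\Sigma_{\sigma,\delta}\}$ on $\mathcal L(\mathfrak X_q(\mathbf R_+^N),\mathfrak A_q(\mathbf R_+^N))$ and of $\{(\lambda\frac{d}{d\lambda})^n(\mathcal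 T_\lambda\mathcal B_0(\lambda)):\lambda\in\Sigma_{\sigma,\delta}\}$ on $\mathcal L(\mathfrak X_q(\mathbf R_+^N),\mathfrak B_q(\mathbf R_+^N))$ are at most $c(\delta,\sigma)$. *)

(* Defs.v *)
From HB Require Import structures.
From mathcomp Require Import all_boot all_order all_algebra.
From mathcomp Require Import complex.
From mathcomp Require Import all_classical all_reals all_analysis.

Set Implicit Arguments.
Unset Strict Implicit.
Unset Printing Implicit Defensive.

Import Order.TTheory GRing.Theory Num.Theory.
Import numFieldNormedType.Exports.

Local Open Scope classical_set_scope.
Local Open Scope ring_scope.
Local Open Scope complex_scope.

(** The points of [R^n] are the row vectors ['rV[R]_n], with the sigma-algebra
    generated by the coordinates, i.e. the Borel one. *)
Section measurable_rV.
Context {d : measure_display} {T : measurableType d} (n : nat).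

Let coord (i : 'I_n) (x : 'rV[T]_n) : T := x ord0 i.

Let rV_set0 : g_sigma_preimage coord set0.
Proof. exact: sigma_algebra0. Qed.

Let rV_setC A : g_sigma_preimage coord A -> g_sigma_preimage coord (~` A).
Proof. exact: sigma_algebraC. Qed.

Let rV_bigcup (F : (set 'rV[T]_n)^nat) :
  (forall i, g_sigma_preimage coord (F i)) ->
  g_sigma_preimage coord (\bigcup_i (F i)).
Proof. exact: sigma_algebra_bigcup. Qed.

HB.instance Definition _ := @isMeasurable.Build (measure_tuple_display d)
  'rV[T]_n (g_sigma_preimage coord) rV_set0 rV_setC rV_bigcup.

End measurable_rV.

Definition snoc (T : Type) (n : nat) (x : 'rV[T]_n * T) : 'rV[T]_n.+1 :=
  \row_(i < n.+1) oapp (fun j : 'I_n => x.1 ord0 j) x.2 (unlift ord_max i).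

Lemma measurable_snoc d (T : measurableType d) (n : nat) :
  measurable_fun setT (@snoc T n).
Proof.
have mcoord (i : 'I_n) (Y : set T) : measurable Y ->
    measurable [set x : 'rV[T]_n | Y (x ord0 i)].
  move=> mY; apply: sub_sigma_algebra; rewrite -bigcup_seq/=.
  by exists i => /=; [rewrite mem_index_enum | exists Y; rewrite ?setTI].
have sub : g_sigma_preimage (fun (i : 'I_n.+1) x => @snoc T n x ord0 i)
    `<=` measurable.
  apply: smallest_sub; first exact: sigma_algebra_measurable.
  rewrite -bigcup_seq/=; apply: bigcup_sub => i _ A [B mB <-].
  case: (unliftP ord_max i) => [j|] ->.
    have -> : (fun x => @snoc T n x ord0 (lift ord_max j))
        = (fun x => x.1 ord0 j) by apply/funext => x; rewrite mxE liftK.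
    exact: (measurable_fst measurableT _ (mcoord j B mB)).
  have -> : (fun x => @snoc T n x ord0 ord_max) = snd.
    by apply/funext => x; rewrite mxE unlift_none.
  exact: measurable_snd.
move=> _ A mA; rewrite setTI; apply: sub.
rewrite (g_sigma_preimage_comp (fun (i : 'I_n.+1) (x : 'rV[T]_n.+1) => x ord0 i)).
by exists A => //; rewrite setTI.
Qed.

Section lebesgue_rV.
Local Open Scope ereal_scope.
Variable R : realType.

Definition leb_snoc (n : nat) (mu : {measure set 'rV[R]_n -> \bar R}) :
    set 'rV[R]_n.+1 -> \bar R :=
  pushforward (mu \x @lebesgue_measure R) (@snoc R n).

Section leb_snoc_measure.
Variables (n : nat) (mu : {measure set 'rV[R]_n -> \bar R}).

Let msnoc : @measurable_fun _ _ ('rV[R]_n * measurableTypeR R)%type 'rV[R]_n.+1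
  setT (@snoc R n).
Proof. exact: measurable_snoc. Qed.

Let leb_snoc0 : leb_snoc mu set0 = 0.
Proof. by rewrite /leb_snoc /pushforward preimage_set0 measure0. Qed.

Let leb_snoc_ge0 A : 0 <= leb_snoc mu A.
Proof. exact: measure_ge0. Qed.

Let leb_snoc_sigma_additive : semi_sigma_additive (leb_snoc mu).
Proof.
move=> F mF tF mUF; rewrite /leb_snoc /pushforward preimage_bigcup.
apply: measure_semi_sigma_additive.
- by move=> k; rewrite -[X in measurable X]setTI; exact: msnoc.
- apply/trivIsetP => /= i j _ _ ij; rewrite -preimage_setI.
  by move/trivIsetP : tF => /(_ _ _ _ _ ij) ->//; rewrite preimage_set0.
- by rewrite -preimage_bigcup -[X in measurable X]setTI; exact: msnoc.
Qed.

HB.instance Definition _ := isMeasure.Build _ _ _ (leb_snoc mu)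
  leb_snoc0 leb_snoc_ge0 leb_snoc_sigma_additive.

End leb_snoc_measure.

(** Lebesgue measure on [R^n], as an iterated product along
    [R^(n+1) = R^n x R]; [leb_box] is the usual characterisation. *)
Fixpoint leb (n : nat) : {measure set 'rV[R]_n -> \bar R} :=
  match n with
  | 0%N => dirac (0%R : 'rV[R]_0)
  | m.+1 => leb_snoc (leb m)
  end.

Lemma leb_box (n : nat) (a b : 'rV[R]_n) : (forall i, a ord0 i <= b ord0 i)%R ->
  leb n [set x | forall i, a ord0 i < x ord0 i <= b ord0 i]%R =
  (\prod_(i < n) (b ord0 i - a ord0 i))%:E.
Proof.
elim: n a b => [|n IH] a b ab.
  rewrite big_ord0 /= diracE mem_set//; by case.
rewrite big_ord_recr/=.
rewrite -[LHS]/((leb n \x @lebesgue_measure R) (@snoc R n @^-1`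
  [set x | forall i, a ord0 i < x ord0 i <= b ord0 i]%R)).
pose l (x : 'rV[R]_n.+1) : 'rV[R]_n := \row_i x ord0 (widen_ord (leqnSn n) i).
have liftE (i : 'I_n) : lift ord_max i = widen_ord (leqnSn n) i.
  by apply/val_inj; rewrite /= /bump leqNgt ltn_ord.
rewrite (_ : @snoc R n @^-1` _ =
  [set x : 'rV[R]_n | forall i, l a ord0 i < x ord0 i <= l b ord0 i]%R `*`
  `]a ord0 ord_max, b ord0 ord_max]%classic); last first.
  apply/seteqP; split=> [[x t]/= H|[x t]/= [H1 H2] i].
    split=> [i|]; last first.
      by move: (H ord_max); rewrite mxE unlift_none in_itv.
    by move: (H (lift ord_max i)); rewrite !mxE liftK/= liftE.
  case: (unliftP ord_max i) => [j|] ->; rewrite mxE.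
    by rewrite liftK/= liftE; move: (H1 j); rewrite !mxE.
  by rewrite unlift_none/=; move: H2; rewrite in_itv.
rewrite product_measure1E//; last first.
  rewrite (_ : [set x | _] = \bigcap_(i in [set: 'I_n])
     [set x : 'rV[R]_n | `]l a ord0 i, l b ord0 i]%classic (x ord0 i)]); last first.
    apply/seteqP; split=> [x/= H i _/=|x/= H i]; first by rewrite in_itv/=.
    by have := H i Logic.I; rewrite /= in_itv.
  apply: fin_bigcap_measurable => // i _; apply: sub_sigma_algebra.
  rewrite -bigcup_seq/=; exists i; first by rewrite /= mem_index_enum.
  by exists (`]l a ord0 i, l b ord0 i]%classic); rewrite ?setTI.
rewrite IH => [|i]; last by rewrite !mxE.
rewrite [X in _ * X = _]lebesgue_measure_itv/= lte_fin.
have -> : (\prod_(i < n) (l b ord0 i - l a ord0 i) =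
  \prod_(i < n) (b ord0 (widen_ord (leqnSn n) i) - a ord0 (widen_ord (leqnSn n) i)))%R.
  by apply: eq_bigr => i _; rewrite !mxE.
rewrite EFinM; congr (_ * _).
by case: ltP => // /(conj (ab ord_max))/andP/le_anti->; rewrite subrr.
Qed.

End lebesgue_rV.

(** A complex Banach space of functions is presented by the ambient space of
    all functions, the set of its members and its norm on members.  Members at
    distance 0 (almost everywhere equal functions) are identified: this is
    [sn_eq], and linearity and uniqueness below are stated up to [sn_eq]. *)
Record snSpace (R : realType) := SNSpace {
  sn_car :> lmodType R[i];
  sn_mem : set sn_car;
  sn_norm : sn_car -> R
}.
Arguments sn_mem {R} s _.
Arguments sn_norm {R} s _.

Definition sn_eq (R : realType) (X : snSpace R) (f g : X) : Prop :=
  sn_norm X (f - g) = 0.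

(** Norms of finite products are sums of the norms of the components. *)
Definition sn_prod (R : realType) (X Y : snSpace R) : snSpace R :=
  @SNSpace R (X * Y)%type
    [set f | sn_mem X f.1 /\ sn_mem Y f.2]
    (fun f => sn_norm X f.1 + sn_norm Y f.2).

Notation "X \xs Y" := (sn_prod X Y) (at level 40, left associativity).

Definition sn_pow (R : realType) (I : finType) (X : snSpace R) : snSpace R :=
  @SNSpace R (I -> X)
    [set f | forall i, sn_mem X (f i)]
    (fun f => \sum_i sn_norm X (f i)).

Section operators.
Variables (R : realType) (X Y : snSpace R).
Implicit Types (T : X -> Y) (S : R[i] -> X -> Y) (U : set R[i]).

Definition bounded_linear T : Prop :=
  [/\ forall f, sn_mem X f -> sn_mem Y (T f),
      forall (a : R[i]) f g, sn_mem X f -> sn_mem X g ->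
        sn_eq (T (a *: f + g)) (a *: T f + T g)
    & exists M : R, forall f, sn_mem X f -> sn_norm Y (T f) <= M * sn_norm X f].

(** [T] is the derivative of [S] at [l] in the operator norm of L(X, Y). *)
Definition is_op_deriv S (l : R[i]) T : Prop :=
  bounded_linear T /\
  forall e : R, 0 < e -> exists2 r : R, 0 < r &
    forall h : R[i], 0 < Normc.normc h < r -> forall f, sn_mem X f ->
      sn_norm Y (S (l + h) f - S l f - h *: T f) <= e * Normc.normc h * sn_norm X f.

(** Meant for open [U]: the derivative at [l] looks at a full neighbourhood. *)
Definition Hol U S : Prop :=
  forall l, U l -> bounded_linear (S l) /\ exists T, is_op_deriv S l T.

(** The derivative of [S], chosen up to [sn_eq]; 0 where there is none. *)
Definition op_deriv S (l : R[i]) : X -> Y :=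
  xget (fun=> 0) [set T | is_op_deriv S l T].

Definition euler_deriv (k : nat) S : R[i] -> X -> Y :=
  iter k (fun S' l f => l *: op_deriv S' l f) S.

Definition op_family U S : set (X -> Y) := [set S l | l in U].

Definition rademacher (j : nat) (u : R) : R := Num.sg (sin (2 ^+ j * pi * u)).

(** The indices [1, ..., m] are [j.+1] for [j < m]. *)
Definition R_bounded_by (p : R) (F : set (X -> Y)) (c : R) : Prop :=
  forall (m : nat) (T : 'I_m -> X -> Y) (f : 'I_m -> X),
    (forall j, F (T j)) -> (forall j, sn_mem X (f j)) ->
    (\int[@lebesgue_measure R]_(u in `[0%R, 1%R])
       (sn_norm Y (\sum_(j < m) (rademacher j.+1 u)%:C *: T j (f j)) `^ p))
      `^ p^-1
    <= c *
    (\int[@lebesgue_measure R]_(u in `[0%R, 1%R])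
       (sn_norm X (\sum_(j < m) (rademacher j.+1 u)%:C *: f j) `^ p)) `^ p^-1.

(** The R-bound; it is [+oo] iff the family is not R-bounded. *)
Definition R_bound (p : R) (F : set (X -> Y)) : \bar R :=
  ereal_inf [set c%:E | c in [set c : R | 0 < c /\ R_bounded_by p F c]].

End operators.

Section sectors.
Variable R : realType.
Implicit Types z l : R[i].

(** The argument in ]-pi, pi] of [z != 0]. *)
Definition carg z : R :=
  if 0 <= complex.Im z then acos (complex.Re z / Normc.normc z)
  else - acos (complex.Re z / Normc.normc z).

Definition sector (sigma delta : R) : set R[i] :=
  [set l | `|carg l| < pi - sigma /\ delta < Normc.normc l].

Definition eta_w (mu nu kappa : R) : R :=
  ((mu + nu) / (2 * kappa)) ^+ 2 - kappa^-1.

Definition sigma_w (mu nu kappa : R) : R :=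
  if 0 <= eta_w mu nu kappa then 0
  else carg ((mu + nu) / (2 * kappa) +i* Num.sqrt `|eta_w mu nu kappa|).

End sectors.

Section function_spaces.
Variable R : realType.

Definition Lq_fin (n : nat) (G : set 'rV[R]_n) (q : R) (f : 'rV[R]_n -> R[i]) :
    \bar R :=
  'N[leb R n]_(q%:E)[(fun x => (Normc.normc (f x))%:E) \_ G]%E.

(** Functions are defined on all of [R^n], but only their values on [G]
    matter. *)
Definition Lq (n : nat) (G : set 'rV[R]_n) (q : R) : snSpace R :=
  @SNSpace R ('rV[R]_n -> R[i])
    [set f | [/\ measurable_fun G (fun x => complex.Re (f x)),
                measurable_fun G (fun x => complex.Im (f x))
              & (Lq_fin G q f < +oo)%E]]
    (fun f => fine (Lq_fin G q f)).

Variable n : nat.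
Local Notation N := n.+1.
Local Notation "'Rn'" := 'rV[R]_N.
Implicit Types (G : set Rn) (q : R) (s : seq 'I_N).

(** Classical partial derivatives: [pderivs [:: i; j] phi] is
    [\partial_i \partial_j phi]. *)
Definition pderivs s (phi : Rn -> R) : Rn -> R :=
  foldr (fun i g x => 'D_('e_i) g x) phi s.

Definition smooth (phi : Rn -> R) : Prop :=
  forall s, continuous (pderivs s phi) /\
    forall (i : 'I_N) x, derivable (pderivs s phi) x 'e_i.

Definition test_fun G (phi : Rn -> R) : Prop :=
  smooth phi /\
  exists2 K : set Rn, compact K /\ K `<=` G & forall x, ~ K x -> phi x = 0.

Definition loc_integrable G (f : Rn -> R[i]) : Prop :=
  forall K : set Rn, compact K -> K `<=` G ->
    (leb R N).-integrable K (fun x => (complex.Re (f x))%:E) /\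
    (leb R N).-integrable K (fun x => (complex.Im (f x))%:E).

Definition Cintegral G (f : Rn -> R[i]) : R[i] :=
  (\int[leb R N]_(x in G) complex.Re (f x))
  +i* (\int[leb R N]_(x in G) complex.Im (f x)).

(** [g] is the weak derivative of [f] on [G] along the indices [s]. *)
Definition is_weak_deriv G s (f g : Rn -> R[i]) : Prop :=
  [/\ loc_integrable G f, loc_integrable G g
    & forall phi, test_fun G phi ->
        Cintegral G (fun x => f x * (pderivs s phi x)%:C) =
        (-1) ^+ size s * Cintegral G (fun x => g x * (phi x)%:C)].

(** A representative of the weak derivative, 0 if there is none. *)
Definition wderiv G s (f : Rn -> R[i]) : Rn -> R[i] :=
  xget (fun=> 0) [set g | is_weak_deriv G s f g].

(** The norm is [\sum_(k <= m) |nabla^k f|_q], where [nabla^k f] has one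
    component per ordered [k]-tuple of indices. *)
Definition Wmq G (m : nat) q : snSpace R :=
  @SNSpace R (Rn -> R[i])
    [set f | sn_mem (Lq G q) f /\
       forall s, (size s <= m)%N ->
         exists2 g, is_weak_deriv G s f g & sn_mem (Lq G q) g]
    (fun f => \sum_(k < m.+1) \sum_(t : k.-tuple 'I_N)
                sn_norm (Lq G q) (wderiv G t f)).

Definition vec (X : snSpace R) := sn_pow 'I_N X.
Definition mat (X : snSpace R) := sn_pow ('I_N * 'I_N)%type X.
Definition ten (X : snSpace R) := sn_pow ('I_N * 'I_N * 'I_N)%type X.

Definition Xq G q : snSpace R :=
  Wmq G 1 q \xs vec (Lq G q) \xs vec (Wmq G 1 q) \xs Wmq G 2 q.

(** (d, f, nabla g, lambda^(1/2) g, nabla^2 h, nabla lambda^(1/2) h,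
    lambda h) *)
Definition fXq G q : snSpace R :=
  Wmq G 1 q \xs vec (Lq G q) \xs mat (Lq G q) \xs vec (Lq G q)
    \xs mat (Lq G q) \xs vec (Lq G q) \xs Lq G q.

Definition fAq G q : snSpace R :=
  ten (Lq G q) \xs mat (Lq G q) \xs Wmq G 1 q.

Definition fBq G q : snSpace R :=
  ten (Lq G q) \xs mat (Lq G q) \xs vec (Lq G q).

(** [sqrtc] is the principal branch of the square root. *)
Definition Fl G q (l : R[i]) (F : Xq G q) : fXq G q :=
  let: (d, f, g, h) := F in
  (d, f,
   fun ij => wderiv G [:: ij.1] (g ij.2),
   sqrtc l *: g,
   fun ij => wderiv G [:: ij.1; ij.2] h,
   fun i => wderiv G [:: i] (sqrtc l *: h),
   l *: h).

Definition Sl G q (l : R[i]) (rho : Wmq G 3 q) : fAq G q :=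
  (fun ijk => wderiv G [:: ijk.1.1; ijk.1.2; ijk.2] rho,
   fun ij => sqrtc l *: wderiv G [:: ij.1; ij.2] rho,
   l *: rho).

Definition Tl G q (l : R[i]) (u : vec (Wmq G 2 q)) : fBq G q :=
  (fun ijk => wderiv G [:: ijk.1.1; ijk.1.2] (u ijk.2),
   fun ij => sqrtc l *: wderiv G [:: ij.1] (u ij.2),
   l *: u).

Definition half_space : set Rn := [set x | 0 < x ord0 ord_max].

(** The trace on the boundary [x_N = 0] of [w \in W^1_q], as the continuous
    extension of the restriction map from smooth functions: [b] is the trace of
    [w] if [w] is a limit in [W^1_q] of restrictions to the half-space of
    compactly supported smooth functions on [R^N], whose boundary values tend to
    [b] in [L_q(R^(N-1))], the boundary being parametrised by [x' -> (x', 0)]. *)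
Definition has_trace q (w : Rn -> R[i]) (b : 'rV[R]_n -> R[i]) : Prop :=
  exists phi : nat -> Rn -> R[i],
    [/\ forall k, test_fun setT (fun x => complex.Re (phi k x)) /\
                  test_fun setT (fun x => complex.Im (phi k x)),
        (fun k => sn_norm (Wmq half_space 1 q) (phi k - w)) @ \oo --> (0 : R)
      & (fun k => sn_norm (Lq [set: 'rV[R]_n] q)
           ((fun x => phi k (snoc (x, 0))) - b)) @ \oo --> (0 : R)].

Definition eq_bdry q (v w : Rn -> R[i]) : Prop := has_trace q (v - w) (fun=> 0).

Definition eq_int (v w : Rn -> R[i]) : Prop :=
  {ae leb R N, forall x, half_space x -> v x = w x}.

Local Notation dd i f := (wderiv half_space [:: i] f).

Implicit Types (f rho : Rn -> R[i]) (u : 'I_N -> Rn -> R[i]).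

Definition grad rho : 'I_N -> Rn -> R[i] := fun i => dd i rho.
Definition dvg u : Rn -> R[i] := \sum_j dd j (u j).
Definition lap f : Rn -> R[i] := \sum_j dd j (dd j f).
Definition Dsym u (i j : 'I_N) : Rn -> R[i] := dd i (u j) + dd j (u i).

(** The unit outer normal [(0, ..., 0, -1)]. *)
Definition normal (i : 'I_N) : R[i] := if i == ord_max then -1 else 0.

Definition gkop (gamma kappa : R) f : Rn -> R[i] :=
  gamma%:C *: f - kappa%:C *: lap f.

Definition stress (mu nu gamma kappa : R) rho u (i j : 'I_N) : Rn -> R[i] :=
  mu%:C *: Dsym u i j
  + (if i == j then (nu - mu)%:C *: dvg u - gkop gamma kappa rho else 0).

Definition solves (q mu nu gamma kappa : R) (l : R[i]) (F : Xq half_space q)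
    rho u : Prop :=
  let: (d, f, g, h) := F in
  [/\ eq_int (l *: rho + dvg u) d,
      forall i, eq_int
        (l *: u i - mu%:C *: lap (u i) - nu%:C *: grad (dvg u) i
         + gkop gamma kappa (grad rho i)) (f i),
      forall i, eq_bdry q
        (\sum_j normal j *: stress mu nu gamma kappa rho u i j) (g i)
    & eq_bdry q (\sum_j normal j *: grad rho j) h].

Definition unique_solution (q mu nu gamma kappa : R) (l : R[i])
    (F : Xq half_space q)
    (rho : Wmq half_space 3 q) (u : vec (Wmq half_space 2 q)) : Prop :=
  let E := Wmq half_space 3 q \xs vec (Wmq half_space 2 q) in
  [/\ sn_mem E (rho, u), solves mu nu gamma kappa l F rho u
    & forall (rho' : Wmq half_space 3 q) (u' : vec (Wmq half_space 2 q)),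
        sn_mem E (rho', u') -> solves mu nu gamma kappa l F rho' u' ->
        @sn_eq R E (rho', u') (rho, u)].

Definition solution_operators (q mu nu gamma kappa sigma delta : R)
    (A : R[i] -> fXq half_space q -> Wmq half_space 3 q)
    (B : R[i] -> fXq half_space q -> vec (Wmq half_space 2 q)) : Prop :=
  [/\ Hol (sector sigma delta) A, Hol (sector sigma delta) B
    & forall (F : Xq half_space q) l,
        sn_mem (Xq half_space q) F -> sector sigma delta l ->
        unique_solution mu nu gamma kappa l F (A l (Fl l F)) (B l (Fl l F))].

Definition R_bounds_le (p q sigma delta c : R)
    (A : R[i] -> fXq half_space q -> Wmq half_space 3 q)
    (B : R[i] -> fXq half_space q -> vec (Wmq half_space 2 q)) : Prop :=
  forall k : nat, (k <= 1)%N ->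
    (R_bound p (op_family (sector sigma delta)
       (euler_deriv k (fun l F => Sl l (A l F)))) <= c%:E)%E /\
    (R_bound p (op_family (sector sigma delta)
       (euler_deriv k (fun l F => Tl l (B l F)))) <= c%:E)%E.

(** [sigma_star] and [c q delta sigma] are constants as furnished by the result
    for [gamma = 0], R-bounds being computed with the exponent [p]. *)
Definition gamma0_constants (p mu nu kappa sigma_star : R) (c : R -> R -> R -> R) :
    Prop :=
  sigma_w mu nu kappa < sigma_star < pi / 2 /\
  forall q delta sigma : R, 1 < q -> 0 < delta -> sigma_star < sigma < pi / 2 ->
    0 < c q delta sigma /\
    exists A B, @solution_operators q mu nu 0 kappa sigma delta A B /\
      R_bounds_le p sigma delta (c q delta sigma) A B.

End function_spaces.

(* Main.v *)
Require Import Defs.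
From mathcomp Require Import all_boot all_order all_algebra.
From mathcomp Require Import complex.
From mathcomp Require Import all_classical all_reals all_analysis.
From mathcomp Require Import measurable_realfun.
From mathcomp Require Import ring lra.

Set Implicit Arguments.
Unset Strict Implicit.
Unset Printing Implicit Defensive.

Import Order.TTheory GRing.Theory Num.Theory.
Import numFieldNormedType.Exports.

Local Open Scope classical_set_scope.
Local Open Scope ring_scope.
Local Open Scope complex_scope.
Import Normc.

(** The system with [gamma] is a perturbation of the system without. Let [A0] and [B0] be the
solution operators for [gamma = 0], write [F_l] for [Fl l], and let [h] be an element of the
space [fXq] in which the transformed data [F_l F] live. If the terms with [gamma] of
[rho = A0(l) h] are moved to the right-hand side, the data [F] become
[F - (0, gamma grad rho, - gamma n rho, 0)]. With
<<
  T(l) h = F_l (0, gamma grad rho, - gamma n rho, 0),   rho = A0(l) h,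
>>
the pair [(A0(l) h, B0(l) h)] hence solves the full system for [F] as soon as
[h + T(l) h = F_l F], and the operators of the theorem are [A = A0 (1 + T)^-1] and
[B = B0 (1 + T)^-1].

The perturbation is small for large [l]. In terms of [l rho], which is a component of
[S_l A0(l) h] and so controlled by [c0], it is the sum of [1 / l] times the operator
[lot_grad] and of [1 / sqrt l] times the operator [lot_bdry], whose norms are at most
[2 |gamma|] and [|gamma|] in every dimension. By Kahane's contraction principle
([rad_contract]) the families [T] and [l T'] have R-bounds at most 1/2 on the sector
[|l| > lambda0] if [lambda0 = (1 + 24 |gamma| c0)^2]. Then [(1 + T)^-1] has R-bound at most 2
([Rbd_inverse]), and since its derivative is [- (1 + T)^-1 T' (1 + T)^-1]
([deriv_on_inverse]), the R-bounds of the composite families and of their Euler derivatives are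
at most [2 c0] and [4 c0] ([Rbd_perturbed], [Rbd_perturbed_deriv]). Rademacher integrals are
handled as averages over signs ([integral_rademachers]).

The inverse of [1 + T(l)] is a Neumann series ([neumann]). The first component of [T(l) h] is 0,
and the others are sequences of functions in [L_q], so that the completeness of [L_q]
([riesz_fischer]) makes the series converge.

Two points are specific to the concrete function spaces. Their elements are functions, equal up
to null functions only, and all operator identities hold in this sense ([sn_eq]). Weak
derivatives are chosen representatives; their uniqueness almost everywhere
([is_weak_deriv_unique], from [du_bois_reymond]) makes them linear and bounded in the function,
and turns the Sobolev spaces into seminormed spaces. Moreover equivalent functions have the same
chosen derivatives ([wderiv_ext]): for [gamma = 0] a solution can therefore be replaced by an
equivalent one ([solves_ext]). The passage between the systems for [gamma] and for 0 keeps the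
solution and changes the data, and it changes both sides of the boundary condition by the same
function ([solves_lot]). *)

(** * Linear identities in modules *)

Section module_expressions.
Variables (K : comNzRingType) (V : lmodType K).

Inductive lexp :=
  LVar of nat | LZero | LAdd of lexp & lexp | LOpp of lexp | LScale of K & lexp.

Fixpoint leval (env : seq V) (e : lexp) : V :=
  match e with
  | LVar i => env`_i
  | LZero => 0
  | LAdd e1 e2 => leval env e1 + leval env e2
  | LOpp e1 => - leval env e1
  | LScale a e1 => a *: leval env e1
  end.

Fixpoint lcoef (e : lexp) (i : nat) : K :=
  match e with
  | LVar j => if Nat.eqb j i then 1 else 0
  | LZero => 0
  | LAdd e1 e2 => lcoef e1 i + lcoef e2 i
  | LOpp e1 => - lcoef e1 i
  | LScale a e1 => a * lcoef e1 i
  end.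

Fixpoint lcoefs_eq (n : nat) (e1 e2 : lexp) : Prop :=
  match n with
  | 0 => True
  | n'.+1 => lcoef e1 n' = lcoef e2 n' /\ lcoefs_eq n' e1 e2
  end.

Lemma leval_coef env e :
  leval env e = \sum_(i < size env) lcoef e i *: env`_i.
Proof.
elim: e => [j||e1 IH1 e2 IH2|e IH|a e IH] /=.
- have [jlt|jge] := ltnP j (size env).
    rewrite (bigD1 (Ordinal jlt)) //= PeanoNat.Nat.eqb_refl scale1r big1 ?addr0// => i ij.
    case: PeanoNat.Nat.eqb_spec => [ji|]; last by rewrite scale0r.
    by move/eqP: ij; case; apply/val_inj.
  rewrite nth_default// big1// => i _.
  case: PeanoNat.Nat.eqb_spec => [ji|]; last by rewrite scale0r.
  by move: (ltn_ord i); rewrite -ji ltnNge jge.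
- by rewrite big1// => i _; rewrite scale0r.
- by rewrite IH1 IH2 -big_split; apply: eq_bigr => i _; rewrite scalerDl.
- by rewrite IH -sumrN; apply: eq_bigr => i _; rewrite scaleNr.
- by rewrite IH scaler_sumr; apply: eq_bigr => i _; rewrite scalerA.
Qed.

Lemma leval_eq env e1 e2 :
  lcoefs_eq (size env) e1 e2 -> leval env e1 = leval env e2.
Proof.
rewrite !leval_coef => H; apply: eq_bigr => -[i ilt] _ /=.
suff -> : lcoef e1 i = lcoef e2 i by [].
elim: (size env) H i ilt => // n IH [H0 H] i; rewrite ltnS leq_eqVlt.
by case/predU1P => [->//|]; exact: IH.
Qed.

End module_expressions.

Ltac lmod_mem x l :=
  lazymatch l with
  | nil => constr:(false)
  | cons x _ => constr:(true)
  | cons _ ?l' => lmod_mem x l'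
  end.
Ltac lmod_index x l :=
  lazymatch l with
  | cons x _ => constr:(0%N)
  | cons _ ?l' => let n := lmod_index x l' in constr:(S n)
  end.
Ltac lmod_atoms t l :=
  lazymatch t with
  | (?a + ?b)%R => let l1 := lmod_atoms a l in lmod_atoms b l1
  | (- ?a)%R => lmod_atoms a l
  | (_ *: ?a)%R => lmod_atoms a l
  | 0%R => l
  | _ => let b := lmod_mem t l in
         lazymatch b with true => l | false => constr:(cons t l) end
  end.
Ltac lmod_quote K t l :=
  lazymatch t with
  | (?a + ?b)%R => let x := lmod_quote K a l in let y := lmod_quote K b l in
                   constr:(@LAdd K x y)
  | (- ?a)%R => let x := lmod_quote K a l in constr:(@LOpp K x)
  | (?c *: ?a)%R => let x := lmod_quote K a l in constr:(@LScale K c x)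
  | 0%R => constr:(@LZero K)
  | _ => let n := lmod_index t l in constr:(@LVar K n)
  end.
(** Equality of the coefficients suffices, whatever relations hold between the atoms; each
    coefficient equation is left to [ring]. *)
Ltac lmod K V :=
  lazymatch goal with
  | |- ?a = ?b =>
    let l := lmod_atoms a (@nil V) in
    let l := lmod_atoms b l in
    let x := lmod_quote K a l in
    let y := lmod_quote K b l in
    change (@leval K _ l x = @leval K _ l y);
    apply: leval_eq; cbn [lcoefs_eq size lcoef Nat.eqb]; repeat split; try ring
  end.

(** * Seminormed spaces and bounded operators up to null elements *)

(** The norms of the function spaces are not definite: functions that agree almost everywhere
    are at distance 0. *)
Record seminormed (R : realType) (X : snSpace R) : Prop := Seminormed {
  mem0 : sn_mem X 0;
  memL : forall (a : R[i]) f g, sn_mem X f -> sn_mem X g -> sn_mem X (a *: f + g);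
  norm_ge0 : forall f, sn_mem X f -> 0 <= sn_norm X f;
  normD : forall f g, sn_mem X f -> sn_mem X g ->
    sn_norm X (f + g) <= sn_norm X f + sn_norm X g;
  normZ : forall (a : R[i]) f, sn_mem X f ->
    sn_norm X (a *: f) = normc a * sn_norm X f
}.

Ltac lmodR := lazymatch goal with |- @eq ?T _ _ =>
  lazymatch T with context [@sn_car ?R ?X] => lmod (R[i]) (sn_car X) end end.

Section seminormed_theory.
Variables (R : realType) (X : snSpace R) (sX : seminormed X).
Implicit Types (f g h : X) (a : R[i]).
Local Notation mem := (sn_mem X).
Local Notation N := (sn_norm X).

Lemma memD f g : mem f -> mem g -> mem (f + g).
Proof. by move=> mf mg; rewrite -[f]scale1r; exact: memL. Qed.

Lemma memZ a f : mem f -> mem (a *: f).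
Proof. by move=> mf; rewrite -[_ *: _]addr0; apply: memL => //; exact: mem0. Qed.

Lemma memN f : mem f -> mem (- f).
Proof. by move=> mf; rewrite -scaleN1r; exact: memZ. Qed.

Lemma memB f g : mem f -> mem g -> mem (f - g).
Proof. by move=> mf mg; apply: memD => //; exact: memN. Qed.

Lemma mem_sum (I : Type) (r : seq I) (P : pred I) (F : I -> X) :
  (forall i, P i -> mem (F i)) -> mem (\sum_(i <- r | P i) F i).
Proof. by move=> mF; elim/big_ind: _ => //; [exact: mem0|exact: memD]. Qed.

Lemma norm0 : N 0 = 0.
Proof. by rewrite -(scale0r (0 : X)) normZ ?normc0 ?mul0r//; exact: mem0. Qed.

Lemma normN f : mem f -> N (- f) = N f.
Proof. by move=> mf; rewrite -scaleN1r normZ// normcN normc1 mul1r. Qed.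

Lemma normB f g : mem f -> mem g -> N (f - g) <= N f + N g.
Proof. by move=> mf mg; rewrite -(normN mg); apply: normD => //; exact: memN. Qed.

Lemma norm_subC f g : mem f -> mem g -> N (f - g) = N (g - f).
Proof. by move=> mf mg; rewrite -opprB normN//; exact: memB. Qed.

Lemma norm_sum (I : Type) (r : seq I) (P : pred I) (F : I -> X) :
  (forall i, P i -> mem (F i)) ->
  N (\sum_(i <- r | P i) F i) <= \sum_(i <- r | P i) N (F i).
Proof.
move=> mF; suff: mem (\sum_(i <- r | P i) F i) /\
  N (\sum_(i <- r | P i) F i) <= \sum_(i <- r | P i) N (F i) by case.
elim/big_ind2: _ => [|x1 x2 y1 y2 [? H1] [? H2]|i Pi]; last by split=> //; exact: mF.
  by split; [exact: mem0|rewrite norm0].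
split; first exact: memD.
by apply: le_trans (lerD H1 H2); exact: normD.
Qed.

Lemma sn_eq_refl f : sn_eq f f.
Proof. by rewrite /sn_eq subrr norm0. Qed.

Lemma sn_eq_sym f g : mem f -> mem g -> sn_eq f g -> sn_eq g f.
Proof. by rewrite /sn_eq => mf mg; rewrite norm_subC. Qed.

Lemma sn_eq_trans g f h : mem f -> mem g -> mem h ->
  sn_eq f g -> sn_eq g h -> sn_eq f h.
Proof.
rewrite /sn_eq => mf mg mh fg gh; apply/eqP.
rewrite eq_le norm_ge0 ?andbT; [|by []|exact: memB].
have -> : f - h = (f - g) + (g - h) by lmodR.
by rewrite (le_trans (normD sX _ _))// ?fg ?gh ?addr0//; exact: memB.
Qed.

Lemma le_norm_eq f g : mem f -> mem g -> sn_eq f g -> N f <= N g.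
Proof.
move=> mf mg fg; have -> : f = (f - g) + g by lmodR.
by rewrite (le_trans (normD sX _ _)) ?fg ?add0r//; exact: memB.
Qed.

Lemma norm_eq f g : mem f -> mem g -> sn_eq f g -> N f = N g.
Proof.
move=> mf mg fg; apply/eqP; rewrite eq_le le_norm_eq//=.
by rewrite le_norm_eq//; exact: sn_eq_sym.
Qed.

Lemma sn_eqD f f' g g' : mem f -> mem f' -> mem g -> mem g' ->
  sn_eq f f' -> sn_eq g g' -> sn_eq (f + g) (f' + g').
Proof.
rewrite /sn_eq => mf mf' mg mg' ff' gg'; apply/eqP.
rewrite eq_le norm_ge0 ?andbT; [|by []|by apply: memB; exact: memD].
have -> : f + g - (f' + g') = (f - f') + (g - g') by lmodR.
by rewrite (le_trans (normD sX _ _)) ?ff' ?gg' ?addr0//; exact: memB.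
Qed.

Lemma sn_eqZ a f g : mem f -> mem g -> sn_eq f g -> sn_eq (a *: f) (a *: g).
Proof.
rewrite /sn_eq => mf mg fg.
by rewrite -scalerBr normZ// ?fg ?mulr0//; exact: memB.
Qed.

Lemma sn_eqN f g : mem f -> mem g -> sn_eq f g -> sn_eq (- f) (- g).
Proof.
move=> mf mg fg; rewrite -[- f]scaleN1r -[- g]scaleN1r; exact: sn_eqZ.
Qed.

End seminormed_theory.

(** Membership of linear combinations of known members. *)
Ltac memt := repeat first [assumption | apply: memD | apply: memB | apply: memZ |
  apply: memN | apply: mem0].

Section bounded_operators.
Variables (R : realType) (X Y : snSpace R).
Hypotheses (sX : seminormed X) (sY : seminormed Y).
Implicit Types T : X -> Y.

Lemma bl_mem T f : bounded_linear T -> sn_mem X f -> sn_mem Y (T f).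
Proof. by case=> + _ _; exact. Qed.

Lemma bl_bound T : bounded_linear T ->
  exists2 M : R, 0 < M & forall f, sn_mem X f -> sn_norm Y (T f) <= M * sn_norm X f.
Proof.
case=> _ _ [M HM]; exists (Num.max M 1); first by rewrite lt_max ltr01 orbT.
move=> f mf; apply: le_trans (HM f mf) _; apply: ler_wpM2r; first exact: norm_ge0.
by rewrite le_max lexx.
Qed.

Lemma bl_lin T (a : R[i]) f g : bounded_linear T -> sn_mem X f -> sn_mem X g ->
  sn_eq (T (a *: f + g)) (a *: T f + T g).
Proof. by case=> _ + _; exact. Qed.

Lemma bl_sub T f g : bounded_linear T -> sn_mem X f -> sn_mem X g ->
  sn_eq (T (f - g)) (T f - T g).
Proof.
move=> bT mf mg.
have -> : f - g = -1 *: g + f by lmodR.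
have -> : T f - T g = -1 *: T g + T f by lmodR.
exact: bl_lin.
Qed.

Lemma bl_D T f g : bounded_linear T -> sn_mem X f -> sn_mem X g ->
  sn_eq (T (f + g)) (T f + T g).
Proof.
move=> bT mf mg; rewrite -[f in T (f + _)]scale1r -[T f]scale1r.
exact: bl_lin.
Qed.

(** Linearity only holds up to null elements, so that compatibility with [sn_eq] needs the
    bound on the operator. *)
Lemma bl_eq T f g : bounded_linear T -> sn_mem X f -> sn_mem X g ->
  sn_eq f g -> sn_eq (T f) (T g).
Proof.
move=> bT mf mg fg; have [M _ HM] := bl_bound bT.
have [mTf mTg] := (bl_mem bT mf, bl_mem bT mg).
have mfg : sn_mem X (f - g) by memt.
have := HM _ mfg; rewrite fg mulr0 => H.
apply/eqP; rewrite eq_le norm_ge0 ?andbT//; last by memt.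
apply: le_trans H; apply: (le_norm_eq sY); [memt|exact: bl_mem|].
apply: (sn_eq_sym sY); [exact: bl_mem|memt|exact: bl_sub].
Qed.

(** The law for operators has no separate clause for [0]; [T 0] is null by boundedness. *)
Lemma bl_Z T a f : bounded_linear T -> sn_mem X f -> sn_eq (T (a *: f)) (a *: T f).
Proof.
move=> bT mf; have m0 := mem0 sX; have mT := bl_mem bT mf; have mT0 := bl_mem bT m0.
have T0 : sn_eq (T 0) 0.
  rewrite /sn_eq subr0; apply/eqP; rewrite eq_le norm_ge0 ?andbT//.
  have [M _ HM] := bl_bound bT.
  by rewrite (le_trans (HM _ m0))// norm0// mulr0.
have := bl_lin a bT mf m0; rewrite addr0 => H.
apply: (sn_eq_trans sY) H _; [apply: bl_mem|memt|memt|] => //; first by memt.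
rewrite -[X in sn_eq _ X]addr0; apply: (sn_eqD sY) => //; memt.
exact: sn_eq_refl.
Qed.

Lemma norm_bl_sub T f g : bounded_linear T -> sn_mem X f -> sn_mem X g ->
  sn_norm Y (T f - T g) = sn_norm Y (T (f - g)).
Proof.
move=> bT mf mg; have [mTf mTg] := (bl_mem bT mf, bl_mem bT mg).
have mfg : sn_mem X (f - g) by memt.
by apply/esym/(norm_eq sY); [exact: bl_mem|memt|exact: bl_sub].
Qed.

Lemma norm_bl_sub3 T (h : R[i]) f g k : bounded_linear T -> sn_mem X f ->
  sn_mem X g -> sn_mem X k ->
  sn_norm Y (T f - T g - h *: T k) = sn_norm Y (T (f - g - h *: k)).
Proof.
move=> bT mf mg mk; have [mTf mTg] := (bl_mem bT mf, bl_mem bT mg).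
have mTk := bl_mem bT mk.
have mfg : sn_mem X (f - g) by memt.
have mfgk : sn_mem X (f - g - h *: k) by memt.
have mTfg := bl_mem bT mfg.
have mhk : sn_mem X (h *: k) by memt.
have mThk := bl_mem bT mhk.
apply/esym/(norm_eq sY); [exact: bl_mem|memt|].
apply: (sn_eq_trans sY) (bl_sub bT mfg mhk) _; [exact: bl_mem|memt|memt|].
apply: (sn_eqD sY); memt; first exact: bl_sub.
by apply: (sn_eqN sY); memt; exact: bl_Z.
Qed.

Lemma bl_scale (a : R[i]) T : bounded_linear T -> bounded_linear (fun f => a *: T f).
Proof.
move=> bT; split=> [f mf|b f g mf mg|].
- by have := bl_mem bT mf => mTf; memt.
- have [mTf mTg] := (bl_mem bT mf, bl_mem bT mg).
  have mL : sn_mem X (b *: f + g) by memt.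
  have mTL := bl_mem bT mL.
  have -> : b *: (a *: T f) + a *: T g = a *: (b *: T f + T g) by lmodR.
  by apply: (sn_eqZ sY); memt; exact: bl_lin.
- have [M _ HM] := bl_bound bT; exists (normc a * M) => f mf.
  rewrite normZ//; last exact: bl_mem.
  by rewrite -mulrA; apply: ler_wpM2l (HM _ mf); rewrite /normc; case: (a) => *; exact: sqrtr_ge0.
Qed.

Lemma bl_add T1 T2 : bounded_linear T1 -> bounded_linear T2 ->
  bounded_linear (fun f => T1 f + T2 f).
Proof.
move=> b1 b2; split=> [f mf|b f g mf mg|].
- by have [] := (bl_mem b1 mf, bl_mem b2 mf) => *; memt.
- have [m1f m1g] := (bl_mem b1 mf, bl_mem b1 mg).
  have [m2f m2g] := (bl_mem b2 mf, bl_mem b2 mg).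
  have mL : sn_mem X (b *: f + g) by memt.
  have [m1L m2L] := (bl_mem b1 mL, bl_mem b2 mL).
  have -> : b *: (T1 f + T2 f) + (T1 g + T2 g) =
            (b *: T1 f + T1 g) + (b *: T2 f + T2 g) by lmodR.
  by apply: (sn_eqD sY); memt; exact: bl_lin.
- have [M1 _ H1] := bl_bound b1; have [M2 _ H2] := bl_bound b2.
  exists (M1 + M2) => f mf; rewrite mulrDl.
  apply: le_trans (lerD (H1 _ mf) (H2 _ mf)).
  by apply: normD => //; exact: bl_mem.
Qed.

Lemma bl_ext T T' : (forall f, sn_mem X f -> sn_mem Y (T' f)) ->
  (forall f, sn_mem X f -> sn_eq (T f) (T' f)) ->
  bounded_linear T -> bounded_linear T'.
Proof.
move=> mT' TT' bT; split=> // [b f g mf mg|].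
- have [mTf mTg] := (bl_mem bT mf, bl_mem bT mg).
  have mL : sn_mem X (b *: f + g) by memt.
  have mTL := bl_mem bT mL; have [m1 m2] := (mT' _ mf, mT' _ mg).
  have mL' := mT' _ mL.
  apply: (sn_eq_trans sY) (_ : sn_eq _ (T (b *: f + g))) _ => //; memt.
    by apply: (sn_eq_sym sY) => //; exact: TT'.
  apply: (sn_eq_trans sY) (bl_lin b bT mf mg) _; memt.
  apply: (sn_eqD sY); memt; last exact: TT'.
  by apply: (sn_eqZ sY); memt; exact: TT'.
- have [M _ HM] := bl_bound bT; exists M => f mf.
  by rewrite -(norm_eq sY _ _ (TT' _ mf)); [exact: HM|exact: bl_mem|exact: mT'].
Qed.

End bounded_operators.

Section composition.
Variables (R : realType) (X Y Z : snSpace R).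
Hypotheses (sX : seminormed X) (sY : seminormed Y) (sZ : seminormed Z).

Lemma bl_comp (T : Y -> Z) (S : X -> Y) : bounded_linear T -> bounded_linear S ->
  bounded_linear (fun f => T (S f)).
Proof.
move=> bT bS; split=> [f mf|b f g mf mg|].
- by apply: (bl_mem bT); exact: (bl_mem bS).
- have [m1 m2] := (bl_mem bS mf, bl_mem bS mg).
  have [m3 m4] := (bl_mem bT m1, bl_mem bT m2).
  have mL : sn_mem X (b *: f + g) by memt.
  have mLY : sn_mem Y (b *: S f + S g) by memt.
  have mSL := bl_mem bS mL.
  apply: (sn_eq_trans sZ) (bl_eq sY sZ bT mSL mLY (bl_lin b bS mf mg)) _ => //.
  + exact: (bl_mem bT).
  + exact: (bl_mem bT).
  + by memt.
  exact: bl_lin.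
- have [M M0 HM] := bl_bound sX bS; have [M' M'0 HM'] := bl_bound sY bT.
  exists (M' * M) => f mf; apply: le_trans (HM' _ (bl_mem bS mf)) _.
  by rewrite -mulrA; apply: ler_wpM2l (HM _ mf); exact: ltW.
Qed.

End composition.

(** * Holomorphic families of operators *)

Section scalars.
Variable R : realType.

Lemma normc_ge0 (z : R[i]) : 0 <= normc z.
Proof. by case: z => a b; exact: sqrtr_ge0. Qed.

Lemma normc_real (x : R) : normc x%:C = `|x|.
Proof. by rewrite /normc/= expr0n/= addr0 sqrtr_sqr. Qed.

Lemma normc_gt0 (z : R[i]) : (0 < normc z) = (z != 0).
Proof.
rewrite lt_neqAle normc_ge0 andbT eq_sym; congr (~~ _).
by apply/eqP/eqP => [/eq0_normc//|->]; exact: normc0.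
Qed.

Lemma le0_all_eps (a b : R) : 0 <= b -> (forall e, 0 < e -> a <= e * b) -> a <= 0.
Proof.
move=> b0 H; rewrite leNgt; apply/negP => a0.
have c0 : 0 < 2 * (b + 1) by rewrite mulr_gt0// ltr_wpDl.
have := H (a / (2 * (b + 1))) (divr_gt0 a0 c0); rewrite leNgt => /negP; apply.
rewrite mulrAC ltr_pdivrMr// ltr_pM2l//; lra.
Qed.

Lemma le_of_eq (a b : R) : a = b -> a <= b.
Proof. by move=> ->. Qed.

(** Openness in terms of the norm that measures increments in [is_op_deriv]. *)
Definition openC (U : set R[i]) := forall l, U l ->
  exists2 r : R, 0 < r & forall h, normc h < r -> U (l + h).

Definition cderiv_on (U : set R[i]) (s s' : R[i] -> R[i]) := forall l, U l ->
  forall e : R, 0 < e -> exists2 r : R, 0 < r & forall h, 0 < normc h < r ->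
    normc (s (l + h) - s l - h * s' l) <= e * normc h.

End scalars.

(** [Hol] with the derivative named, so that the rules of calculus can be stated. *)
Definition deriv_on (R : realType) (X Y : snSpace R) (U : set R[i])
    (S S' : R[i] -> X -> Y) :=
  forall l, U l -> bounded_linear (S l) /\ is_op_deriv S l (S' l).

Section derivatives.
Variables (R : realType) (X Y : snSpace R).
Hypotheses (sX : seminormed X) (sY : seminormed Y).
Variable U : set R[i].
Hypothesis oU : openC U.
Implicit Types S T : R[i] -> X -> Y.

Lemma Hol_deriv_on S : Hol U S -> deriv_on U S (op_deriv S).
Proof.
by move=> HS l /HS[bS [T HT]]; split=> //; exact: (xgetPex _ (ex_intro _ T HT)).
Qed.

Lemma deriv_on_Hol S S' : deriv_on U S S' -> Hol U S.
Proof. by move=> HS l /HS[bS HS']; split=> //; exists (S' l). Qed.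

Lemma deriv_on_sub (V : set R[i]) S S' : U `<=` V -> deriv_on V S S' -> deriv_on U S S'.
Proof. by move=> UV HS l /UV/HS. Qed.

(** Near [l] the difference quotients differ by at most 1 from the derivative, which is
    bounded. *)
Lemma deriv_lip S S' l : deriv_on U S S' -> U l ->
  exists2 M : R, 0 < M & exists2 r : R, 0 < r & forall h, normc h < r -> U (l + h) /\
    forall f, sn_mem X f ->
      sn_norm Y (S (l + h) f - S l f) <= M * normc h * sn_norm X f.
Proof.
move=> HS Ul; have [bS [bS' /(_ 1 ltr01)[r r0 Hr]]] := HS _ Ul.
have [r' r'0 Hr'] := oU Ul.
have [M M0 HM] := bl_bound sX bS'.
exists (1 + M); first lra.
exists (Num.min r r') => [|h]; first by rewrite lt_min r0.
rewrite lt_min => /andP[hr hr']; split; first exact: Hr'.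
move=> f mf; have [mS mS'] := (bl_mem bS mf, bl_mem bS' mf).
have mSh := bl_mem (HS _ (Hr' _ hr')).1 mf.
have [->|h0] := eqVneq h 0.
  rewrite addr0 subrr (norm0 sY) normc0 mulr0 mul0r//.
have h0' : 0 < normc h by rewrite normc_gt0.
have -> : S (l + h) f - S l f = (S (l + h) f - S l f - h *: S' l f) + h *: S' l f
  by lmodR.
rewrite (le_trans (normD sY _ _))//; memt.
rewrite mulrDl mulrDl; apply: lerD; first by apply: Hr => //; rewrite h0' hr.
rewrite (normZ sY)// (mulrC M) -mulrA; apply: ler_wpM2l (HM _ mf); exact: normc_ge0.
Qed.

(** Both operators are close to the difference quotient at one small increment, which exists
    since [U] is open. *)
Lemma op_deriv_unique S l (T1 T2 : X -> Y) : (forall l, U l -> bounded_linear (S l)) -> U l ->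
  is_op_deriv S l T1 -> is_op_deriv S l T2 ->
  forall f, sn_mem X f -> sn_eq (T1 f) (T2 f).
Proof.
move=> bS Ul [b1 H1] [b2 H2] f mf; have [m1 m2] := (bl_mem b1 mf, bl_mem b2 mf).
have mS := bl_mem (bS _ Ul) mf; have [r0 r00 Hr0] := oU Ul.
apply/eqP; rewrite eq_le norm_ge0 ?andbT//; last by memt.
apply: (@le0_all_eps _ _ (2 * sn_norm X f)) => [|e e0].
  by rewrite mulr_ge0// norm_ge0.
have [r1 r10 {}H1] := H1 _ e0; have [r2 r20 {}H2] := H2 _ e0.
pose r := Num.min r0 (Num.min r1 r2); have r_gt0 : 0 < r by rewrite !lt_min r00 r10.
pose h : R[i] := (r / 2)%:C.
have nh : normc h = r / 2 by rewrite normc_real ger0_norm// divr_ge0// ltW.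
have h_gt0 : 0 < normc h by rewrite nh divr_gt0.
have hr : normc h < r by rewrite nh; lra.
clearbody h => {nh}.
have : r <= r0 /\ r <= r1 /\ r <= r2 by rewrite /r !ge_min !lexx !orbT.
move=> [rr0 [rr1 rr2]].
have mSh := bl_mem (bS _ (Hr0 h (lt_le_trans hr rr0))) mf.
have := H1 h _ f mf; rewrite h_gt0 (lt_le_trans hr)//= => /(_ isT) {}H1.
have := H2 h _ f mf; rewrite h_gt0 (lt_le_trans hr)//= => /(_ isT) {}H2.
rewrite -(ler_pM2l h_gt0) -(normZ sY); last by memt.
have -> : h *: (T1 f - T2 f) = (S (l + h) f - S l f - h *: T2 f) -
                              (S (l + h) f - S l f - h *: T1 f) by lmodR.
rewrite (le_trans (normB sY _ _))//; memt.
apply: le_trans (lerD H2 H1) _; apply: le_of_eq; ring.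
Qed.

Lemma deriv_on_ext S S2 S' S2' :
  (forall l f, U l -> sn_mem X f -> [/\ sn_mem Y (S2 l f), sn_mem Y (S2' l f),
     sn_eq (S l f) (S2 l f) & sn_eq (S' l f) (S2' l f)]) ->
  deriv_on U S S' -> deriv_on U S2 S2'.
Proof.
move=> E HS l Ul; have [bS [bS' H]] := HS _ Ul; split; [|split].
- by apply: bl_ext bS => // f mf; have [] := E _ _ Ul mf.
- by apply: bl_ext bS' => // f mf; have [] := E _ _ Ul mf.
move=> e e0; have [r r0 Hr] := H _ e0; have [r' r'0 Hr'] := oU Ul.
exists (Num.min r r') => [|h]; first by rewrite lt_min r0.
rewrite lt_min => /and3P[h0 hr hr'] f mf; have Ulh := Hr' _ hr'.
have [m1 m2 E1 E2] := E _ _ Ul mf; have [m3 m4 E3 E4] := E _ _ Ulh mf.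
have [[n1 n2] n3] := (bl_mem bS mf, bl_mem bS' mf, bl_mem (HS _ Ulh).1 mf).
apply: (@le_trans _ _ (sn_norm Y (S (l + h) f - S l f - h *: S' l f))); last first.
  by apply: Hr => //; rewrite h0.
apply: (le_norm_eq sY); memt; apply: (sn_eq_sym sY); memt.
apply: (sn_eqD sY); memt; last by apply: (sn_eqN sY); memt; exact: (sn_eqZ sY).
by apply: (sn_eqD sY); memt; exact: (sn_eqN sY).
Qed.

Lemma deriv_on_cst (T : X -> Y) : bounded_linear T ->
  deriv_on U (fun _ => T) (fun _ _ => 0).
Proof.
move=> bT l Ul; split=> //; split.
  split=> [f mf|a f g mf mg|]; first by memt.
    by rewrite scaler0 addr0; exact: sn_eq_refl.
  by exists 0 => f mf; rewrite norm0// mul0r.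
move=> e e0; exists 1 => // h /andP[h0 _] f mf.
rewrite subrr scaler0 subr0 norm0// mulr_ge0 ?(norm_ge0 sX)// mulr_ge0 ?ltW//.
Qed.

Lemma deriv_on_add S S' T T' : deriv_on U S S' -> deriv_on U T T' ->
  deriv_on U (fun l f => S l f + T l f) (fun l f => S' l f + T' l f).
Proof.
move=> HS HT l Ul; have [bS [bS' H1]] := HS _ Ul; have [bT [bT' H2]] := HT _ Ul.
split; first exact: bl_add.
split; first exact: bl_add.
move=> e e0; have e20 : 0 < e / 2 by rewrite divr_gt0.
have [r1 r10 {}H1] := H1 _ e20; have [r2 r20 {}H2] := H2 _ e20.
have [r' r'0 Hr'] := oU Ul.
exists (Num.min r' (Num.min r1 r2)) => [|h]; first by rewrite !lt_min r'0 r10.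
rewrite !lt_min => /and4P[h0 hr' hr1 hr2] f mf; have Ulh := Hr' _ hr'.
have [[m1 m2] m3] := (bl_mem bS mf, bl_mem bS' mf, bl_mem (HS _ Ulh).1 mf).
have [[n1 n2] n3] := (bl_mem bT mf, bl_mem bT' mf, bl_mem (HT _ Ulh).1 mf).
have -> : S (l + h) f + T (l + h) f - (S l f + T l f) - h *: (S' l f + T' l f) =
  (S (l + h) f - S l f - h *: S' l f) + (T (l + h) f - T l f - h *: T' l f) by lmodR.
rewrite (le_trans (normD sY _ _))//; memt.
have := H1 h _ f mf; rewrite h0 hr1 => /(_ isT) {}H1.
have := H2 h _ f mf; rewrite h0 hr2 => /(_ isT) {}H2.
by apply: le_trans (lerD H1 H2) _; apply: le_of_eq; field.
Qed.

Lemma deriv_on_scal (s s' : R[i] -> R[i]) : cderiv_on U s s' ->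
  deriv_on U (fun l (f : X) => s l *: f) (fun l f => s' l *: f).
Proof.
have bid : bounded_linear (fun f : X => f).
  by split=> [//|a f g _ _|]; [exact: sn_eq_refl|exists 1 => f; rewrite mul1r].
move=> Hs l Ul; split; first exact: bl_scale.
split; first exact: bl_scale.
move=> e e0; have [r r0 Hr] := Hs _ Ul _ e0; exists r => // h hr f mf.
have -> : s (l + h) *: f - s l *: f - h *: (s' l *: f) =
  (s (l + h) - s l - h * s' l) *: f by lmodR.
by rewrite (normZ sX)//; apply: ler_wpM2r; [exact: norm_ge0|exact: Hr].
Qed.

End derivatives.

Section chain.
Variables (R : realType) (X Y Z : snSpace R).
Hypotheses (sX : seminormed X) (sY : seminormed Y) (sZ : seminormed Z).
Variable U : set R[i].
Hypothesis oU : openC U.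

(** The remainder of the composite is the sum of the remainder of [S] at [J (l + h)], of [h]
    times an increment of [J] under [S' l], and of the remainder of [J] under [S l]; each
    takes a third of the tolerance. *)
Lemma deriv_on_comp (S S' : R[i] -> Y -> Z) (J J' : R[i] -> X -> Y) :
  deriv_on U S S' -> deriv_on U J J' ->
  deriv_on U (fun l f => S l (J l f)) (fun l f => S' l (J l f) + S l (J' l f)).
Proof.
move=> HS HJ l Ul; have [bS [bS' H1]] := HS _ Ul; have [bJ [bJ' H2]] := HJ _ Ul.
split; first exact: bl_comp.
split; first by apply: bl_add => //; exact: bl_comp.
move=> e e0.
have [MJ MJ0 [rJ rJ0 HrJ]] := deriv_lip sX sY oU HJ Ul.
have [NS NS0 HNS] := bl_bound sY bS.
have [NS' NS'0 HNS'] := bl_bound sY bS'.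
have [NJ NJ0 HNJ] := bl_bound sX bJ.
have e10 : 0 < e / (3 * (NJ + MJ)) by rewrite divr_gt0// mulr_gt0// addr_gt0.
have e20 : 0 < e / (3 * NS) by rewrite divr_gt0// mulr_gt0.
have [r1 r10 {}H1] := H1 _ e10; have [r2 r20 {}H2] := H2 _ e20.
pose r3 := e / (3 * NS' * MJ).
have r30 : 0 < r3 by rewrite divr_gt0// mulr_gt0// mulr_gt0.
exists (Num.min (Num.min rJ 1) (Num.min r3 (Num.min r1 r2))) => [|h].
  by rewrite !lt_min rJ0 ltr01 r30 r10.
rewrite !lt_min => /andP[h0 /andP[/andP[hrJ h1] /and3P[hr3 hr1 hr2]]] f mf.
have [Ulh HJh] := HrJ _ hrJ.
have [[mu mv] mj] := (bl_mem (HJ _ Ulh).1 mf, bl_mem bJ mf, bl_mem bJ' mf).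
set u := J (l + h) f in mu *; set v := J l f in mv *; set j := J' l f in mj *.
have [bSh [_ _]] := HS _ Ulh.
have [[m1 m2] m3] := (bl_mem bSh mu, bl_mem bS mv, bl_mem bS mj).
have [[m4 m5] m6] := (bl_mem bS' mu, bl_mem bS' mv, bl_mem bS mu).
have -> : S (l + h) u - S l v - h *: (S' l v + S l j) =
  (S (l + h) u - S l u - h *: S' l u) + h *: (S' l u - S' l v) +
  (S l u - S l v - h *: S l j) by lmodR.
rewrite (le_trans (normD sZ _ _))//; memt.
rewrite (norm_bl_sub3 sY sZ h bS mu mv mj).
rewrite (le_trans (lerD (normD sZ _ _) (lexx _)))//; memt.
rewrite (normZ sZ); last by memt.
rewrite (norm_bl_sub sY sZ bS' mu mv).
have muv : sn_mem Y (u - v) by memt.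
have muvj : sn_mem Y (u - v - h *: j) by memt.
have nf := norm_ge0 sX mf; have nuv := norm_ge0 sY muv.
have Huv : sn_norm Y (u - v) <= MJ * normc h * sn_norm X f by exact: HJh.
have nu : sn_norm Y u <= (NJ + MJ) * sn_norm X f.
  have -> : u = v + (u - v) by lmodR.
  rewrite (le_trans (normD sY _ _))// mulrDl lerD//; first exact: HNJ.
  apply: le_trans Huv _; apply: ler_wpM2r => //.
  by rewrite -[leRHS]mulr1 ler_wpM2l// ltW.
have T1 : sn_norm Z (S (l + h) u - S l u - h *: S' l u) <=
    e / 3 * normc h * sn_norm X f.
  apply: le_trans (H1 h _ u mu) _; first by rewrite h0.
  apply: (@le_trans _ _ (e / (3 * (NJ + MJ)) * normc h * ((NJ + MJ) * sn_norm X f))).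
    by apply: ler_wpM2l => //; rewrite mulr_ge0// ltW.
  by apply: le_of_eq; field; rewrite gt_eqF// addr_gt0.
have T2 : normc h * sn_norm Z (S' l (u - v)) <= e / 3 * normc h * sn_norm X f.
  rewrite (mulrC (e / 3)) -mulrA ler_pM2l//.
  apply: le_trans (HNS' _ muv) _.
  apply: (@le_trans _ _ (NS' * (MJ * r3 * sn_norm X f))).
    rewrite ler_pM2l// (le_trans Huv)// ler_wpM2r// ler_pM2l//; exact: ltW.
  by apply: le_of_eq; rewrite /r3; field; rewrite !gt_eqF.
have T3 : sn_norm Z (S l (u - v - h *: j)) <= e / 3 * normc h * sn_norm X f.
  apply: le_trans (HNS _ muvj) _.
  apply: (@le_trans _ _ (NS * (e / (3 * NS) * normc h * sn_norm X f))).
    by rewrite ler_pM2l//; apply: H2 => //; rewrite h0.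
  by apply: le_of_eq; field; rewrite gt_eqF.
by apply: le_trans (lerD (lerD T1 T2) T3) _; apply: le_of_eq; field.
Qed.

End chain.

Section inverse.
Variables (R : realType) (X : snSpace R).
Hypothesis sX : seminormed X.
Variable U : set R[i].
Hypothesis oU : openC U.
Variables T T' J : R[i] -> X -> X.
Hypothesis HT : deriv_on U T T'.
Hypothesis T_half : forall l f, U l -> sn_mem X f -> sn_norm X (T l f) <= 2^-1 * sn_norm X f.
Hypothesis mJ : forall l f, U l -> sn_mem X f -> sn_mem X (J l f).
Hypothesis JE : forall l f, U l -> sn_mem X f -> sn_eq (J l f + T l (J l f)) f.

(** [T l] at most halves norms, so that [1 + T l] cannot shrink them by more than 2. *)
Lemma le_norm_IT l g : U l -> sn_mem X g ->
  sn_norm X g <= 2 * sn_norm X (g + T l g).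
Proof.
move=> Ul mg; have mT := bl_mem (HT Ul).1 mg.
have {1}-> : g = (g + T l g) - T l g by lmodR.
have := normB sX (memD sX mg mT) mT; have := T_half Ul mg.
have -> : sn_norm X (g + T l g - T l g) = sn_norm X g by congr sn_norm; lmodR.
lra.
Qed.

Lemma IT_inj l f g : U l -> sn_mem X f -> sn_mem X g ->
  sn_eq (f + T l f) (g + T l g) -> sn_eq f g.
Proof.
move=> Ul mf mg; rewrite /sn_eq => E; have bT := (HT Ul).1.
have [mTf mTg] := (bl_mem bT mf, bl_mem bT mg).
have mfg : sn_mem X (f - g) by memt.
have mTfg := bl_mem bT mfg.
apply/eqP; rewrite eq_le norm_ge0// andbT (le_trans (le_norm_IT Ul mfg))//.
suff -> : sn_norm X (f - g + T l (f - g)) = sn_norm X (f + T l f - (g + T l g)).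
  by rewrite E mulr0.
apply: (norm_eq sX); memt.
have -> : f + T l f - (g + T l g) = (f - g) + (T l f - T l g) by lmodR.
by apply: (sn_eqD sX); memt; [exact: sn_eq_refl|exact: bl_sub].
Qed.

(** [J l] is only chosen pointwise: its linearity up to null elements comes from the
    injectivity of [1 + T l]. *)
Lemma J_bl l : U l -> bounded_linear (J l).
Proof.
move=> Ul; have bT := (HT Ul).1; split=> [f|a f g mf mg|]; first exact: mJ.
- have mL : sn_mem X (a *: f + g) by memt.
  have [[m1 m2] m3] := (mJ Ul mf, mJ Ul mg, mJ Ul mL).
  have [[n1 n2] n3] := (bl_mem bT m1, bl_mem bT m2, bl_mem bT m3).
  have m4 : sn_mem X (a *: J l f + J l g) by memt.
  have n4 := bl_mem bT m4.
  apply: (IT_inj Ul) => //.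
  apply: (sn_eq_trans sX) (JE Ul mL) _ => //; memt.
  apply: (sn_eq_sym sX) => //; memt.
  apply: (sn_eq_trans sX)
    (_ : sn_eq _ (a *: (J l f + T l (J l f)) + (J l g + T l (J l g)))) _; memt.
    have -> : a *: (J l f + T l (J l f)) + (J l g + T l (J l g)) =
      (a *: J l f + J l g) + (a *: T l (J l f) + T l (J l g)) by lmodR.
    by apply: (sn_eqD sX); memt; [exact: sn_eq_refl|exact: bl_lin].
  apply: (sn_eqD sX); memt; last exact: JE.
  by apply: (sn_eqZ sX); memt; exact: JE.
- exists 2 => f mf; have m1 := mJ Ul mf; have n1 := bl_mem bT m1.
  rewrite (le_trans (le_norm_IT Ul m1))// (norm_eq sX _ _ (JE Ul mf))//; memt.
Qed.

(** Applied to the remainder [J (l + h) - J l + h J (T' (J l))], the operator [1 + T (l + h)]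
    leaves the remainder of [T] at [J l] and [h] times an increment of [T]: both are
    [o(h)], and [1 + T (l + h)] does not shrink norms by more than 2. *)
Lemma deriv_on_inverse : deriv_on U J (fun l f => - J l (T' l (J l f))).
Proof.
move=> l Ul; have bJ := J_bl Ul; have [bT [bT' H]] := HT Ul; split=> //.
have bJ' : bounded_linear (fun f => - J l (T' l (J l f))).
  have -> : (fun f => - J l (T' l (J l f))) = (fun f => -1 *: J l (T' l (J l f))).
    by apply/funext => f; rewrite scaleN1r.
  by apply: bl_scale => //; apply: (bl_comp sX sX sX) => //; exact: (bl_comp sX sX sX).
split=> // e e0.
have [MT MT0 [rT rT0 HrT]] := deriv_lip sX sX oU HT Ul.
have [NJ NJ0 HNJ] := bl_bound sX bJ.
have [NT' NT'0 HNT'] := bl_bound sX bT'.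
have e10 : 0 < e / (4 * NJ) by rewrite divr_gt0// mulr_gt0.
have [r1 r10 {}H] := H _ e10.
pose r2 := e / (4 * MT * (NJ * (NT' * NJ))).
have r20 : 0 < r2 by rewrite divr_gt0// ?mulr_gt0.
exists (Num.min rT (Num.min r2 r1)) => [|h]; first by rewrite !lt_min rT0 r20.
rewrite !lt_min => /and4P[h0 hrT hr2 hr1] f mf.
have [Ulh HTh] := HrT _ hrT; have [bTh _] := HT Ulh.
have mv := mJ Ul mf; have mu := mJ Ulh mf.
set v := J l f in mv *; set u := J (l + h) f in mu *.
have mw := bl_mem bT' mv; set w := T' l v in mw *.
have mj := mJ Ul mw; set j := J l w in mj *.
have mE : sn_mem X (u - v - h *: (- j)) by memt.
have [[p1 p2] p3] := (bl_mem bTh mu, bl_mem bTh mv, bl_mem bTh mj).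
have [q2 q3] := (bl_mem bT mv, bl_mem bT mj).
have mNj : sn_mem X (- j) by memt.
have p4 := bl_mem bTh mNj; have pE := bl_mem bTh mE.
have K : sn_norm X (u - v - h *: (- j) + T (l + h) (u - v - h *: (- j))) <=
  sn_norm X (T (l + h) v - T l v - h *: w) + normc h * sn_norm X (T (l + h) j - T l j).
  rewrite -(normZ sX); last by memt.
  rewrite -[X in _ <= X + _](normN sX); last by memt.
  apply: le_trans (normD sX _ _); memt.
  apply: (le_norm_eq sX); memt.
  have pm : sn_mem X (h *: - j) by memt.
  have A1 : sn_eq (T (l + h) (u - v - h *: (- j)))
      (T (l + h) u - T (l + h) v + h *: T (l + h) j).
    have -> : u - v - h *: - j = (u - v) + h *: j by lmodR.
    have muv : sn_mem X (u - v) by memt.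
    have mhj : sn_mem X (h *: j) by memt.
    have [s1 s2] := (bl_mem bTh muv, bl_mem bTh mhj).
    have s3 : sn_mem X (u - v + h *: j) by memt.
    have s4 := bl_mem bTh s3.
    apply: (sn_eq_trans sX) (bl_D bTh muv mhj) _; memt.
    apply: (sn_eqD sX); memt; first exact: bl_sub.
    exact: bl_Z.
  apply: (sn_eq_trans sX) (_ : sn_eq _ ((u + T (l + h) u) - (v + T l v) +
    h *: (j + T l j) + - (T (l + h) v - T l v) + h *: (T (l + h) j - T l j))) _; memt.
    have -> : u + T (l + h) u - (v + T l v) + h *: (j + T l j) -
      (T (l + h) v - T l v) + h *: (T (l + h) j - T l j) =
      (u - v - h *: - j) + (T (l + h) u - T (l + h) v + h *: T (l + h) j) by lmodR.
    apply: (sn_eqD sX); memt; exact: sn_eq_refl.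
  have -> : - (T (l + h) v - T l v - h *: w) + h *: (T (l + h) j - T l j) =
    f - f + h *: w + - (T (l + h) v - T l v) + h *: (T (l + h) j - T l j) by lmodR.
  apply: (sn_eqD sX); memt; last exact: sn_eq_refl.
  apply: (sn_eqD sX); memt; last exact: sn_eq_refl.
  apply: (sn_eqD sX); memt; last by apply: (sn_eqZ sX); memt; exact: JE.
  apply: (sn_eqD sX); memt; first exact: JE.
  by apply: (sn_eqN sX); memt; exact: JE.
apply: le_trans (le_norm_IT Ulh mE) _.
have nf := norm_ge0 sX mf; have nj := norm_ge0 sX mj.
have Nv : sn_norm X v <= NJ * sn_norm X f by exact: HNJ.
have Nj : sn_norm X j <= NJ * (NT' * NJ) * sn_norm X f.
  apply: le_trans (HNJ _ mw) _; rewrite -!mulrA ler_pM2l//.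
  by apply: le_trans (HNT' _ mv) _; rewrite ler_pM2l.
have T1 : sn_norm X (T (l + h) v - T l v - h *: w) <= e / 4 * normc h * sn_norm X f.
  apply: le_trans (H h _ v mv) _; first by rewrite h0.
  apply: (@le_trans _ _ (e / (4 * NJ) * normc h * (NJ * sn_norm X f))).
    by apply: ler_wpM2l => //; rewrite mulr_ge0// ltW.
  by apply: le_of_eq; field; rewrite gt_eqF.
have T2 : sn_norm X (T (l + h) j - T l j) <= e / 4 * sn_norm X f.
  apply: le_trans (HTh _ mj) _.
  apply: (@le_trans _ _ (MT * r2 * (NJ * (NT' * NJ) * sn_norm X f))).
    apply: ler_pM => //; first by rewrite mulr_ge0 ?normc_ge0 ?ltW.
    by rewrite ler_pM2l// ltW.
  by apply: le_of_eq; rewrite /r2; field; rewrite !gt_eqF.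
have : normc h * sn_norm X (T (l + h) j - T l j) <= e / 4 * normc h * sn_norm X f.
  by rewrite (mulrC (e / 4)) -mulrA ler_pM2l.
move=> T3; apply: (@le_trans _ _ (2 * (e / 4 * normc h * sn_norm X f +
  e / 4 * normc h * sn_norm X f))).
  by rewrite ler_pM2l//; apply: le_trans K _; exact: lerD.
by apply: le_of_eq; field.
Qed.

End inverse.

(** * Rademacher averages *)

Section rademacher_integral.
Variable R : realType.
Implicit Types (u t : R).

Lemma sg_sin_pi (d : nat) t : d%:R < t < d.+1%:R -> Num.sg (sin (pi * t)) = (-1) ^+ d.
Proof.
elim: d t => [|d IH] t /andP[dt td].
  rewrite expr0; apply: gtr0_sg; apply: sin_gt0_pi.
  by rewrite mulr_gt0 ?pi_gt0//= -[ltRHS]mulr1 ltr_pM2l ?pi_gt0.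
have -> : pi * t = pi * (t - 1) + pi by ring.
rewrite sinDpi sgrN IH ?exprS ?mulN1r//; rewrite -!natr1 in dt td *.
by apply/andP; split; lra.
Qed.

(** The sign is determined by the half-period of the sine that contains [u]. Its index is the
    integer part of [2^(j+1) u], which is [k] without its last [m - j - 1] binary digits. *)
Lemma rademacher_dyadic (m j k : nat) u : (j < m)%N ->
  k%:R < u * 2 ^+ m < k.+1%:R ->
  rademacher j.+1 u = (-1) ^+ (k %/ 2 ^ (m - j.+1)).
Proof.
move=> jm /andP[ku uk]; rewrite /rademacher.
have -> : 2 ^+ j.+1 * pi * u = pi * (2 ^+ j.+1 * u) by ring.
apply: sg_sin_pi; set e := (2 ^ (m - j.+1))%N.
have e0 : (0 < e)%N by rewrite expn_gt0.
have eR : (0 : R) < e%:R by rewrite ltr0n.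
have te : 2 ^+ j.+1 * u * e%:R = u * 2 ^+ m.
  by rewrite /e natrX mulrAC -exprD subnKC// mulrC.
rewrite -(ltr_pM2r eR) te -[X in _ && X](ltr_pM2r eR) te -!natrM.
apply/andP; split.
  by apply: le_lt_trans ku; rewrite ler_nat leq_trunc_div.
by apply: lt_le_trans uk _; rewrite ler_nat ltn_ceil.
Qed.

Lemma measurable_rademacher (j : nat) : measurable_fun setT (@rademacher R j).
Proof.
have m1 : measurable_fun setT (fun u : R => sin (2 ^+ j * pi * u)).
  apply: continuous_measurable_fun => x; apply: continuous_comp.
    exact: mulrl_continuous.
  exact: continuous_sin.
have -> : @rademacher R j = (fun u => if 0 < sin (2 ^+ j * pi * u) then 1 else
   if sin (2 ^+ j * pi * u) < 0 then -1 else 0).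
  apply/funext => u; rewrite /rademacher.
  by case: (ltrgtP 0 (sin (2 ^+ j * pi * u))) => [/gtr0_sg|/ltr0_sg|<-]; rewrite ?sgr0.
apply: measurable_fun_ifT => //; first exact: measurable_fun_ltr.
apply: measurable_fun_ifT => //; exact: measurable_fun_ltr.
Qed.

Lemma rademacher_range (j : nat) u :
  exists s : 'I_3, rademacher j u = (s : nat)%:R - 1.
Proof.
rewrite /rademacher; case: sgrP => _.
- by exists (@Ordinal 3 1 isT); rewrite subrr.
- by exists (@Ordinal 3 2 isT); rewrite /=; ring.
- by exists (@Ordinal 3 0 isT); rewrite /= sub0r.
Qed.

(** A Rademacher function has three values, so that only finitely many values of [phi]
    matter. *)
Lemma measurable_rademachers (m : nat) (phi : ('I_m -> R) -> R) :
  measurable_fun setT (fun u => phi (fun j => rademacher j.+1 u)).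
Proof.
move=> _ Y mY; rewrite setTI.
pose v (s : {ffun 'I_m -> 'I_3}) (j : 'I_m) : R := (s j : nat)%:R - 1.
have -> : (fun u => phi (fun j : 'I_m => rademacher j.+1 u)) @^-1` Y =
    \bigcup_(s in [set s | Y (phi (v s))])
      \bigcap_(j in [set: 'I_m]) [set u | rademacher j.+1 u = v s j].
  apply/seteqP; split=> u /=.
    move=> Yu; have [s Hs] := choice (fun j : 'I_m => rademacher_range j.+1 u).
    have E : (fun j : 'I_m => rademacher j.+1 u) = v (finfun s).
      by apply/funext => j; rewrite Hs /v ffunE.
    exists (finfun s); first by rewrite /= -E.
    by move=> j _ /=; rewrite Hs /v ffunE.
  move=> [s /= Ys Hs]; rewrite (_ : (fun j : 'I_m => _) = v s)//.
  by apply/funext => j; exact: Hs.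
apply: fin_bigcup_measurable; first exact: finite_finset.
move=> s _; apply: fin_bigcap_measurable => // j _.
have := @measurable_rademacher j.+1 measurableT [set v s j] (measurable_set1 _).
by rewrite setTI.
Qed.

Lemma integral_rademachers_dyadic (m : nat) (phi : ('I_m -> R) -> R) :
  (forall x, 0 <= phi x) ->
  (\int[@lebesgue_measure R]_(u in `[0%R, 1%R])
     (phi (fun j => rademacher j.+1 u))%:E)%E =
  (\sum_(0 <= k < 2 ^ m)
     2 ^- m * phi (fun j : 'I_m => (-1) ^+ (k %/ 2 ^ (m - j.+1))))%:E.
Proof.
move=> phi0; set f := fun u => phi (fun j => rademacher j.+1 u).
have mf (D : set R) : measurable D -> measurable_fun D (EFin \o f).
  move=> mD; apply: (measurable_funS measurableT) => //.
  by apply/measurable_EFinP; exact: measurable_rademachers.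
rewrite -integral_itv_obnd_cbnd; last exact: mf.
pose h : R := 2 ^- m; have h0 : 0 < h by rewrite invr_gt0 exprn_gt0.
(* The closed interval is built up from left to right, one dyadic interval at a time. *)
suff H n : (\int[@lebesgue_measure R]_(u in `]0%R, (n%:R * h)%R]) (f u)%:E)%E =
  (\sum_(0 <= k < n) h * phi (fun j : 'I_m => (-1) ^+ (k %/ 2 ^ (m - j.+1))))%:E.
  by have := H (2 ^ m)%N; rewrite natrX /h divff// expf_neq0// pnatr_eq0.
elim: n => [|n IH].
  by rewrite mul0r big_geq// set_itv_ge ?integral_set0// -leNgt bnd_simp.
rewrite (@itv_bndbnd_setU _ _ _ (BRight (n%:R * h))); last 2 first.
- by rewrite bnd_simp mulr_ge0// ltW.
- by rewrite bnd_simp ler_pM2r// ler_nat.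
rewrite ge0_integral_setU//=; last 3 first.
- by apply: mf; exact: measurableU.
- by move=> x _; rewrite lee_fin; exact: phi0.
- apply/disj_setPS => x [] /=; rewrite !in_itv/= => /andP[_ H1] /andP[H2 _].
  by move: (le_lt_trans H1 H2); rewrite ltxx.
rewrite IH big_nat_recr//= EFinD; congr (_ + _)%E.
rewrite -integral_itv_bndo_bndc; last exact: mf.
rewrite (eq_integral (cst (phi (fun j : 'I_m => (-1) ^+ (n %/ 2 ^ (m - j.+1))))%:E)).
  rewrite integral_cst//= lebesgue_measure_itv/= lte_fin ltr_pM2r// ltr_nat ltnSn.
  by rewrite -EFinD -EFinM mulrC; congr (_ * _)%:E; rewrite -natr1; ring.
move=> u; rewrite inE/= in_itv/= => /andP[H1 H2]; congr (phi _)%:E.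
apply/funext => j; apply: (@rademacher_dyadic m j n u (ltn_ord j)).
have p0 : 0 < (2 : R) ^+ m by rewrite exprn_gt0.
by rewrite -ltr_pdivrMr// -/h H1 -ltr_pdivlMr.
Qed.

Lemma eq_of_bits (m k k' : nat) : (k < 2 ^ m)%N -> (k' < 2 ^ m)%N ->
  (forall i, (i < m)%N -> odd (k %/ 2 ^ i) = odd (k' %/ 2 ^ i)) -> k = k'.
Proof.
elim: m k k' => [|m IH] k k'; first by rewrite expn0 !ltnS !leqn0 => /eqP-> /eqP->.
move=> km km' H; rewrite -(odd_double_half k) -(odd_double_half k').
have := H 0%N (ltn0Sn m); rewrite expn0 !divn1 => ->; congr (_ + _.*2)%N.
apply: IH => [||i im].
- by rewrite -divn2 ltn_divLR// -expnSr.
- by rewrite -divn2 ltn_divLR// -expnSr.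
- by have := H i.+1 im; rewrite expnS -!divn2 -!divnMA.
Qed.

(** Rademacher functions are independent random signs: as [k] runs over the dyadic intervals,
    its binary digits run over all families of signs. *)
Lemma integral_rademachers (m : nat) (phi : ('I_m -> R) -> R) :
  (forall x, 0 <= phi x) ->
  \int[@lebesgue_measure R]_(u in `[0%R, 1%R]) phi (fun j => rademacher j.+1 u) =
  2 ^- m * \sum_(e : {ffun 'I_m -> bool}) phi (fun j => (-1) ^+ e j).
Proof.
move=> phi0; rewrite /Rintegral integral_rademachers_dyadic//= -mulr_sumr big_mkord.
congr (_ * _).
pose b (k : 'I_(2 ^ m)) : {ffun 'I_m -> bool} := [ffun j : 'I_m => odd (k %/ 2 ^ (m - j.+1))].
have binj : injective b.
  move=> k k' /ffunP bk; apply/val_inj; apply: (@eq_of_bits m); [exact: ltn_ord|exact: ltn_ord|].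
  move=> i im; have := bk (rev_ord (Ordinal im)); rewrite !ffunE /=.
  by rewrite -subSn// subSS subKn// ltnW.
have bb : bijective b by apply: inj_card_bij => //; rewrite card_ffun card_bool !card_ord.
rewrite [RHS](reindex b) /=; last by case: bb => g bK gK; exists g => x _.
by apply: eq_bigr => k _; congr phi; apply/funext => j; rewrite ffunE signr_odd.
Qed.

End rademacher_integral.

Section finite_minkowski.
Variables (R : realType) (E : finType) (p w : R).
Hypotheses (p1 : 1 <= p) (w0 : 0 < w).
Implicit Types a b : E -> R.

(** The [L_p] norm for the weights [w]: with [w = 2^-m] it turns Rademacher integrals into
    finite averages over signs. *)
Definition lpmean a : R := (w * \sum_e a e `^ p) `^ p^-1.

Let p0 : 0 < p. Proof. exact: lt_le_trans p1. Qed.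

Let sum0 a : 0 <= w * \sum_e a e `^ p.
Proof. by rewrite mulr_ge0 ?(ltW w0)// sumr_ge0// => e _; exact: powR_ge0. Qed.

Lemma sum_le_lpmean a (c : R) : 0 <= c -> lpmean a <= c -> w * \sum_e a e `^ p <= c `^ p.
Proof.
move=> c0 H; have := ge0_ler_powR (ltW p0) _ _ H.
rewrite !nnegrE powR_ge0 => /(_ isT c0).
by rewrite /lpmean -powRrM mulVf ?gt_eqF// powRr1.
Qed.

Lemma lpmean_le_sum a (c : R) : 0 <= c -> w * \sum_e a e `^ p <= c `^ p -> lpmean a <= c.
Proof.
move=> c0 H; have pV : 0 <= p^-1 by rewrite invr_ge0 ltW.
have := ge0_ler_powR pV _ _ H; rewrite !nnegrE powR_ge0 => /(_ (sum0 a) isT).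
by rewrite -powRrM mulfV ?gt_eqF// powRr1.
Qed.

Lemma lpmean_homo a b (c : R) : 0 <= c -> (forall e, 0 <= a e) -> (forall e, 0 <= b e) ->
  (forall e, a e <= c * b e) -> lpmean a <= c * lpmean b.
Proof.
move=> c0 a0 b0 ab; apply: lpmean_le_sum; first by rewrite mulr_ge0// powR_ge0.
rewrite powRM//; last exact: powR_ge0.
rewrite -powRrM mulVf ?gt_eqF// powRr1; last exact: sum0.
rewrite mulrCA ler_pM2l// mulr_sumr; apply: ler_sum => e _.
rewrite -powRM//; apply: ge0_ler_powR => //; first exact: ltW.
- by rewrite nnegrE.
- by rewrite nnegrE mulr_ge0.
Qed.

(** Minkowski's inequality: [(a + b) / (A + B)] is the convex combination of [a / A] and
    [b / B] with weights [A / (A + B)] and [B / (A + B)], and [x^p] is convex. *)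
Lemma lpmeanD a b : (forall e, 0 <= a e) -> (forall e, 0 <= b e) ->
  lpmean (fun e => a e + b e) <= lpmean a + lpmean b.
Proof.
move=> a0 b0.
suff H A B : 0 < A -> 0 < B -> lpmean a <= A -> lpmean b <= B ->
    lpmean (fun e => a e + b e) <= A + B.
  apply/ler_addgt0Pr => e e0; have e20 : 0 < e / 2 by rewrite divr_gt0.
  have -> : lpmean a + lpmean b + e = (lpmean a + e / 2) + (lpmean b + e / 2).
    by move: (lpmean a) (lpmean b) => ? ?; field.
  by apply: H; rewrite ?lerDl ?(ltW e20)// ltr_wpDl// powR_ge0.
move=> A0 B0; have [A0' B0'] := (ltW A0, ltW B0).
have AB0 : 0 < A + B by exact: addr_gt0.
have AB0' := ltW AB0.
move=> /(sum_le_lpmean A0') HA /(sum_le_lpmean B0') HB.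
apply: lpmean_le_sum => //.
pose t := A / (A + B); have t0 : 0 <= t by rewrite divr_ge0 ?ltW.
have t1 : t <= 1 by rewrite ler_pdivrMr// mul1r lerDl ltW.
have t1' : 0 <= 1 - t by rewrite subr_ge0.
have tB : 1 - t = B / (A + B) by rewrite /t; field; rewrite gt_eqF.
have K i : (a i + b i) `^ p <= (A + B) `^ p *
    (t * (a i `^ p / A `^ p) + (1 - t) * (b i `^ p / B `^ p)).
  have -> : a i + b i = (A + B) * (t * (a i / A) + (1 - t) * (b i / B)).
    by rewrite tB /t; field; rewrite !gt_eqF.
  have aA : 0 <= a i / A by exact: divr_ge0.
  have bB : 0 <= b i / B by exact: divr_ge0.
  rewrite (powRM _ AB0'); last exact: addr_ge0 (mulr_ge0 t0 aA) (mulr_ge0 t1' bB).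
  rewrite ler_pM2l ?powR_gt0//.
  have := @convex_powR R p p1 (Itv01 t0 t1) (a i / A) (b i / B).
  rewrite !inE/= !in_itv/= !andbT => /(_ aA bB).
  rewrite !convRE /= => H.
  apply: (@le_trans _ _ (t * (a i / A) `^ p + (1 - t) * (b i / B) `^ p)); first exact: H.
  have pV x : 0 <= x -> x^-1 `^ p = (x `^ p)^-1.
    by move=> x0; rewrite -(powR_inv1 x0) -powRrM mulN1r powRN.
  by rewrite !powRM// ?invr_ge0// !pV.
apply: (@le_trans _ _ (w * \sum_i ((A + B) `^ p *
    (t * (a i `^ p / A `^ p) + (1 - t) * (b i `^ p / B `^ p))))).
  by rewrite ler_pM2l//; apply: ler_sum => i _; exact: K.
rewrite -mulr_sumr big_split/= -!mulr_sumr -!mulr_suml mulrCA.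
apply: ler_piMr; first exact: powR_ge0.
have -> : w * (t * ((\sum_i a i `^ p) / A `^ p) + (1 - t) * ((\sum_i b i `^ p) / B `^ p))
  = t * ((w * \sum_i a i `^ p) / A `^ p) + (1 - t) * ((w * \sum_i b i `^ p) / B `^ p).
  by ring.
apply: (@le_trans _ _ (t * 1 + (1 - t) * 1)); last by apply: le_of_eq; ring.
apply: lerD; apply: ler_wpM2l => //.
- by rewrite ler_pdivrMr ?powR_gt0// mul1r.
- by rewrite ler_pdivrMr ?powR_gt0// mul1r.
Qed.

End finite_minkowski.

(** The two sides of the inequality that defines R-bounds. *)
Definition rad (R : realType) (p : R) (X : snSpace R) (m : nat) (x : 'I_m -> X) : R :=
  (\int[@lebesgue_measure R]_(u in `[0%R, 1%R])
    (sn_norm X (\sum_(j < m) (rademacher j.+1 u)%:C *: x j) `^ p)) `^ p^-1.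

Section averages.
Variables (R : realType) (p : R) (X : snSpace R).
Hypotheses (p1 : 1 <= p) (sX : seminormed X).
Variable m : nat.
Implicit Types (x y : 'I_m -> X) (e : {ffun 'I_m -> bool}).

Definition signed e x : X := \sum_(j < m) ((-1) ^+ e j)%:C *: x j.

Lemma mem_signed e x : (forall j, sn_mem X (x j)) -> sn_mem X (signed e x).
Proof. by move=> mx; apply: mem_sum => // j _; apply: memZ. Qed.

Lemma radE x : rad p x = lpmean p (2 ^- m) (fun e => sn_norm X (signed e x)).
Proof.
rewrite /rad /lpmean; congr (_ `^ _).
exact: (@integral_rademachers R m (fun r => sn_norm X (\sum_(j < m) (r j)%:C *: x j) `^ p)
  (fun r => powR_ge0 _ _)).
Qed.

Lemma rad_ge0 x : 0 <= rad p x.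
Proof. exact: powR_ge0. Qed.

Let w0 : 0 < (2 : R) ^- m. Proof. by rewrite invr_gt0 exprn_gt0. Qed.

Lemma radD x y : (forall j, sn_mem X (x j)) -> (forall j, sn_mem X (y j)) ->
  rad p (fun j => x j + y j) <= rad p x + rad p y.
Proof.
move=> mx my; have [Mx My] := (fun e => mem_signed e mx, fun e => mem_signed e my).
have mxy j : sn_mem X (x j + y j) by exact: memD.
rewrite !radE; apply: le_trans (lpmeanD p1 w0 _ _); last first.
- by move=> e; exact: norm_ge0.
- by move=> e; exact: norm_ge0.
rewrite -[leRHS]mul1r; apply: lpmean_homo => // e.
- by apply: norm_ge0 => //; exact: mem_signed.
- by rewrite addr_ge0//; exact: norm_ge0.
rewrite mul1r; have -> : signed e (fun j => x j + y j) = signed e x + signed e y.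
  by rewrite /signed -big_split; apply: eq_bigr => j _; rewrite scalerDr.
exact: normD.
Qed.

Lemma rad_scale (a : R[i]) x : (forall j, sn_mem X (x j)) ->
  rad p (fun j => a *: x j) <= normc a * rad p x.
Proof.
move=> mx; have Mx e := mem_signed e mx.
have max j : sn_mem X (a *: x j) by exact: memZ.
rewrite !radE; apply: lpmean_homo => // [|e|e|e].
- exact: normc_ge0.
- by apply: norm_ge0 => //; exact: mem_signed.
- exact: norm_ge0.
rewrite -(normZ sX)//; have -> // : signed e (fun j => a *: x j) = a *: signed e x.
by rewrite /signed scaler_sumr; apply: eq_bigr => j _; rewrite !scalerA mulrC.
Qed.

(** Flipping a sign permutes the families of signs. *)
Lemma rad_flip (i : 'I_m) x :
  rad p (fun j => if j == i then - x j else x j) = rad p x.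
Proof.
rewrite !radE /lpmean; congr ((_ * _) `^ _).
pose f e := [ffun j => (j == i) (+) e j].
have fK : involutive f by move=> e; apply/ffunP => j; rewrite !ffunE addKb.
rewrite [RHS](reindex_inj (inv_inj fK)); apply: eq_bigr => e _; congr (sn_norm X _ `^ _).
apply: eq_bigr => j _; rewrite ffunE; case: eqP => _; rewrite ?addFb//.
by rewrite addTb signrN rmorphN scaleNr scalerN.
Qed.

(** A coefficient in [-1, 1] is a convex combination of [1] and [-1], and flipping
    the sign of one summand does not change a Rademacher average. *)
Lemma rad_contract1 (i : 'I_m) (t : R) x : (forall j, sn_mem X (x j)) -> `|t| <= 1 ->
  rad p (fun j => if j == i then t%:C *: x j else x j) <= rad p x.
Proof.
move=> mx; rewrite ler_norml => /andP[t1 t2].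
pose y j := if j == i then - x j else x j.
have my j : sn_mem X (y j) by rewrite /y; case: ifP => _ //; exact: memN.
have -> : (fun j => if j == i then t%:C *: x j else x j) =
    (fun j => ((1 + t) / 2)%:C *: x j + ((1 - t) / 2)%:C *: y j).
  apply/funext => j; rewrite /y; case: ifP => _.
    rewrite scalerN -scaleNr -scalerDl -rmorphN -rmorphD/=.
    by congr (_%:C *: _); field.
  rewrite -scalerDl -rmorphD/=; have -> : (1 + t) / 2 + (1 - t) / 2 = 1 by field.
  by rewrite rmorph1 scale1r.
apply: le_trans (radD _ _) _ => [j|j|]; [exact: memZ|exact: memZ|].
apply: le_trans (lerD (rad_scale _ mx) (rad_scale _ my)) _.
rewrite (rad_flip i x) !normc_real !ger0_norm ?divr_ge0//; [|lra|lra].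
by rewrite -mulrDl; apply: le_of_eq; field.
Qed.

Lemma rad_contract_real (t : 'I_m -> R) x : (forall j, sn_mem X (x j)) ->
  (forall j, `|t j| <= 1) -> rad p (fun j => (t j)%:C *: x j) <= rad p x.
Proof.
move=> mx t1.
pose y (n : nat) (j : 'I_m) : X := if (j < n)%N then (t j)%:C *: x j else x j.
have my n j : sn_mem X (y n j) by rewrite /y; case: ifP => _ //; exact: memZ.
have -> : (fun j => (t j)%:C *: x j) = y m by apply/funext => j; rewrite /y ltn_ord.
suff H n : (n <= m)%N -> rad p (y n) <= rad p x by exact: H.
elim: n => [_|n IH nm].
  by have -> : y 0%N = x by apply/funext => j; rewrite /y ltn0.
apply: le_trans (IH (ltnW nm)); pose i := Ordinal nm.
apply: le_trans (rad_contract1 i (my n) (t1 i)).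
rewrite le_eqVlt; apply/orP; left; apply/eqP; congr rad; apply/funext => j.
rewrite /y ltnS leq_eqVlt -[j == i]/(j == n :> nat).
by have [ji|] := eqVneq (j : nat) n; rewrite //= ji ltnn (_ : j = i)//; exact/val_inj.
Qed.

(** Kahane's contraction principle. Real coefficients are changed one at a time; real and
    imaginary parts are treated separately, whence the factor 2. *)
Lemma rad_contract (c : R) (a : 'I_m -> R[i]) x : (forall j, sn_mem X (x j)) -> 0 < c ->
  (forall j, normc (a j) <= c) -> rad p (fun j => a j *: x j) <= 2 * c * rad p x.
Proof.
move=> mx c0 ac.
have Rea j : `|complex.Re (a j) / c| <= 1.
  rewrite normrM normfV (gtr0_norm c0) ler_pdivrMr// mul1r (le_trans _ (ac j))//.
  case: (a j) => r i /=; rewrite -sqrtr_sqr ler_sqrt ?addr_ge0 ?sqr_ge0//.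
  by rewrite lerDl sqr_ge0.
have Ima j : `|complex.Im (a j) / c| <= 1.
  rewrite normrM normfV (gtr0_norm c0) ler_pdivrMr// mul1r (le_trans _ (ac j))//.
  case: (a j) => r i /=; rewrite -sqrtr_sqr ler_sqrt ?addr_ge0 ?sqr_ge0//.
  by rewrite lerDr sqr_ge0.
have -> : (fun j => a j *: x j) = (fun j => c%:C *: ((complex.Re (a j) / c)%:C *: x j) +
    (c%:C * 'i) *: ((complex.Im (a j) / c)%:C *: x j)).
  apply/funext => j; rewrite !scalerA -scalerDl; congr (_ *: _).
  case: (a j) => r i /=; apply/eqP; rewrite eq_complex /=; apply/andP.
  by split; apply/eqP; field; rewrite gt_eqF.
have m1 j : sn_mem X ((complex.Re (a j) / c)%:C *: x j) by exact: memZ.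
have m2 j : sn_mem X ((complex.Im (a j) / c)%:C *: x j) by exact: memZ.
apply: le_trans (radD _ _) _ => [j|j|]; [exact: memZ|exact: memZ|].
apply: le_trans (lerD (rad_scale _ m1) (rad_scale _ m2)) _.
have n1 : normc (c%:C * 'i) = c.
  rewrite normcM normc_real gtr0_norm// (_ : normc 'i = 1) ?mulr1//.
  by rewrite /normc /= expr0n expr1n add0r sqrtr1.
rewrite n1 normc_real gtr0_norm//.
apply: (@le_trans _ _ (c * rad p x + c * rad p x)); last by apply: le_of_eq; ring.
by apply: lerD; rewrite (ler_pM2l c0); exact: rad_contract_real.
Qed.

End averages.

Section averages_operators.
Variables (R : realType) (p : R) (X Y : snSpace R).
Hypotheses (p1 : 1 <= p) (sX : seminormed X) (sY : seminormed Y).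
Variable m : nat.

Lemma rad_eq (x y : 'I_m -> Y) : (forall j, sn_mem Y (x j)) ->
  (forall j, sn_mem Y (y j)) -> (forall j, sn_eq (x j) (y j)) -> rad p x = rad p y.
Proof.
move=> mx my xy; rewrite !radE; congr lpmean; apply/funext => e.
apply: (norm_eq sY); [exact: mem_signed|exact: mem_signed|].
suff [] : [/\ sn_mem Y (signed e x), sn_mem Y (signed e y)
  & sn_eq (signed e x) (signed e y)] by [].
rewrite /signed; elim/big_rec2: _ => [|j u v _ [mu mv uv]].
  by split; [exact: mem0|exact: mem0|exact: sn_eq_refl].
have [mxj myj] := (mx j, my j).
split; memt; apply: (sn_eqD sY); memt; exact: (sn_eqZ sY).
Qed.

Lemma rad_bl (T : X -> Y) (c : R) (x : 'I_m -> X) : bounded_linear T -> 0 <= c ->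
  (forall f, sn_mem X f -> sn_norm Y (T f) <= c * sn_norm X f) ->
  (forall j, sn_mem X (x j)) -> rad p (fun j => T (x j)) <= c * rad p x.
Proof.
move=> bT c0 Tc mx; have mTx j : sn_mem Y (T (x j)) by exact: (bl_mem bT).
rewrite !radE; apply: lpmean_homo => // [e|e|e].
- by apply: norm_ge0 => //; exact: mem_signed.
- by apply: norm_ge0 => //; exact: mem_signed.
apply: le_trans (Tc _ (mem_signed sX e mx)).
apply: (le_norm_eq sY); [exact: mem_signed|by apply: (bl_mem bT); exact: mem_signed|].
suff [_ _ _] : [/\ sn_mem Y (signed e (fun j => T (x j))), sn_mem X (signed e x),
  sn_mem Y (T (signed e x)) &
  sn_eq (signed e (fun j => T (x j))) (T (signed e x))] by [].
rewrite /signed; elim/big_rec2: _ => [|j v u _ [mu mv mTv uv]].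
  have m0 := mem0 sX; have mT0 := bl_mem bT m0.
  split; memt; apply: (sn_eq_sym sY); memt.
  by have := bl_Z sX sY 0 bT m0; rewrite !scale0r.
have [mxj mTxj] := (mx j, mTx j).
have mL : sn_mem X (((-1) ^+ e j)%:C *: x j + v) by memt.
have mTL := bl_mem bT mL.
split; memt; apply: (sn_eq_sym sY); memt.
apply: (sn_eq_trans sY) (bl_lin _ bT mxj mv) _; memt.
apply: (sn_eqD sY); memt; first exact: sn_eq_refl.
exact: (sn_eq_sym sY).
Qed.

End averages_operators.

(** * R-bounded families *)

(** [R_bounded_by] for a family indexed by [U], on the level of [rad]; repetitions of an index
    are allowed, as the operators of a family may be repeated. *)
Definition Rbd (R : realType) (p : R) (X Y : snSpace R) (U : set R[i])
    (S : R[i] -> X -> Y) (c : R) :=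
  forall m (l : 'I_m -> R[i]) (f : 'I_m -> X), (forall j, U (l j)) ->
    (forall j, sn_mem X (f j)) ->
    rad p (fun j => S (l j) (f j)) <= c * rad p f.

Definition maps_on (R : realType) (X Y : snSpace R) (U : set R[i])
    (S : R[i] -> X -> Y) := forall l f, U l -> sn_mem X f -> sn_mem Y (S l f).

Section Rbd.
Variables (R : realType) (p : R) (X Y : snSpace R).
Hypotheses (p1 : 1 <= p) (sX : seminormed X) (sY : seminormed Y).
Variable U : set R[i].
Implicit Types (S T : R[i] -> X -> Y) (c : R).

Lemma deriv_on_maps S S' : deriv_on U S S' -> maps_on U S /\ maps_on U S'.
Proof.
by move=> H; split=> l f Ul mf; have [bS [bS' _]] := H _ Ul; apply: bl_mem mf.
Qed.

(** The infimum that defines the R-bound is attained, the inequalities being closed in [c]. *)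
Lemma R_bound_leP S c : 0 < c -> (R_bound p (op_family U S) <= c%:E)%E <-> Rbd p U S c.
Proof.
move=> c0; split=> [H m l f Ul mf|H].
  rewrite -subr_le0; apply: (@le0_all_eps _ _ (rad p f)) => [|e e0]; first exact: rad_ge0.
  have : (R_bound p (op_family U S) < (c + e)%:E)%E.
    by apply: le_lt_trans H _; rewrite lte_fin ltrDl.
  move=> /ereal_inf_lt [_ [c' [c'0 Hc'] <-]]; rewrite lte_fin => c'c.
  have -> : rad p (fun j => S (l j) (f j)) - c * rad p f <= e * rad p f =
    (rad p (fun j => S (l j) (f j)) <= (c + e) * rad p f).
    by rewrite lerBlDr mulrDl addrC.
  have Fam j : op_family U S (S (l j)) by exists (l j).
  apply: le_trans (Hc' m (fun j => S (l j)) f Fam mf) _.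
  by apply: ler_wpM2r; [exact: rad_ge0|exact: ltW].
apply: ereal_inf_lbound; exists c => //; split=> // m T f FT mf.
have FT' j : exists k, U k /\ S k = T j by case: (FT j) => k; exists k.
have [l Hl] := choice FT'.
have -> : T = (fun j => S (l j)) by apply/funext => j; case: (Hl j).
by apply: H => // j; case: (Hl j).
Qed.

Lemma Rbd_sub (V : set R[i]) S c : U `<=` V -> Rbd p V S c -> Rbd p U S c.
Proof. by move=> UV H m l f Ul mf; apply: H => // j; exact: UV. Qed.

Lemma Rbd_le S c c' : c <= c' -> Rbd p U S c -> Rbd p U S c'.
Proof.
move=> cc' H m l f Ul mf; apply: le_trans (H m l f Ul mf) _.
by apply: ler_wpM2r cc'; exact: rad_ge0.
Qed.

Lemma Rbd_ext S T c : maps_on U S -> maps_on U T ->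
  (forall l f, U l -> sn_mem X f -> sn_eq (S l f) (T l f)) -> Rbd p U S c -> Rbd p U T c.
Proof.
move=> mS mT ST H m l f Ul mf; have := H m l f Ul mf.
rewrite (@rad_eq _ p _ sY m (fun j => S (l j) (f j)) (fun j => T (l j) (f j))) => [//|j|j|j].
- exact: mS.
- exact: mT.
- exact: ST.
Qed.

Lemma Rbd_add S T c c' : maps_on U S -> maps_on U T -> Rbd p U S c -> Rbd p U T c' ->
  Rbd p U (fun l f => S l f + T l f) (c + c').
Proof.
move=> mS mT HS HT m l f Ul mf; rewrite mulrDl.
have H := lerD (HS m l f Ul mf) (HT m l f Ul mf); apply: le_trans H.
by apply: (radD p1 sY) => j; [exact: mS|exact: mT].
Qed.

Lemma Rbd_scal S c (s : R[i] -> R[i]) (a : R) : maps_on U S -> Rbd p U S c -> 0 < a ->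
  (forall l, U l -> normc (s l) <= a) -> Rbd p U (fun l f => s l *: S l f) (2 * a * c).
Proof.
move=> mS HS a0 sa m l f Ul mf.
have mSj j : sn_mem Y (S (l j) (f j)) by exact: mS.
apply: le_trans (rad_contract p1 sY mSj a0 (fun j => sa _ (Ul j))) _.
rewrite -(mulrA (2 * a) c); apply: ler_wpM2l; last exact: HS.
by rewrite mulr_ge0// ltW.
Qed.

Lemma Rbd_opp S c : maps_on U S -> Rbd p U S c -> Rbd p U (fun l f => - S l f) c.
Proof.
move=> mS HS m l f Ul mf; have mSj j : sn_mem Y (S (l j) (f j)) by exact: mS.
apply: le_trans (HS m l f Ul mf).
have -> : (fun j => - S (l j) (f j)) = (fun j => -1 *: S (l j) (f j)).
  by apply/funext => j; rewrite scaleN1r.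
by apply: le_trans (rad_scale p1 sY (-1) mSj) _; rewrite normcN normc1 mul1r.
Qed.

Lemma Rbd_cst (T : X -> Y) c : bounded_linear T -> 0 <= c ->
  (forall f, sn_mem X f -> sn_norm Y (T f) <= c * sn_norm X f) -> Rbd p U (fun _ => T) c.
Proof. by move=> bT c0 Tc m l f Ul mf; exact: rad_bl. Qed.

Lemma rad1 (x : X) : sn_mem X x -> rad p (fun _ : 'I_1 => x) = sn_norm X x.
Proof.
move=> mx; have p0 : p != 0 by rewrite gt_eqF// (lt_le_trans _ p1).
rewrite radE /lpmean.
have Ne (e : {ffun 'I_1 -> bool}) : sn_norm X (signed e (fun=> x)) = sn_norm X x.
  rewrite /signed big_ord1 (normZ sX)// normc_real normrX normrN normr1 expr1n mul1r//.
under eq_bigr do rewrite Ne.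
rewrite sumr_const card_ffun card_bool card_ord expn1 expr1 -(mulr_natl (_ `^ p)) mulrA mulVf//.
by rewrite mul1r -powRrM mulfV// powRr1// norm_ge0.
Qed.

End Rbd.

Section Rbd_comp.
Variables (R : realType) (p : R) (X Y Z : snSpace R).
Hypotheses (p1 : 1 <= p) (sX : seminormed X) (sY : seminormed Y) (sZ : seminormed Z).
Variable U : set R[i].

Lemma Rbd_comp (S : R[i] -> Y -> Z) (T : R[i] -> X -> Y) c c' : 0 <= c -> maps_on U T ->
  Rbd p U S c -> Rbd p U T c' -> Rbd p U (fun l f => S l (T l f)) (c * c').
Proof.
move=> c0 mT HS HT m l f Ul mf.
apply: le_trans (HS m l (fun j => T (l j) (f j)) Ul _) _ => [j|]; first exact: mT.
by rewrite -mulrA; apply: ler_wpM2l => //; exact: HT.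
Qed.

(** R-bounds dominate operator norms: take a single summand. *)
Lemma Rbd_norm (S : R[i] -> X -> Y) c : maps_on U S -> Rbd p U S c ->
  forall l f, U l -> sn_mem X f -> sn_norm Y (S l f) <= c * sn_norm X f.
Proof.
move=> mS HS l f Ul mf; have := HS 1%N (fun=> l) (fun=> f) (fun=> Ul) (fun=> mf).
by rewrite !rad1//; exact: mS.
Qed.

Lemma half_absorb (a b d e : R) : a <= 2^-1 * b -> b <= d + e -> e <= a -> b <= 2 * d.
Proof. lra. Qed.

(** Since [J f = f - T (J f)], half of the average of the [J f] can be absorbed. *)
Lemma Rbd_inverse (T J : R[i] -> X -> X) : maps_on U T -> maps_on U J ->
  (forall l f, U l -> sn_mem X f -> sn_eq (J l f + T l (J l f)) f) ->
  Rbd p U T 2^-1 -> Rbd p U J 2.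
Proof.
move=> mT mJ JE HT m l f Ul mf.
have mg j : sn_mem X (J (l j) (f j)) by exact: mJ.
have mTg j : sn_mem X (T (l j) (J (l j) (f j))) by exact: mT.
have mNTg j : sn_mem X (- T (l j) (J (l j) (f j))) by exact: memN.
have msum j : sn_mem X (J (l j) (f j) + T (l j) (J (l j) (f j))) by exact: memD.
have H1 := HT m l (fun j => J (l j) (f j)) Ul mg.
have H2 := rad_eq p sX msum mf (fun j => JE _ _ (Ul j) (mf j)).
have H3 := radD p1 sX msum mNTg.
have H4 : rad p (fun j => - T (l j) (J (l j) (f j))) <= rad p (fun j => T (l j) (J (l j) (f j))).
  have := rad_scale p1 sX (-1) mTg; rewrite normcN normc1 mul1r.
  suff -> : (fun j => -1 *: T (l j) (J (l j) (f j))) =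
    (fun j => - T (l j) (J (l j) (f j))) by [].
  by apply/funext => j; rewrite scaleN1r.
have E : (fun j => J (l j) (f j) + T (l j) (J (l j) (f j)) + - T (l j) (J (l j) (f j))) =
    (fun j => J (l j) (f j)) by apply/funext => j; lmodR.
rewrite E H2 in H3.
exact: half_absorb H1 H3 H4.
Qed.

End Rbd_comp.

(** * Inversion of [1 + T] *)

(** Completeness in the form used for Neumann series. The sum need not belong to [V]: a limit
    is only known as a member of [X]. *)
Definition summable_in (R : realType) (X : snSpace R) (V : set X) :=
  forall (x : nat -> X) (C : R), (forall k, V (x k)) ->
    (forall k, sn_norm X (x k) <= C / 2 ^+ k) ->
    exists2 s, sn_mem X s &
      exists K, forall n, sn_norm X (s - \sum_(k < n) x k) <= K / 2 ^+ n.

Section neumann.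
Variables (R : realType) (X : snSpace R).
Hypothesis sX : seminormed X.

Lemma le0_all_pow2 (a b : R) : 0 <= b -> (forall n, a <= b / 2 ^+ n) -> a <= 0.
Proof.
move=> b0 H; apply: (@le0_all_eps _ _ b) => // e e0.
have e0' : 0 <= e^-1 by rewrite invr_ge0 ltW.
have [n Hn] : exists n : nat, e^-1 <= n%:R.
  by exists (Num.bound e^-1); exact/ltW/archi_boundP.
apply: le_trans (H n) _; rewrite mulrC; apply: ler_wpM2r => //.
rewrite -[leRHS]invrK lef_pV2 ?posrE ?exprn_gt0 ?invr_gt0//.
apply: le_trans Hn _; rewrite -natrX ler_nat; exact/ltnW/ltn_expl.
Qed.

(** All terms of the Neumann series except the first belong to the range of [T]: completeness
    is asked of [V] alone. *)
Lemma neumann (V : set X) (T : X -> X) : V `<=` sn_mem X -> summable_in V ->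
  bounded_linear T -> (forall f, sn_mem X f -> V (T f)) ->
  (forall f, sn_mem X f -> sn_norm X (T f) <= 2^-1 * sn_norm X f) ->
  forall f, sn_mem X f -> exists2 g, sn_mem X g & sn_eq (g + T g) f.
Proof.
move=> VX cV bT TV Th f mf.
pose y k := iter k (fun x => - T x) f.
have my k : sn_mem X (y k).
  by elim: k => [//|k IH] /=; apply: memN => //; exact: (bl_mem bT).
have mTy k : sn_mem X (T (y k)) by exact: (bl_mem bT).
have ny k : sn_norm X (y k) <= sn_norm X f / 2 ^+ k.
  elim: k => [|k IH]; first by rewrite expr0 divr1.
  rewrite [y _]/= normN// (le_trans (Th _ (my k)))// exprS invfM mulrCA.
  by rewrite ler_pM2l ?invr_gt0.
pose C := 2^-1 * sn_norm X f.
have nx k : sn_norm X (T (y k)) <= C / 2 ^+ k.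
  by rewrite (le_trans (Th _ (my k)))// /C -mulrA ler_pM2l ?invr_gt0.
have [s ms [K Hs]] := cV (fun k => T (y k)) C (fun k => TV _ (my k)) nx.
pose S n := \sum_(k < n) T (y k); pose Y n := \sum_(k < n) y k.
have mS n : sn_mem X (S n) by apply: mem_sum.
have mY n : sn_mem X (Y n) by apply: mem_sum.
have TY n : sn_eq (T (Y n)) (S n).
  elim: n => [|n IH].
    rewrite /Y /S !big_ord0; have m0 := mem0 sX.
    by have := bl_Z sX sX 0 bT m0; rewrite !scale0r.
  have -> : Y n.+1 = Y n + y n by rewrite /Y big_ord_recr.
  have -> : S n.+1 = S n + T (y n) by rewrite /S big_ord_recr.
  have mYn := mY n; have mSn := mS n; have myn := my n; have mTyn := mTy n.
  have mTY := bl_mem bT mYn; have mYy : sn_mem X (Y n + y n) by memt.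
  have mTYy := bl_mem bT mYy.
  apply: (sn_eq_trans sX) (bl_D bT mYn myn) _; memt.
  by apply: (sn_eqD sX); memt; exact: sn_eq_refl.
(* [y k] is [(-T)^k f], so that the partial sums [Y] and [S] of [y] and [T y] are related. *)
have fS n : f - S n = Y n.+1.
  rewrite /S /Y big_ord_recl; elim: n => [|n IH]; first by rewrite !big_ord0 subr0 addr0.
  rewrite big_ord_recr [in RHS]big_ord_recr /= addrA -IH opprD addrA//.
exists (f - s); first by memt.
have mg : sn_mem X (f - s) by memt.
have mTg := bl_mem bT mg.
apply/eqP; rewrite eq_le norm_ge0 ?andbT//; last by memt.
have nf := norm_ge0 sX mf.
have K0 : 0 <= K.
  have mr0 : sn_mem X (s - \sum_(k < 0) T (y k)) by rewrite big_ord0 subr0.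
  by have := le_trans (norm_ge0 sX mr0) (Hs 0%N); rewrite expr0 divr1.
apply: (@le0_all_pow2 _ K) => // n.
have [mSn mSn1 mYn1] := (And3 (mS n) (mS n.+1) (mY n.+1)).
have mTY := bl_mem bT mYn1.
have mr : sn_mem X (S n - s) by memt.
have mTr := bl_mem bT mr.
have E : sn_eq (T (f - s)) (S n.+1 + T (S n - s)).
  have gE : f - s = Y n.+1 + (S n - s) by rewrite -fS; lmodR.
  rewrite gE; have mYr : sn_mem X (Y n.+1 + (S n - s)) by memt.
  have mTYr := bl_mem bT mYr.
  apply: (sn_eq_trans sX) (bl_D bT mYn1 mr) _; memt.
  by apply: (sn_eqD sX); memt; [exact: TY|exact: sn_eq_refl].
apply: (@le_trans _ _ (sn_norm X ((S n.+1 - s) + T (S n - s)))).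
  apply: (le_norm_eq sX); memt.
  have -> : f - s + T (f - s) - f = - s + T (f - s) by lmodR.
  have -> : S n.+1 - s + T (S n - s) = - s + (S n.+1 + T (S n - s)) by lmodR.
  by apply: (sn_eqD sX); memt; exact: sn_eq_refl.
apply: le_trans (normD sX _ _) _; memt.
have H1 := Hs n.+1; have H2 := Hs n; have H3 := Th _ mr.
rewrite -/(S n) (norm_subC sX)// in H2; rewrite -/(S n.+1) (norm_subC sX)// in H1.
apply: le_trans (lerD H1 H3) _.
apply: (@le_trans _ _ (K / 2 ^+ n.+1 + 2^-1 * (K / 2 ^+ n))).
  by rewrite lerD2l ler_pM2l ?invr_gt0.
by apply: le_of_eq; rewrite exprS; field; rewrite expf_neq0.
Qed.

End neumann.

(** * Perturbed families *)

Section perturbation.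
Variables (R : realType) (p : R) (X Y : snSpace R).
Hypotheses (p1 : 1 <= p) (sX : seminormed X) (sY : seminormed Y).
Variable U : set R[i].
Hypothesis oU : openC U.
Variables T T' J : R[i] -> X -> X.
Hypotheses (HT : deriv_on U T T') (bT : Rbd p U T 2^-1).
Hypothesis bT' : Rbd p U (fun l f => l *: T' l f) 2^-1.
Hypothesis mJ : maps_on U J.
Hypothesis JE : forall l f, U l -> sn_mem X f -> sn_eq (J l f + T l (J l f)) f.
Variables E E' : R[i] -> X -> Y.
Hypothesis HE : deriv_on U E E'.

Let mT : maps_on U T. Proof. by have [] := deriv_on_maps HT. Qed.
Let mT' : maps_on U T'. Proof. by have [] := deriv_on_maps HT. Qed.
Let mE : maps_on U E. Proof. by have [] := deriv_on_maps HE. Qed.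
Let mE' : maps_on U E'. Proof. by have [] := deriv_on_maps HE. Qed.

Let HJ : deriv_on U J (fun l f => - J l (T' l (J l f))).
Proof. exact: (deriv_on_inverse sX oU HT (Rbd_norm p1 sX sX mT bT) mJ JE). Qed.

Let HEJ := deriv_on_comp sX sX sY oU HE HJ.

Lemma Hol_perturbed : Hol U (fun l f => E l (J l f)).
Proof. exact: deriv_on_Hol HEJ. Qed.

(** The inverse [J] of [1 + T] has R-bound at most 2. *)
Lemma Rbd_perturbed (c : R) : 0 <= c -> Rbd p U E c -> Rbd p U (fun l f => E l (J l f)) (2 * c).
Proof.
move=> c0 bE; rewrite mulrC; apply: (Rbd_comp c0 mJ bE).
exact: (Rbd_inverse p1 sX mT mJ JE bT).
Qed.

(** From [(E J)' = E' J - E J T' J], where [J] has R-bound 2 and [l T'] has R-bound 1/2: the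
    two terms of [l (E J)'] have R-bounds [2 c] and [c * 2 * (1/2) * 2 = 2 c]. *)
Lemma Rbd_perturbed_deriv (c : R) : 0 <= c -> Rbd p U E c ->
  Rbd p U (fun l f => l *: E' l f) c ->
  Rbd p U (fun l f => l *: op_deriv (fun l f => E l (J l f)) l f) (4 * c).
Proof.
move=> c0 bE bE'.
have bJ : Rbd p U J 2 by exact: (Rbd_inverse p1 sX mT mJ JE bT).
pose S1 l f := l *: E' l (J l f).
pose S2 l f := - E l (J l (l *: T' l (J l f))).
have mS1 : maps_on U S1.
  by move=> l f Ul mf; apply: (memZ sY); apply: mE' => //; exact: mJ.
have mJT l f : U l -> sn_mem X f -> sn_mem X (l *: T' l (J l f)).
  by move=> Ul mf; apply: (memZ sX); apply: mT' => //; exact: mJ.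
have mS2' : maps_on U (fun l f => E l (J l (l *: T' l (J l f)))).
  by move=> l f Ul mf; apply: mE => //; apply: mJ => //; exact: mJT.
have mS2 : maps_on U S2 by move=> l f Ul mf; apply: (memN sY); exact: mS2'.
have b1 : Rbd p U S1 (c * 2) by exact: (@Rbd_comp _ _ _ _ _ _ _ _ _ _ c0 mJ bE' bJ).
have b2 : Rbd p U S2 (c * (2 * (2^-1 * 2))).
  apply: (Rbd_opp p1 sY mS2').
  apply: (Rbd_comp c0 _ bE) => [l f Ul mf|]; first by apply: mJ => //; exact: mJT.
  apply: (Rbd_comp _ _ bJ) => [//|l f Ul mf|]; first exact: mJT.
  by apply: (@Rbd_comp _ _ _ _ _ _ _ _ _ _ _ mJ bT' bJ); rewrite invr_ge0.
have -> : 4 * c = c * 2 + c * (2 * (2^-1 * 2)) by field.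
have b12 := Rbd_add p1 sY mS1 mS2 b1 b2.
apply: (Rbd_ext sY _ _ _ b12) => [l f Ul mf|l f Ul mf|l f Ul mf].
- by apply: (memD sY); [exact: mS1|exact: mS2].
- have [_ [bl _]] := Hol_deriv_on Hol_perturbed Ul.
  by apply: (memZ sY); exact: (bl_mem bl).
have [_ Hd] := Hol_deriv_on Hol_perturbed Ul; have [_ Hd'] := HEJ Ul.
have bEJ k : U k -> bounded_linear (fun f => E k (J k f)) by move=> /HEJ[].
have := op_deriv_unique sX sY oU bEJ Ul Hd' Hd mf.
have [[bO _] [bO' _]] := (Hd, Hd').
have [mO mO'] := (bl_mem bO mf, bl_mem bO' mf).
move=> /(sn_eqZ sY l mO' mO); apply: (sn_eq_trans sY).
- by apply: (memD sY); [exact: mS1|exact: mS2].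
- by apply: (memZ sY).
- by apply: (memZ sY).
have [bEl _] := HE Ul; have bJl : bounded_linear (J l) by have [] := HJ Ul.
have [bT'l _] := (HT Ul).2; have mJf := mJ Ul mf.
have mw := mT' Ul mJf; have mJw := mJ Ul mw.
have mlw : sn_mem X (l *: T' l (J l f)) by memt.
have mJlw := mJ Ul mlw; have mNJw : sn_mem X (- J l (T' l (J l f))) by memt.
have [[m1 m2] [m3 m4]] := ((mE Ul mJlw, mE Ul mNJw), (mE Ul mJw, mE' Ul mJf)).
rewrite /S1 /S2 /= scalerDr; apply: (sn_eqD sY); memt; first exact: sn_eq_refl.
have e1 : sn_eq (E l (J l (l *: T' l (J l f)))) (l *: E l (J l (T' l (J l f)))).
  have mlJw : sn_mem X (l *: J l (T' l (J l f))) by memt.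
  have m5 := mE Ul mlJw.
  apply: (sn_eq_trans sY) (bl_eq sX sY bEl mJlw mlJw (bl_Z sX sX l bJl mw)) _; memt.
  exact: bl_Z.
have e2 : sn_eq (E l (- J l (T' l (J l f)))) (- E l (J l (T' l (J l f)))).
  rewrite -scaleN1r -[- E l _]scaleN1r; exact: bl_Z.
apply: (sn_eq_trans sY) (_ : sn_eq _ (- (l *: E l (J l (T' l (J l f)))))) _; memt.
  by apply: (sn_eqN sY); memt.
rewrite -scalerN; apply: (sn_eqZ sY); memt.
by apply: (sn_eq_sym sY); memt.
Qed.

End perturbation.

(** * Lebesgue spaces of complex functions *)

Section Lnorm_facts.
Context d (T : measurableType d) (R : realType) (mu : {measure set T -> \bar R}) (q : R).
Hypothesis q0 : 0 < q.
Implicit Types g h : T -> R.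
Local Open Scope ereal_scope.

Lemma measurable_powR_comp (D : set T) g : measurable_fun D g ->
  measurable_fun D (fun x => g x `^ q)%R.
Proof. exact: (@measurableT_comp _ _ _ _ _ _ (@powR R ^~ q)). Qed.

Lemma Lnorm_real g : (forall x, (0 <= g x)%R) ->
  'N[mu]_(q%:E)[EFin \o g] = (\int[mu]_x (g x `^ q)%:E) `^ q^-1.
Proof.
move=> g0; rewrite Lnorm.unlock; congr poweR; apply: eq_integral => x _ /=.
by rewrite ger0_norm.
Qed.

Lemma Lnorm_leP g (c : R) : (forall x, (0 <= g x)%R) -> (0 <= c)%R ->
  'N[mu]_(q%:E)[EFin \o g] <= c%:E <-> \int[mu]_x (g x `^ q)%:E <= (c `^ q)%:E.
Proof.
move=> g0 c0; rewrite Lnorm_real//.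
have i0 : 0 <= \int[mu]_x (g x `^ q)%:E.
  by apply: integral_ge0 => x _; rewrite lee_fin powR_ge0.
have qV : (0 <= q^-1)%R by rewrite invr_ge0 ltW.
split=> H.
  have := gt0_ler_poweR (ltW q0) _ _ H.
  rewrite !in_itv/= !leey !andbT poweR_ge0 lee_fin => /(_ isT c0).
  by rewrite -poweRrM mulVf ?gt_eqF// poweRe1.
have := gt0_ler_poweR qV _ _ H.
rewrite !in_itv/= !leey !andbT i0 lee_fin powR_ge0 => /(_ isT isT).
by rewrite [X in _ <= X]poweR_EFin -powRrM mulfV ?gt_eqF// powRr1.
Qed.

Lemma le_Lnorm g h : measurable_fun setT g -> measurable_fun setT h ->
  (forall x, (0 <= g x <= h x)%R) ->
  'N[mu]_(q%:E)[EFin \o g] <= 'N[mu]_(q%:E)[EFin \o h].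
Proof.
move=> mg mh gh; have [g0 h0] : (forall x, (0 <= g x)%R) /\ (forall x, (0 <= h x)%R).
  by split=> x; have /andP[g0 gh'] := gh x; rewrite // (le_trans g0).
have [Ny|Nfin] := eqVneq 'N[mu]_(q%:E)[EFin \o h] +oo; first by rewrite Ny leey.
have Nf : 'N[mu]_(q%:E)[EFin \o h] \is a fin_num.
  by rewrite ge0_fin_numE ?Lnorm_ge0// lt_neqAle Nfin leey.
rewrite -(fineK Nf); apply/Lnorm_leP => //; first by apply: fine_ge0; exact: Lnorm_ge0.
have : 'N[mu]_(q%:E)[EFin \o h] <= (fine 'N[mu]_(q%:E)[EFin \o h])%:E by rewrite fineK.
move=> /(Lnorm_leP h0 (fine_ge0 (Lnorm_ge0 _ _ _))); apply: le_trans.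
apply: ge0_le_integral => //.
- by move=> x _; rewrite lee_fin powR_ge0.
- exact/measurable_EFinP/measurable_powR_comp.
- exact/measurable_EFinP/measurable_powR_comp.
move=> x _; rewrite lee_fin; have /andP[gx0 ghx] := gh x.
by apply: ge0_ler_powR => //; [exact: ltW|rewrite nnegrE; exact: h0].
Qed.

Lemma Lnorm_scale g (c : R) : measurable_fun setT g -> (forall x, (0 <= g x)%R) ->
  (0 <= c)%R ->
  'N[mu]_(q%:E)[EFin \o (fun x => c * g x)%R] = c%:E * 'N[mu]_(q%:E)[EFin \o g].
Proof.
move=> mg g0 c0; rewrite !Lnorm_real// => [|x]; last by rewrite mulr_ge0.
under eq_integral do rewrite powRM// EFinM.
rewrite ge0_integralZl_EFin ?powR_ge0//; last first.
- exact/measurable_EFinP/measurable_powR_comp.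
- by move=> x _; rewrite lee_fin powR_ge0.
rewrite poweRM ?lee_fin ?powR_ge0//; last first.
  by apply: integral_ge0 => x _; rewrite lee_fin powR_ge0.
by rewrite poweR_EFin -powRrM mulfV ?gt_eqF// powRr1.
Qed.

End Lnorm_facts.

Section Lq.
Variables (R : realType) (n : nat) (G : set 'rV[R]_n) (q : R).
Hypotheses (q1 : 1 <= q) (mG : measurable G).
Implicit Types f g : 'rV[R]_n -> R[i].
Local Notation mu := (leb R n).
Local Notation L := (Lq G q).

Let q0 : 0 < q. Proof. exact: lt_le_trans q1. Qed.

(** Measurability as it is required of the members of [Lq]. *)
Definition cmeas f := measurable_fun G (fun x => complex.Re (f x)) /\
  measurable_fun G (fun x => complex.Im (f x)).

(** Real-valued and defined everywhere, so that the theory of [Lnorm] applies. *)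
Definition modG f : 'rV[R]_n -> R := (fun x => normc (f x)) \_ G.

Lemma modGE f x : modG f x = if x \in G then normc (f x) else 0.
Proof. by []. Qed.

Lemma modG_ge0 f x : 0 <= modG f x.
Proof. by rewrite modGE; case: ifP => // _; exact: normc_ge0. Qed.

Lemma measurable_normc f : cmeas f -> measurable_fun G (fun x => normc (f x)).
Proof.
move=> [mr mi].
have -> : (fun x => normc (f x)) =
    (fun x => Num.sqrt (complex.Re (f x) ^+ 2 + complex.Im (f x) ^+ 2)).
  by apply/funext => x; case: (f x).
have ms : measurable_fun setT (@Num.sqrt R).
  by apply: measurable_realfun.continuous_measurable_fun; exact: sqrt_continuous.
apply: (measurableT_comp ms); apply: measurable_funD; exact: measurable_funX.
Qed.

Lemma measurable_modG f : cmeas f -> measurable_fun setT (modG f).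
Proof.
by move=> mf; apply/(measurable_restrictT _ _).1 => //; exact: measurable_normc.
Qed.

Lemma Lq_finE f : Lq_fin G q f = ('N[mu]_(q%:E)[EFin \o modG f])%E.
Proof.
rewrite /Lq_fin; congr Lnorm; apply/funext => x /=.
by rewrite modGE /patch; case: ifP.
Qed.

Lemma Lq_fin_ge0 f : (0 <= Lq_fin G q f)%E.
Proof. by rewrite Lq_finE; exact: Lnorm_ge0. Qed.

Lemma Lq_memP f : sn_mem L f <-> cmeas f /\ (Lq_fin G q f < +oo)%E.
Proof. by split=> [[? ? ?]|[[? ?] ?]]. Qed.

Lemma Lq_normE f : sn_mem L f -> ((sn_norm L f)%:E = Lq_fin G q f)%E.
Proof. by move=> /Lq_memP[_ fin]; rewrite /= fineK// ge0_fin_numE// Lq_fin_ge0. Qed.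

Lemma cmeas_lin (a : R[i]) f g : cmeas f -> cmeas g -> cmeas (a *: f + g).
Proof.
case: a => ar ai [mr mi] [mr' mi'].
split.
  have -> : (fun x => complex.Re (((ar +i* ai) *: f + g) x)) =
    (fun x => (ar * complex.Re (f x) - ai * complex.Im (f x)) + complex.Re (g x)).
    by apply/funext => x; rewrite !fctE /=; case: (f x) (g x) => [? ?] [? ?].
  by apply: measurable_funD => //; apply: measurable_funB; exact: measurable_funM.
have -> : (fun x => complex.Im (((ar +i* ai) *: f + g) x)) =
  (fun x => (ar * complex.Im (f x) + ai * complex.Re (f x)) + complex.Im (g x)).
  by apply/funext => x; rewrite !fctE /=; case: (f x) (g x) => [? ?] [? ?].
by apply: measurable_funD => //; apply: measurable_funD; exact: measurable_funM.
Qed.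

Lemma Lq_finD f g : cmeas f -> cmeas g ->
  (Lq_fin G q (f + g)%R <= Lq_fin G q f + Lq_fin G q g)%E.
Proof.
move=> mf mg; rewrite !Lq_finE.
have [mmf mmg] := (measurable_modG mf, measurable_modG mg).
apply: le_trans (minkowski_EFin mu mmf mmg q1).
apply: le_Lnorm => //.
- by apply: measurable_modG; rewrite -[f]scale1r; exact: cmeas_lin.
- exact: measurable_funD.
move=> x; rewrite modG_ge0 /= !modGE; case: ifP => _; last by rewrite addr0.
by have := le_normcD (f x) (g x).
Qed.

Lemma Lq_finZ (a : R[i]) f : cmeas f ->
  (Lq_fin G q (a *: f)%R = (normc a)%:E * Lq_fin G q f)%E.
Proof.
move=> mf; rewrite !Lq_finE -Lnorm_scale//; last 3 first.
- exact: measurable_modG.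
- exact: modG_ge0.
- exact: normc_ge0.
congr Lnorm; apply/funext => x /=; rewrite !modGE.
by case: ifP => _; rewrite ?mulr0// fctE normcM.
Qed.

Lemma cmeas0 : cmeas 0.
Proof. by split; exact: measurable_cst. Qed.

Lemma Lq_fin0 : Lq_fin G q 0 = 0%E.
Proof. by rewrite -(scale0r (0 : 'rV[R]_n -> R[i])) Lq_finZ ?normc0 ?mul0e//; exact: cmeas0. Qed.

Lemma seminormed_Lq : seminormed L.
Proof.
have lin (a : R[i]) f g : sn_mem L f -> sn_mem L g -> sn_mem L (a *: f + g).
  move=> /Lq_memP[mf ff] /Lq_memP[mg fg]; apply/Lq_memP.
  have maf : cmeas (a *: f) by rewrite -[_ *: _]addr0; exact: cmeas_lin cmeas0.
  split; first exact: cmeas_lin.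
  apply: le_lt_trans (Lq_finD maf mg) _; rewrite Lq_finZ// lte_add_pinfty//.
  by rewrite lte_mul_pinfty// lee_fin normc_ge0.
have m0 : sn_mem L 0 by apply/Lq_memP; rewrite Lq_fin0; split; [exact: cmeas0|].
split=> // [f mf|f g mf mg|a f mf].
- by rewrite -lee_fin Lq_normE// Lq_fin_ge0.
- have mfg : sn_mem L (f + g) by rewrite -[f]scale1r; exact: lin.
  rewrite -lee_fin EFinD !Lq_normE//.
  by case/Lq_memP: mf mg => mf _ /Lq_memP[mg _]; exact: Lq_finD.
- have maf : sn_mem L (a *: f) by rewrite -[_ *: _]addr0; exact: lin.
  apply: EFin_inj; rewrite EFinM !Lq_normE//.
  by case/Lq_memP: mf => mf _; rewrite Lq_finZ.
Qed.

(** What [sn_eq] means in [Lq]. *)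
Lemma Lq_null f : cmeas f ->
  Lq_fin G q f = 0%E <-> {ae mu, forall x, G x -> f x = 0}.
Proof.
move=> mf; rewrite Lq_finE; split=> [H|H].
  have mE : measurable_fun setT (EFin \o modG f).
    by apply/measurable_EFinP; exact: measurable_modG.
  have := Lnorm_eq0_eq0 mE _ H; rewrite lte_fin => /(_ q0).
  apply: filterS => x /= /(_ Logic.I) [] + Gx.
  by rewrite modGE mem_set// => /eq0_normc.
have -> : ('N[mu]_(q%:E)[EFin \o modG f] = 'N[mu]_(q%:E)[cst 0])%E.
  rewrite Lnorm.unlock; congr poweR; apply: ae_eq_integral => //.
  - apply: (@measurableT_comp _ _ _ _ _ _ (fun x => x `^ q)%E) => //.
      exact: measurable_poweR.
    apply: measurableT_comp => //; apply/measurable_EFinP; exact: measurable_modG.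
  apply: filterS H => x /= Hx _; rewrite modGE; case: ifP => //.
  by rewrite inE => /Hx ->; rewrite normc0.
by rewrite Lnorm0// eqe gt_eqF.
Qed.

End Lq.

Section ae_summable.
Context d (T : measurableType d) (R : realType) (mu : {measure set T -> \bar R}).
Variables (q B : R) (h : nat -> T -> R).
Hypotheses (q1 : 1 <= q) (B0 : 0 <= B).
Hypotheses (mh : forall k, measurable_fun setT (h k)) (h0 : forall k x, 0 <= h k x).
Hypothesis hB : forall m,
  ('N[mu]_(q%:E)[EFin \o (fun x => series (h ^~ x) m)] <= B%:E)%E.

Let q0 : 0 < q. Proof. exact: lt_le_trans q1. Qed.

Lemma le_1powR (t : R) : 0 <= t -> t <= 1 + t `^ q.
Proof.
move=> t0; have [t1|/ltW t1] := leP t 1; first by rewrite (le_trans t1)// lerDl powR_ge0.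
by rewrite -[leLHS](powRr1 t0) (le_trans (ler_powR t1 q1))// lerDr.
Qed.

(** By monotone convergence the [q]-th powers of the partial sums have an integrable
    limit, which is therefore finite almost everywhere. *)
Lemma ae_summable : exists A : set T, [/\ measurable A, mu (~` A) = 0%E
  & forall x, A x -> cvgn (series (h ^~ x))].
Proof.
pose H m x := series (h ^~ x) m.
have H0 m x : 0 <= H m x by rewrite /H /series/= sumr_ge0.
have mH m : measurable_fun setT (H m) by exact: measurable_sum.
have ndH x : nondecreasing_seq (H ^~ x).
  by apply/nondecreasing_seqP => m; rewrite /H /series/= big_nat_recr//= lerDl.
pose P m x := (H m x `^ q)%:E.
have P0 m x : (0 <= P m x)%E by rewrite lee_fin powR_ge0.
have mP m : measurable_fun setT (P m).
  by apply/measurable_EFinP; exact: measurable_powR_comp.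
have ndP x : nondecreasing_seq (P ^~ x).
  move=> m n mn; rewrite lee_fin; apply: ge0_ler_powR; rewrite ?nnegrE//; first exact: ltW.
  exact: ndH.
have IP m : (\int[mu]_x P m x <= (B `^ q)%:E)%E.
  by have /Lnorm_leP := hB m; apply => // x; exact: H0.
pose L x := limn (P ^~ x).
have cP x : P ^~ x @ \oo --> L x by exact: ereal_nondecreasing_is_cvgn.
have mL : measurable_fun setT L by apply: (emeasurable_fun_cvg P) => // x _; exact: cP.
have L0 x : (0 <= L x)%E by apply: lime_ge; [exact: cP|exact: nearW].
have IL : (\int[mu]_x L x <= (B `^ q)%:E)%E.
  rewrite /L monotone_convergence//.
  apply: lime_le; last exact: nearW.
  apply: ereal_nondecreasing_is_cvgn => m n mn; apply: ge0_le_integral => // x _.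
  exact: ndP.
have iL : mu.-integrable setT L.
  apply/integrableP; split=> //; under eq_integral do rewrite gee0_abs//.
  by rewrite (le_lt_trans IL)// ltry.
have mA : measurable [set x | (L x < +oo)%E].
  by have := emeasurable_fun_infty_o measurableT mL +oo%E; rewrite setTI.
exists [set x | (L x < +oo)%E]; split=> //.
  apply/negligibleP; first exact: measurableC.
  have /= := integrable_ae measurableT iL; apply: negligibleS => x /=.
  by move=> Lx; apply: contra_not Lx => /(_ Logic.I); rewrite ge0_fin_numE.
move=> x /= Lx; apply: nondecreasing_is_cvgn; first exact: ndH.
exists (1 + fine (L x)) => _ [m _ <-].
apply: le_trans (le_1powR (H0 m x)) _; rewrite lerD2l -lee_fin fineK ?ge0_fin_numE//.
by have := ereal_nondecreasing_cvgn (ndP x); move=> /cvg_lim; rewrite /L => ->//;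
  apply: ereal_sup_ubound; exists m.
Qed.

End ae_summable.

(** Only the tail matters for the lower limit in Fatou's lemma. *)
Lemma limn_einf_le (R : realType) (u : (\bar R)^nat) (c : \bar R) (n : nat) :
  (forall m, (n <= m)%N -> (u m <= c)%E) -> (limn_einf u <= c)%E.
Proof.
move=> H; rewrite limn_einf_lim; apply: lime_le; first exact: is_cvg_einfs.
exists n => // m /= nm; apply: le_trans (H m nm).
by apply: ereal_inf_lbound; exists m => /=.
Qed.

(** The power function is differentiable at positive limits; at the limit 0 it is squeezed by
    [u^q <= u] for [u <= 1]. *)
Lemma cvg_powR (R : realType) (q : R) (u : nat -> R) (l : R) : 1 <= q ->
  (forall k, 0 <= u k) -> u @ \oo --> l -> (fun k => u k `^ q) @ \oo --> l `^ q.
Proof.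
move=> q1 u0 ul; have q0 : 0 < q by exact: lt_le_trans q1.
have l0 : 0 <= l.
  by rewrite -(cvg_lim _ ul)//; apply: limr_ge; [exact: cvgP ul|exact: nearW].
move: l0; rewrite le_eqVlt => /predU1P[l0|l0].
  rewrite -l0 powR0 ?gt_eqF// in ul *.
  have u1 : \forall k \near \oo, u k < 1 by apply: (@cvgr_lt _ _ _ _ u 0 ul); exact: ltr01.
  apply: (@squeeze_cvgr _ _ _ _ (cst 0) u) ul; last exact: cvg_cst.
  near=> k; rewrite powR_ge0/=; have := u0 k; rewrite le_eqVlt => /predU1P[<-|uk].
    by rewrite powR0 ?gt_eqF.
  by apply: ge1r_powR => //; rewrite uk/= ltW//; near: k.
have cl : {for l, continuous (fun t : R => t `^ q)}.
  apply/differentiable_continuous/derivable1_diffP.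
  by apply: derivable_powR; rewrite in_itv/= l0.
exact: (cvg_comp u (fun t : R => t `^ q) ul cl).
Unshelve. all: by end_near. Qed.

Section riesz_fischer.
Variables (R : realType) (n : nat) (G : set 'rV[R]_n) (q : R).
Hypotheses (q1 : 1 <= q) (mG : measurable G).
Local Notation mu := (leb R n).
Local Notation L := (Lq G q).
Let q0 : 0 < q. Proof. exact: lt_le_trans q1. Qed.
Let sL := seminormed_Lq q1 mG.

Lemma geo_sum (C : R) (m k : nat) : 0 <= C -> (m <= k)%N ->
  \sum_(m <= i < k) C / 2 ^+ i <= 2 * C / 2 ^+ m.
Proof.
move=> C0 mk; suff -> : \sum_(m <= i < k) C / 2 ^+ i = 2 * C / 2 ^+ m - 2 * C / 2 ^+ k.
  by rewrite gerBl divr_ge0 ?mulr_ge0.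
elim: k mk => [|k IH]; first by rewrite leqn0 => /eqP->; rewrite big_geq// subrr.
rewrite leq_eqVlt => /predU1P[->|]; first by rewrite big_geq// subrr.
rewrite ltnS => mk; rewrite big_nat_recr//= IH// exprS.
by field; rewrite !expf_neq0.
Qed.

Lemma norm_sum_geo (x : nat -> L) (C : R) (m k : nat) : 0 <= C -> (m <= k)%N ->
  (forall k, sn_mem L (x k)) -> (forall k, sn_norm L (x k) <= C / 2 ^+ k) ->
  sn_norm L (\sum_(m <= i < k) x i) <= 2 * C / 2 ^+ m.
Proof.
move=> C0 mk mx nx; apply: le_trans (geo_sum C0 mk).
apply: (@le_trans _ _ (\sum_(m <= i < k) sn_norm L (x i))).
  by apply: (norm_sum sL) => i _; exact: mx.
by apply: ler_sum => i _; exact: nx.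
Qed.

Lemma normc_leD (z : R[i]) : `|complex.Re z| <= normc z /\ `|complex.Im z| <= normc z.
Proof.
case: z => a b /=; rewrite -!sqrtr_sqr !ler_sqrt ?addr_ge0 ?sqr_ge0//.
by rewrite lerDl lerDr !sqr_ge0.
Qed.

(** The moduli are summable almost everywhere, hence so are real and imaginary parts; Fatou's
    lemma bounds the norm of the tail of the series by the tails of the geometric series. *)
Lemma riesz_fischer : summable_in (sn_mem L).
Proof.
move=> x C mx nx.
have C0 : 0 <= C.
  by have := le_trans (norm_ge0 sL (mx 0%N)) (nx 0%N); rewrite expr0 divr1.
have cx k : cmeas G (x k) by have /Lq_memP[] := mx k.
pose h k := modG G (x k).
have mh k : measurable_fun setT (h k) by exact: measurable_modG.
have h0 k y : 0 <= h k y by exact: modG_ge0.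
have hB m : ('N[mu]_(q%:E)[EFin \o (fun y => series (h ^~ y) m)] <= (2 * C)%:E)%E.
  have H k : ('N[mu]_(q%:E)[EFin \o h k] <= (C / 2 ^+ k)%:E)%E.
    by rewrite -Lq_finE -Lq_normE// lee_fin.
  have mser j : measurable_fun setT (fun y => series (h ^~ y) j) by exact: measurable_sum.
  apply: (@le_trans _ _ (\sum_(0 <= i < m) C / 2 ^+ i)%:E); last first.
    by have := geo_sum C0 (leq0n m); rewrite expr0 divr1 lee_fin.
  elim: m => [|m IH].
    rewrite big_geq//; have -> : EFin \o (fun y => series (h ^~ y) 0) = cst 0%E.
      by apply/funext => y /=; rewrite /series/= big_geq.
    by rewrite Lnorm0// eqe gt_eqF.
  rewrite big_nat_recr//= EFinD; apply: le_trans (leeD IH (H m)).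
  have -> : (fun y => series (h ^~ y) m.+1) =
    (fun y => series (h ^~ y) m) \+ h m.
    by apply/funext => y; rewrite /series/= big_nat_recr.
  exact: minkowski_EFin.
have [A [mA A0 cA]] := ae_summable q1 (mulr_ge0 (ler0n R 2) C0) mh h0 hB.
have hE k y : G y -> h k y = normc (x k y).
  by move=> Gy; rewrite /h modGE mem_set.
have cvpart (part : R[i] -> R) : (forall z, `|part z| <= normc z) ->
    forall y, A y -> G y -> cvgn (series (fun k => part (x k y))).
  move=> partz y /cA cAy Gy; apply: normed_cvg.
  by apply: series_le_cvg cAy => k; rewrite ?normr_ge0// hE//; exact: partz.
have cvRe := cvpart (@complex.Re R) (fun z => (normc_leD z).1).
have cvIm := cvpart (@complex.Im R) (fun z => (normc_leD z).2).
(* outside of [AG], where nothing is known, all terms are replaced by 0 *)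
pose AG := A `&` G; have mAG : measurable AG by exact: measurableI.
pose sr y := limn (series (fun k => ((fun z => complex.Re (x k z)) \_ AG) y)).
pose si y := limn (series (fun k => ((fun z => complex.Im (x k z)) \_ AG) y)).
pose s : 'rV[R]_n -> R[i] := fun y => sr y +i* si y.
have z0 : cvgn (series (fun _ : nat => 0 : R)).
  rewrite (_ : series _ = cst 0); first exact: is_cvg_cst.
  by apply/funext => k; rewrite /series/= big1.
have cr y : series (fun k => ((fun z => complex.Re (x k z)) \_ AG) y) @ \oo --> sr y.
  rewrite /sr /patch; have [/[!inE] -[Ay Gy]|_] := boolP (y \in AG); first exact: cvRe.
  exact: z0.
have ci y : series (fun k => ((fun z => complex.Im (x k z)) \_ AG) y) @ \oo --> si y.
  rewrite /si /patch; have [/[!inE] -[Ay Gy]|_] := boolP (y \in AG); first exact: cvIm.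
  exact: z0.
have cs : cmeas G s.
  split; apply: (measurable_funS measurableT) => //.
    apply: (measurable_fun_cvg _ (fun y _ => cr y)) => m.
    apply: measurable_sum => k; apply/(measurable_restrictT _ _).1 => //.
    by apply: (measurable_funS mG); [exact: subIsetr|case: (cx k)].
  apply: (measurable_fun_cvg _ (fun y _ => ci y)) => m.
  apply: measurable_sum => k; apply/(measurable_restrictT _ _).1 => //.
  by apply: (measurable_funS mG); [exact: subIsetr|case: (cx k)].
pose S m := \sum_(k < m) x k.
have mS m : sn_mem L (S m) by apply: mem_sum => // k _; exact: mx.
have cS m : cmeas G (S m) by have /Lq_memP[] := mS m.
have csS m : cmeas G (s - S m).
  by rewrite addrC -scaleN1r; exact: cmeas_lin.
have main m : (Lq_fin G q (s - S m)%R <= (2 * C / 2 ^+ m)%:E)%E.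
  have c0 : 0 <= 2 * C / 2 ^+ m by rewrite divr_ge0 ?mulr_ge0.
  rewrite Lq_finE; apply/(Lnorm_leP _ _ _) => //; first exact: modG_ge0.
  have mD k : sn_mem L (S k - S m) by exact: (memB sL).
  have cD k : cmeas G (S k - S m) by have /Lq_memP[] := mD k.
  pose f k y := (modG G (S k - S m) y `^ q)%:E.
  have mf k (D : set 'rV[R]_n) : measurable D -> measurable_fun D (f k).
    move=> mD'; apply: (measurable_funS measurableT) => //.
    by apply/measurable_EFinP/measurable_powR_comp; exact: measurable_modG.
  have f0 k y : (0 <= f k y)%E by rewrite lee_fin powR_ge0.
  rewrite (@ge0_negligible_integral _ _ _ mu setT (~` A)) ?setTD ?setCK//; last 3 first.
  - exact: measurableC.
  - by apply/measurable_EFinP/measurable_powR_comp; exact: measurable_modG.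
  - by move=> y _; rewrite lee_fin powR_ge0.
  have lim y : A y -> f ^~ y @ \oo --> (modG G (s - S m) y `^ q)%:E.
    move=> Ay; apply: cvg_EFin; first exact: nearW.
    apply: cvg_powR => // [k|]; first exact: modG_ge0.
    rewrite modGE; have [Gy|Gy] := boolP (y \in G); last first.
      rewrite (_ : (fun k => _) = cst 0); first exact: cvg_cst.
      by apply/funext => k /=; rewrite modGE (negbTE Gy).
    rewrite inE in Gy; have AGy : y \in AG by rewrite inE; split.
    have nE (z : R[i]) : normc z = Num.sqrt (complex.Re z ^+ 2 + complex.Im z ^+ 2).
      by case: z.
    have -> : (fun k => modG G (S k - S m) y) =
      (fun k => Num.sqrt ((series (fun k => ((fun z => complex.Re (x k z)) \_ AG) y) k
          - complex.Re (S m y)) ^+ 2 +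
        (series (fun k => ((fun z => complex.Im (x k z)) \_ AG) y) k
          - complex.Im (S m y)) ^+ 2)).
      apply/funext => k; rewrite modGE mem_set// nE.
      have -> : (S k - S m) y = S k y - S m y by [].
      rewrite !raddfB/= /series/= /patch AGy !big_mkord.
      by rewrite /S !fct_sumE !raddf_sum.
    rewrite nE; have -> : (s - S m) y = s y - S m y by [].
    apply: continuous_cvg; first exact: sqrt_continuous.
    rewrite !raddfB /=; apply: cvgD; rewrite !expr2.
      by apply: cvgM; apply: cvgB; [exact: cr|exact: cvg_cst|exact: cr|exact: cvg_cst].
    by apply: cvgM; apply: cvgB; [exact: ci|exact: cvg_cst|exact: ci|exact: cvg_cst].
  have -> : (\int[mu]_(y in A) (modG G (s - S m) y `^ q)%:E =
      \int[mu]_(y in A) limn_einf (f ^~ y))%E.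
    apply: eq_integral => y; rewrite inE => /lim ly.
    by have [-> _] := cvg_limn_einf_sup ly.
  apply: (@le_trans _ _ (limn_einf (fun k => \int[mu]_(y in A) f k y)%E)).
    by apply: fatou => // k; exact: mf.
  apply: (@limn_einf_le _ _ _ m) => k mk.
  apply: (@le_trans _ _ (\int[mu]_y f k y)%E).
    by apply: ge0_subset_integral => //; exact: mf.
  have : (Lq_fin G q (S k - S m)%R <= (2 * C / 2 ^+ m)%:E)%E.
    rewrite -Lq_normE// lee_fin.
    have -> : S k - S m = \sum_(m <= i < k) x i.
      rewrite /S -!(big_mkord xpredT x) (big_cat_nat (leq0n m) mk)/=.
      by rewrite addrAC subrr add0r.
    exact: norm_sum_geo.
  by rewrite Lq_finE => /Lnorm_leP; apply=> //; exact: modG_ge0.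
have ms : sn_mem L s.
  apply/Lq_memP; split=> //; have := main 0%N.
  rewrite /S big_ord0 subr0 => /le_lt_trans; apply; exact: ltry.
exists s => //; exists (2 * C) => m; rewrite -lee_fin Lq_normE; first exact: main.
exact: (memB sL ms (mS m)).
Qed.

End riesz_fischer.

(** * Borel sets of the coordinate spaces *)

Section borel_rV.
Variables (R : realType) (n : nat).
Local Notation "'Rn'" := 'rV[R]_n.+1.
Implicit Types (a b x y : Rn).

Definition obox a b : set Rn := [set x | forall i, a ord0 i < x ord0 i < b ord0 i].
Definition cbox a b : set Rn := [set x | forall i, a ord0 i <= x ord0 i <= b ord0 i].

Lemma measurable_coord (i : 'I_n.+1) : measurable_fun setT (fun x : Rn => x ord0 i).
Proof.
move=> _ Y mY; rewrite setTI; apply: sub_sigma_algebra; rewrite -bigcup_seq/=.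
by exists i => /=; [rewrite mem_index_enum | exists Y; rewrite ?setTI].
Qed.

Lemma measurable_coordsI (P : 'I_n.+1 -> set R) : (forall i, measurable (P i)) ->
  measurable [set x : Rn | forall i, P i (x ord0 i)].
Proof.
move=> mP; have -> : [set x : Rn | forall i, P i (x ord0 i)] =
    \bigcap_(i in [set: 'I_n.+1]) [set x : Rn | P i (x ord0 i)].
  by apply/seteqP; split=> x /= H; [move=> i _; exact: H|move=> i; exact: (H i)].
apply: fin_bigcap_measurable => // i _.
by have := measurable_coord i measurableT (mP i); rewrite setTI.
Qed.

Lemma measurable_obox a b : measurable (obox a b).
Proof.
have -> : obox a b =
    [set x : Rn | forall i, `]a ord0 i, b ord0 i[%classic (x ord0 i)].
  by apply/seteqP; split=> x /= H i; have := H i; rewrite /= in_itv.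
exact: (@measurable_coordsI (fun i => `]a ord0 i, b ord0 i[%classic)).
Qed.

Lemma measurable_cbox a b : measurable (cbox a b).
Proof.
have -> : cbox a b =
    [set x : Rn | forall i, `[a ord0 i, b ord0 i]%classic (x ord0 i)].
  by apply/seteqP; split=> x /= H i; have := H i; rewrite /= in_itv.
exact: (@measurable_coordsI (fun i => `[a ord0 i, b ord0 i]%classic)).
Qed.

Lemma compact_cbox a b : compact (cbox a b).
Proof.
have -> : cbox a b =
    [set x : Rn | forall i, `[a ord0 i, b ord0 i]%classic (x ord0 i)].
  by apply/seteqP; split=> x /= H i; have := H i; rewrite /= in_itv.
apply: (@rV_compact _ _ (fun i => `[a ord0 i, b ord0 i]%classic)) => i.
exact: segment_compact.
Qed.

Lemma coord_ball x (e : R) y : 0 < e -> (forall i, `|x ord0 i - y ord0 i| < e) -> ball x e y.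
Proof. by move=> e0 H; split=> // j i; rewrite (ord1 j); exact: H. Qed.

(** Cubes with rational centre and inverse integer radius: countably many of them fill an open
    set. *)
Lemma open_measurable_rV (U : set Rn) : open U -> measurable U.
Proof.
move=> oU.
pose r (k : nat) : R := k.+1%:R^-1.
have r0 k : 0 < r k by rewrite invr_gt0.
pose B (ck : 'rV[rat]_n.+1 * nat) : set Rn :=
  [set x | forall i, `|ratr (ck.1 ord0 i) - x ord0 i| < r ck.2].
have mB ck : measurable (B ck).
  have -> : B ck = obox (\row_i (ratr (ck.1 ord0 i) - r ck.2))
                        (\row_i (ratr (ck.1 ord0 i) + r ck.2)).
    apply/seteqP; split=> x /= H i; have := H i; rewrite !mxE distrC;
      by rewrite ltr_distl.
  exact: measurable_obox.
have -> : U = \bigcup_ck (if `[< B ck `<=` U >] then B ck else set0).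
  apply/seteqP; split=> x; last first.
    by move=> [ck _]; case: ifP => // /asboolP BU /BU.
  move=> Ux; have /nbhs_ballP[e /= e0 He] : nbhs x U by exact: open_nbhs_nbhs.
  have [k Hk] : exists k, r k < e / 2.
    have e20 : 0 <= (e / 2)^-1 by rewrite invr_ge0 divr_ge0// ltW.
    exists (Num.bound (e / 2)^-1); rewrite -[ltRHS]invrK /r ltf_pV2 ?posrE ?invr_gt0 ?divr_gt0//.
    by apply: lt_trans (archi_boundP e20) _; rewrite ltr_nat.
  have cx i : exists c : rat, `|ratr c - x ord0 i| < r k.
    have : x ord0 i - r k < x ord0 i + r k by have := r0 k; lra.
    by move=> /rat_in_itvoo[c]; rewrite in_itv/= => Hc; exists c; rewrite ltr_distl.
  have [c Hc] := choice cx; pose ck := (\row_i c i, k) : 'rV[rat]_n.+1 * nat.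
  exists ck => //; rewrite ifT; first by move=> i /=; rewrite mxE; exact: Hc.
  apply/asboolP => y By; apply: He; apply: coord_ball => // i.
  have := By i; have := Hc i; rewrite /= mxE => H1 H2.
  have -> : x ord0 i - y ord0 i = (ratr (c i) - y ord0 i) - (ratr (c i) - x ord0 i) by ring.
  apply: le_lt_trans (ler_normB _ _) _; move: H1 H2 Hk; lra.
apply: countable_bigcupT_measurable => [|ck]; first exact: countableP.
by case: ifP.
Qed.

Lemma continuous_measurable_rV (f : Rn -> R) : continuous f -> measurable_fun setT f.
Proof.
move=> /continuousP cf; apply: (measurability _ (RGenOpens.measurableE R)).
move=> _ [_ [a [b ->] <-]]; rewrite setTI; apply: open_measurable_rV.
exact/cf/interval_open.
Qed.

Lemma compact_measurable_rV (K : set Rn) : compact K -> measurable K.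
Proof.
move=> cK; have cl : closed K := compact_closed (@norm_hausdorff R 'rV[R]_n.+1) cK.
by have /measurableC := open_measurable_rV (closed_openC cl); rewrite setCK.
Qed.

Lemma compact_sub_cbox (K : set Rn) : compact K -> exists2 M : R, 0 < M &
  K `<=` cbox (const_mx (- M)) (const_mx M).
Proof.
move=> /compact_bounded[M [_ HM]]; exists (`|M| + 1); first by rewrite ltr_wpDl.
move=> x Kx i; rewrite !mxE -ler_norml.
have Mlt : M < `|M| + 1 by rewrite (le_lt_trans (ler_norm M))// ltrDl.
apply: le_trans (HM _ Mlt x Kx).
by rewrite /Num.Def.normr/= mx_normrE (le_bigmax _ _ (ord0, i)).
Qed.

Lemma leb_cbox_fin a b : (leb R n.+1 (cbox a b) < +oo)%E.
Proof.
pose a' : Rn := \row_i (a ord0 i - 1); pose b' : Rn := \row_i (`|a ord0 i| + `|b ord0 i|).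
have ab' i : a' ord0 i <= b' ord0 i.
  rewrite !mxE (@le_trans _ _ (a ord0 i))//; first lra.
  by rewrite (le_trans (ler_norm _))// lerDl.
have mab : measurable [set x : Rn | forall i, a' ord0 i < x ord0 i <= b' ord0 i].
  have -> : [set x : Rn | forall i, a' ord0 i < x ord0 i <= b' ord0 i] =
      [set x : Rn | forall i, `]a' ord0 i, b' ord0 i]%classic (x ord0 i)].
    by apply/seteqP; split=> x /= H i; have := H i; rewrite /= in_itv.
  exact: (@measurable_coordsI (fun i => `]a' ord0 i, b' ord0 i]%classic)).
have sub : cbox a b `<=` [set x : Rn | forall i, a' ord0 i < x ord0 i <= b' ord0 i].
  move=> x /= H i; have /andP[H1 H2] := H i; rewrite !mxE; apply/andP; split; first lra.
  by rewrite (le_trans H2)// (le_trans (ler_norm _))// lerDr.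
apply: (@le_lt_trans _ _ (\prod_(i < n.+1) (b' ord0 i - a' ord0 i))%:E); last exact: ltry.
have <- := leb_box ab'.
exact: (le_measure (leb R n.+1) (mem_set (measurable_cbox a b)) (mem_set mab) sub).
Qed.

Lemma leb_compact_fin (K : set Rn) : compact K -> (leb R n.+1 K < +oo)%E.
Proof.
move=> cK; have [M M0 KM] := compact_sub_cbox cK.
apply: le_lt_trans (leb_cbox_fin (const_mx (- M)) (const_mx M)).
by apply: le_measure; rewrite ?inE; [exact: compact_measurable_rV|exact: measurable_cbox|].
Qed.

Lemma open_half_space : open (@half_space R n).
Proof.
rewrite openE => x /= Px.
have := @coord_continuous R 1 n.+1 ord0 ord_max x [set t | 0 < t].
by apply; apply: open_nbhs_nbhs; split=> //; exact: open_gt.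
Qed.

Lemma measurable_half_space : measurable (@half_space R n).
Proof. exact: open_measurable_rV open_half_space. Qed.

Lemma setI_obox a b a' b' : obox a b `&` obox a' b' =
  obox (\row_i Num.max (a ord0 i) (a' ord0 i)) (\row_i Num.min (b ord0 i) (b' ord0 i)).
Proof.
apply/seteqP; split=> x /=.
  move=> [H1 H2] i; rewrite !mxE gt_max lt_min.
  by case/andP: (H1 i) (H2 i) => -> -> /andP[-> ->].
by move=> H; split=> i; have := H i; rewrite !mxE gt_max lt_min =>
  /andP[/andP[? ?] /andP[? ?]];
  apply/andP.
Qed.

Definition oboxes : set (set Rn) := [set A | exists a b, A = obox a b].

Lemma setI_closed_oboxes : setI_closed oboxes.
Proof. by move=> _ _ [a [b ->]] [a' [b' ->]]; rewrite setI_obox; do 2 eexists. Qed.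

(** The preimage of an interval under a coordinate is a countable union of boxes. *)
Lemma measurable_sub_oboxes (A : set Rn) : measurable A -> <<s oboxes >> A.
Proof.
apply: smallest_sub; first exact: smallest_sigma_algebra.
rewrite -bigcup_seq/=; apply: bigcup_sub => i _ _ [B mB <-]; rewrite setTI.
pose coord (x : Rn) := x ord0 i.
suff: <<s @RGenOpens.G R >> `<=` [set B | <<s oboxes >> (coord @^-1` B)].
  have GB : (@RGenOpens.G R).-sigma.-measurable B.
    by rewrite -RGenOpens.measurableE; exact: mB.
  by move=> /(_ B GB).
apply: smallest_sub.
  split=> /=.
  - by rewrite preimage_set0; exact: sigma_algebra0.
  - by move=> C HC; rewrite setTD preimage_setC; exact: sigma_algebraC.
  - by move=> F HF; rewrite preimage_bigcup; exact: sigma_algebra_bigcup.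
move=> _ [s [t ->]] /=.
pose aa (k : nat) : Rn := \row_j (if j == i then s else - k%:R).
pose bb (k : nat) : Rn := \row_j (if j == i then t else k%:R).
have -> : coord @^-1` `]s, t[%classic = \bigcup_k obox (aa k) (bb k).
  apply/seteqP; split=> x /=.
    rewrite in_itv/= => xst; exists (Num.bound `|x|) => // j; rewrite !mxE.
    case: eqP => [->//|_]; rewrite -ltr_norml.
    apply: le_lt_trans (archi_boundP (normr_ge0 x)).
    by rewrite /Num.Def.normr/= mx_normrE (le_bigmax _ _ (ord0, j)).
  by move=> [k _ H]; have := H i; rewrite !mxE eqxx in_itv.
apply: sigma_algebra_bigcup => k; apply: sub_sigma_algebra.
by exists (aa k), (bb k).
Qed.

(** Sides of length of order [k], at distance [1 / k] from the boundary. *)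
Lemma half_space_boxes : exists a b : nat -> Rn,
  (forall k, cbox (a k) (b k) `<=` @half_space R n) /\
  (forall x, half_space x -> exists k, obox (a k) (b k) x).
Proof.
exists (fun k => \row_i (if i == ord_max then k.+1%:R^-1 else - k.+1%:R)).
exists (fun k => \row_i k.+1%:R); split=> [k x /(_ ord_max)|x].
  by rewrite !mxE eqxx => /andP[+ _]; apply: lt_le_trans; rewrite invr_gt0.
rewrite /half_space /= => x0; pose M := Num.max `|x| (x ord0 ord_max)^-1.
have M0 : 0 <= M by rewrite le_max normr_ge0.
have MB : M < (Num.bound M).+1%:R.
  by apply: lt_trans (archi_boundP M0) _; rewrite ltr_nat.
exists (Num.bound M) => i; rewrite !mxE.
have xM : `|x ord0 i| < (Num.bound M).+1%:R.
  apply: le_lt_trans MB; rewrite le_max; apply/orP; left.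
  by rewrite [leRHS]/Num.Def.normr/= mx_normrE (le_bigmax _ _ (ord0, i)).
case: eqP => [iE|_]; last by rewrite -ltr_norml.
rewrite (le_lt_trans (ler_norm _) xM) andbT iE -[ltRHS]invrK ltf_pV2 ?posrE ?invr_gt0//.
by apply: le_lt_trans MB; rewrite le_max lexx orbT.
Qed.

End borel_rV.

(** * Smooth functions supported in a box *)

Section bump.
Variable R : realType.
Implicit Types (P Q : {poly R}) (t : R).

(** Extended by 0 from the positive half-line, [P(1/t) exp(-1/t)] is smooth: its
    derivative has the same form. *)
Definition flat P t : R := if 0 < t then P.[t^-1] * expR (- t^-1) else 0.

(** With [x = 1/t] one has [d/dt = - x^2 d/dx]. *)
Definition dflat P : {poly R} := 'X^2 * (P - P^`()).

Lemma flatZ (c : R) P t : flat (c *: P) t = c * flat P t.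
Proof. by rewrite /flat; case: ifP => _; rewrite ?mulr0// hornerZ mulrA. Qed.

Lemma horner_bound P : exists2 C : R, 0 <= C &
  forall x, 1 <= x -> `|P.[x]| <= C * x ^+ (size P).
Proof.
exists (\sum_(i < size P) `|P`_i|) => [|x x1]; first exact: sumr_ge0.
rewrite horner_coef mulr_suml; apply: le_trans (ler_norm_sum _ _ _) _.
apply: ler_sum => i _; rewrite normrM ler_wpM2l// ger0_norm; last first.
  by rewrite exprn_ge0// (le_trans _ x1).
by rewrite ler_weXn2l// ltnW.
Qed.

(** The bound [(x / (m+1))^(m+1) <= exp x] is the power of [1 + y <= exp y]. *)
Lemma expR_decay (m : nat) (x : R) : 0 < x -> expR (- x) * x ^+ m.+1 <= m.+1%:R ^+ m.+1.
Proof.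
move=> x0; have m0 : 0 < m.+1%:R :> R by rewrite ltr0n.
have xm : 0 <= x / m.+1%:R by rewrite divr_ge0 ?ltW.
have H : (x / m.+1%:R) ^+ m.+1 <= expR x.
  have -> : expR x = expR (x / m.+1%:R) ^+ m.+1.
    by rewrite -expRM_natl mulrCA divff ?mulr1// gt_eqF.
  rewrite lerXn2r ?nnegrE ?expR_ge0//.
  by apply: le_trans (expR_ge1Dx _); rewrite lerDr.
rewrite expRN mulrC ler_pdivrMr ?expR_gt0// mulrC -ler_pdivrMr ?exprn_gt0//.
by rewrite -expr_div_n.
Qed.

Lemma flat_bound P : exists2 C : R, 0 <= C &
  forall t, 0 < t <= 1 -> `|flat P t| <= C * t.
Proof.
have [C C0 HC] := horner_bound P; pose m := size P.
exists (C * m.+1%:R ^+ m.+1) => [|t /andP[t0 t1]].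
  by rewrite mulr_ge0// exprn_ge0.
have it0 : 0 < t^-1 by rewrite invr_gt0.
have it1 : 1 <= t^-1 by rewrite -invr1 lef_pV2 ?posrE.
rewrite /flat t0 normrM (ger0_norm (expR_ge0 _)).
apply: (@le_trans _ _ (C * t^-1 ^+ m * expR (- t^-1))).
  by apply: ler_wpM2r; [exact: expR_ge0|exact: HC].
have := expR_decay m it0; rewrite exprS => H.
have -> : C * t^-1 ^+ m * expR (- t^-1) =
    C * (expR (- t^-1) * (t^-1 * t^-1 ^+ m)) * t.
  have tt : t^-1 * t = 1 by rewrite mulVf// gt_eqF.
  by rewrite -[LHS]mulr1 -tt; ring.
by rewrite ler_pM2r// ler_wpM2l.
Qed.

Lemma flat_cvg0 P : flat P t @[t --> (0 : R)] --> (0 : R).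
Proof.
have [C C0 HC] := flat_bound P.
apply/cvgrPdist_lt => e e0.
have C1 : 0 < C + 1 by rewrite ltr_wpDl.
have d0 : 0 < Num.min 1 (e / (C + 1)) by rewrite lt_min ltr01 divr_gt0.
have nb : \forall t \near nbhs (0 : R), `|t| < Num.min 1 (e / (C + 1)).
  exact: (@nbhs0_lt _ R^o _ d0).
near=> t; rewrite sub0r normrN.
have [t0|t0] := ltP 0 t; last by rewrite /flat (le_gtF t0) normr0.
have te : `|t| < Num.min 1 (e / (C + 1)) by near: t.
move: te; rewrite gtr0_norm// lt_min => /andP[t1 te].
apply: (@le_lt_trans _ _ (C * t)); first by apply: HC; rewrite t0 ltW.
rewrite ltr_pdivlMr// in te; apply: le_lt_trans te.
by rewrite mulrC ler_pM2l// lerDl.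
Unshelve. all: by end_near. Qed.

(** At 0 the difference quotient of [flat P] is again flat, hence tends to 0. *)
Lemma is_derive_flat P t : is_derive t 1 (flat P) (flat (dflat P) t).
Proof.
have [t0|t0|t0] := ltgtP t 0.
- have -> : flat (dflat P) t = 0 by rewrite /flat (lt_gtF t0).
  apply: (@near_eq_is_derive _ _ _ (cst 0)).
  near=> s; rewrite /flat/= ifF//; apply/negbTE; rewrite -leNgt ltW//.
  by near: s; exact: lt_nbhsl.
- have NE : \near t, P.[t^-1] * expR (- t^-1) = flat P t.
    by near=> s; rewrite /flat ifT//; near: s; exact: lt_nbhsr.
  suff F : is_derive t 1 (fun s => P.[s^-1] * expR (- s^-1)) (flat (dflat P) t).
    by apply: near_eq_is_derive NE F.
  have tn0 : t != 0 by rewrite gt_eqF.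
  have dV : is_derive t 1 (fun s : R => s^-1) (- t^-2).
    apply: DeriveDef; first by apply: (@derivableV _ _ id).
    by rewrite (@deriveV _ _ id)//= derive_id /GRing.scale/= mulr1.
  have dP : is_derive t 1 (fun s => P.[s^-1]) (- t^-2 * P^`().[t^-1]).
    have := @is_derive1_comp R (horner P) (fun s : R => s^-1) t _ _ (is_derive_poly P t^-1) dV.
    by rewrite mulrC.
  have dE : is_derive t 1 (fun s => expR (- s^-1)) (t^-2 * expR (- t^-1)).
    have dN : is_derive t 1 (fun s : R => - s^-1) (t^-2).
      by rewrite -[t^-2]opprK; exact: is_deriveN.
    have := @is_derive1_comp R expR (fun s : R => - s^-1) t _ _ (is_derive_expR _) dN.
    by rewrite mulrC.
  refine (is_derive_eq (is_deriveM dP dE) _).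
  rewrite /flat t0 /dflat !hornerE /GRing.scale/=.
  by rewrite exprVn; ring.
rewrite t0; have F0 Q : flat Q 0 = 0 by rewrite /flat ltxx.
have H : (fun h => h^-1 *: ((flat P \o shift 0) (h *: (1 : R)) - flat P 0)) @ 0^' --> (0 : R).
  have -> : (fun h => h^-1 *: ((flat P \o shift 0) (h *: (1 : R)) - flat P 0)) =
     flat ('X * P).
    apply/funext => h; rewrite F0 subr0 /= addr0 /GRing.scale/= mulr1 /flat.
    by case: ifP => _; rewrite ?mulr0// hornerM hornerX mulrA.
  exact: cvg_within_filter (flat_cvg0 _).
by apply: DeriveDef; [apply: cvgP H|rewrite F0; exact: cvg_lim H].
Unshelve. all: by end_near. Qed.

Variables (k a b : R).

(** Sums of products of a flat function vanishing to the left of [a] and one vanishing to the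
    right of [b]: this class is stable under derivation, which [dbumps] computes. *)
Definition bumps (s : seq ({poly R} * {poly R})) t : R :=
  \sum_(PQ <- s) flat PQ.1 (k * (t - a)) * flat PQ.2 (k * (b - t)).

Definition dbumps (s : seq ({poly R} * {poly R})) :=
  flatten [seq [:: (k *: dflat PQ.1, PQ.2); (- k *: PQ.1, dflat PQ.2)] | PQ <- s].

Lemma is_derive_bumps s t : is_derive t 1 (bumps s) (bumps (dbumps s) t).
Proof.
have term PQ : is_derive t 1 (fun t => flat PQ.1 (k * (t - a)) * flat PQ.2 (k * (b - t)))
    (bumps [:: (k *: dflat PQ.1, PQ.2); (- k *: PQ.1, dflat PQ.2)] t).
  have d1 : is_derive t 1 (fun t => k * (t - a)) k.
    have := @is_deriveZ _ _ _ (fun t => t - a) k t 1 1 _.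
    rewrite /GRing.scale/= mulr1; apply.
    by apply: is_derive_eq; rewrite subr0.
  have d2 : is_derive t 1 (fun t => k * (b - t)) (- k).
    have D : is_derive t 1 (fun t : R => b - t) (-1).
      exact: (is_derive_eq (is_deriveB (is_derive_cst b t 1) (is_derive_id t 1)) (sub0r _)).
    by refine (is_derive_eq (is_deriveZ k D) _); rewrite /GRing.scale/= mulrN1.
  have e1 := @is_derive1_comp R (flat PQ.1) (fun t => k * (t - a)) t _ _ (is_derive_flat _ _) d1.
  have e2 := @is_derive1_comp R (flat PQ.2) (fun t => k * (b - t)) t _ _ (is_derive_flat _ _) d2.
  refine (is_derive_eq (is_deriveM e1 e2) _).
  rewrite /bumps !big_cons big_nil addr0 /= !flatZ /GRing.scale/=; ring.
have -> : bumps s = \sum_(PQ <- s) (fun t => flat PQ.1 (k * (t - a)) * flat PQ.2 (k * (b - t))).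
  by apply/funext => u; rewrite fct_sumE.
elim: s => [|PQ s IH].
  by rewrite big_nil /bumps big_nil; exact: is_derive_cst.
rewrite big_cons; refine (is_derive_eq (is_deriveD (term PQ) IH) _).
by rewrite {3}/bumps /dbumps/= !big_cons /bumps !big_cons big_nil addr0 addrA.
Qed.

Lemma bumps_out s t : 0 < k -> ~ a < t < b -> bumps s t = 0.
Proof.
move=> k0 tab; rewrite /bumps big1// => PQ _; rewrite /flat !pmulr_rgt0// !subr_gt0.
case: (ltP a t) => [at_|_]; last by rewrite mul0r.
case: (ltP t b) => [tb|_]; last by rewrite mulr0.
by case: tab; rewrite at_ tb.
Qed.

Lemma continuous_bumps s : continuous (bumps s).
Proof.
move=> t; apply/differentiable_continuous/derivable1_diffP.
exact: (@ex_derive _ _ _ _ _ _ _ (is_derive_bumps s t)).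
Qed.

Definition bump t := bumps [:: (1, 1)] t.

Lemma bumpE t : 0 < k -> a < t < b ->
  bump t = expR (- (k * (t - a))^-1) * expR (- (k * (b - t))^-1).
Proof.
move=> k0 /andP[at_ tb]; rewrite /bump /bumps big_seq1/= /flat !pmulr_rgt0// !subr_gt0.
by rewrite at_ tb !hornerE /= mulr1.
Qed.

Lemma bump_01 t : 0 < k -> 0 <= bump t <= 1.
Proof.
move=> k0; have [tab|/negP tab] := boolP (a < t < b); last first.
  by rewrite /bump bumps_out// lexx ler01.
rewrite bumpE// mulr_ge0 ?expR_ge0//= mulr_ile1 ?expR_ge0// -expR0 ler_expR oppr_le0 invr_ge0.
  by case/andP: tab => *; rewrite mulr_ge0 ?subr_ge0 ?ltW.
by case/andP: tab => *; rewrite mulr_ge0 ?subr_ge0 ?ltW.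
Qed.

End bump.

(** As the steepness [k] grows, the bump functions approach the indicator function. *)
Lemma bump_cvg (R : realType) (a b t : R) : a < t < b ->
  (fun j : nat => bump j.+1%:R a b t) @ \oo --> (1 : R).
Proof.
move=> tab; have [at_ tb] := andP tab.
have H (u : R) : 0 < u -> (fun j : nat => expR (- (j.+1%:R * u)^-1)) @ \oo --> (1 : R).
  move=> u0; rewrite -[X in _ --> X]expR0.
  apply: continuous_cvg; first exact: continuous_expR.
  rewrite -[X in _ --> X]oppr0; apply: cvgN.
  rewrite (_ : (fun j : nat => _) = (fun j : nat => harmonic j * u^-1)); last first.
    by apply/funext => j; rewrite invfM.
  rewrite -[X in _ --> X](mul0r u^-1); apply: cvgMr_tmp; exact: cvg_harmonic.
rewrite (_ : (fun j : nat => _) = (fun j : nat => expR (- (j.+1%:R * (t - a))^-1) *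
  expR (- (j.+1%:R * (b - t))^-1))); last by apply/funext => j; rewrite bumpE.
by rewrite -[X in _ --> X]mulr1; apply: cvgM; apply: H; rewrite subr_gt0.
Qed.

(** * Test functions supported in a box *)

Section box_bumps.
Variables (R : realType) (n : nat).
Local Notation "'Rn'" := 'rV[R]_n.+1.
Implicit Types (a b x : Rn).

(** Partial derivatives are derivatives along a line. *)
Lemma is_derive_coord (f : Rn -> R) (g : R -> R) (dg : R) x (i : 'I_n.+1) :
  (forall h, f (h *: 'e_i + x) = g (h + x ord0 i)) ->
  is_derive (x ord0 i) 1 g dg -> derivable f x 'e_i /\ 'D_('e_i) f x = dg.
Proof.
move=> fg [dgx gE].
have E : (fun h : R => h^-1 *: ((f \o shift x) (h *: 'e_i) - f x)) =
    (fun h : R => h^-1 *: ((g \o shift (x ord0 i)) (h *: (1 : R)) - g (x ord0 i))).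
  apply/funext => h /=; rewrite fg; have := fg 0; rewrite scale0r !add0r => ->.
  by rewrite /GRing.scale/= mulr1.
by split; [rewrite /derivable E|rewrite /derive E; exact: gE].
Qed.

Variables (k : R) (a b : Rn).
Hypothesis k0 : 0 < k.

(** [c i] is the order of derivation in the [i]-th variable, so that all partial derivatives
    of the product of bumps are of this form. *)
Definition boxbump (c : 'I_n.+1 -> nat) x : R :=
  \prod_i bumps k (a ord0 i) (b ord0 i) (iter (c i) (dbumps k) [:: (1, 1)]) (x ord0 i).

Lemma boxbump_partial c x (i : 'I_n.+1) :
  derivable (boxbump c) x 'e_i /\
  'D_('e_i) (boxbump c) x = boxbump (fun j => (i == j) + c j)%N x.
Proof.
pose C := \prod_(j | j != i)
  bumps k (a ord0 j) (b ord0 j) (iter (c j) (dbumps k) [:: (1, 1)]) (x ord0 j).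
pose s := iter (c i) (dbumps k) [:: (1, 1)].
have -> : boxbump (fun j => (i == j) + c j)%N x =
    C *: bumps k (a ord0 i) (b ord0 i) (dbumps k s) (x ord0 i).
  rewrite /boxbump (bigD1 i)//= eqxx add1n mulrC; congr (_ * _).
  by apply: eq_bigr => j ji; rewrite eq_sym (negbTE ji) add0n.
apply: (@is_derive_coord _ (C \*: bumps k (a ord0 i) (b ord0 i) s)).
  move=> h; rewrite /boxbump (bigD1 i)//= mulrC; congr (_ * _).
    apply: eq_bigr => j ji; rewrite !mxE eqxx/= eq_sym.
    by rewrite eq_sym (negbTE ji) mulr0 add0r.
  by rewrite !mxE !eqxx/= mulr1.
by apply: is_deriveZ; exact: is_derive_bumps.
Qed.

Lemma continuous_boxbump c : continuous (boxbump c).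
Proof.
apply: continuous_big => [|i _ x]; first exact: mul_continuous.
apply: (continuous_comp (@coord_continuous R 1 n.+1 ord0 i x)).
exact: continuous_bumps.
Qed.

Lemma pderivs_boxbump s :
  pderivs s (boxbump (fun=> 0%N)) = boxbump (fun j => count_mem j s).
Proof.
elim: s => [//|i s IH] /=; rewrite -/(pderivs s _) IH.
by apply/funext => x; have [_ ->] := boxbump_partial (fun j => count_mem j s) x i.
Qed.

Lemma smooth_boxbump : smooth (boxbump (fun=> 0%N)).
Proof.
move=> s; rewrite pderivs_boxbump; split; first exact: continuous_boxbump.
by move=> i x; have [] := boxbump_partial (fun j => count_mem j s) x i.
Qed.

Lemma boxbump_out c x : ~ obox a b x -> boxbump c x = 0.
Proof.
move=> /existsNP[i abx]; rewrite /boxbump (bigD1 i)//= bumps_out ?mul0r//.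
Qed.

Lemma test_boxbump (G : set Rn) : cbox a b `<=` G -> test_fun G (boxbump (fun=> 0%N)).
Proof.
move=> abG; split; first exact: smooth_boxbump.
exists (cbox a b); first by split; [exact: compact_cbox|].
move=> x abx; apply: boxbump_out; apply: contra_not abx => abx i.
by have /andP[/ltW-> /ltW->] := abx i.
Qed.

Lemma boxbump_01 x : 0 <= boxbump (fun=> 0%N) x <= 1.
Proof.
rewrite /boxbump; elim/big_ind: _ => [|u v /andP[u0 u1] /andP[v0 v1]|i _].
- by rewrite ler01 lexx.
- by rewrite mulr_ge0//= mulr_ile1.
- exact: (bump_01 _ _ _ k0).
Qed.

End box_bumps.

Lemma boxbump_cvg (R : realType) (n : nat) (a b x : 'rV[R]_n.+1) : obox a b x ->
  (fun j : nat => boxbump j.+1%:R a b (fun=> 0%N) x) @ \oo --> (1 : R).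
Proof.
move=> abx; have K := @cvg_big R 'I_n.+1 *%R 1 xpredT (@mul_continuous R) nat \oo
  (index_enum _) (fun i j => bumps j.+1%:R (a ord0 i) (b ord0 i) [:: (1, 1)] (x ord0 i))
  (fun=> 1) _ (fun i _ => bump_cvg (abx i)).
by rewrite big1 in K => [|//]; exact: K.
Qed.

(** * Uniqueness of weak derivatives *)

Section du_bois_reymond.
Variables (R : realType) (n : nat).
Local Notation "'Rn'" := 'rV[R]_n.+1.
Local Notation H := (@half_space R n).
Local Notation mu := (leb R n.+1).
Variable z : Rn -> R.
Hypothesis iz : forall K : set Rn, compact K -> K `<=` H ->
  mu.-integrable K (EFin \o z).
Hypothesis z0 : forall phi, test_fun H phi -> \int[mu]_(x in H) (z x * phi x) = 0.
Implicit Types (a b : Rn).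

Let iz_obox a b : cbox a b `<=` H -> mu.-integrable (obox a b) (EFin \o z).
Proof.
move=> abH; apply: (integrableS (measurable_cbox a b)) (iz (@compact_cbox _ _ a b) abH).
  exact: measurable_obox.
by move=> x abx i; have /andP[/ltW-> /ltW->] := abx i.
Qed.

(** The indicator function of a box is the limit of test functions bounded by 1. *)
Lemma integral_obox0 a b : cbox a b `<=` H ->
  (\int[mu]_(x in obox a b) (z x)%:E = 0)%E.
Proof.
move=> abH; pose phi (j : nat) := boxbump j.+1%:R a b (fun=> 0%N).
have izab := iz_obox abH; have mab := measurable_obox a b.
have mz : measurable_fun (obox a b) z by have /measurable_EFinP := measurable_int _ izab.
have mphi j : measurable_fun (obox a b) (phi j).
  apply: (measurable_funS measurableT) => //; apply: continuous_measurable_rV.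
  exact: continuous_boxbump.
have j0 (j : nat) : 0 < j.+1%:R :> R by rewrite ltr0n.
have [||||| _ _] := @dominated_convergence _ _ _ mu _ mab
    (fun j x => (z x * phi j x)%:E) (fun x => (z x)%:E) (fun x => `|(z x)%:E|%E).
- by move=> j; apply/measurable_EFinP; exact: measurable_funM.
- exact/measurable_EFinP.
- apply: aeW => x abx; apply: cvg_EFin; first exact: nearW.
  rewrite -[X in _ --> X]mulr1; apply: cvgM; first exact: cvg_cst.
  exact: boxbump_cvg.
- exact: integrable_abse.
- apply: aeW => x j abx; rewrite lee_fin normrM ler_piMr//.
  by have /andP[p0 p1] := boxbump_01 a b (j0 j) x; rewrite ger0_norm.
rewrite (_ : [sequence _]_j = cst 0%E); last first.
  apply/funext => j /=.
  pose f x := (z x * phi j x)%:E.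
  have fE : f \_ (obox a b) = f \_ H.
    apply/funext => x; rewrite /patch; case: ifPn => [/[!inE] abx|/negP abx].
      rewrite ifT// inE; apply: abH => i.
      by have /andP[/ltW-> /ltW->] := abx i.
    case: ifP => // _; rewrite /f /phi boxbump_out ?mulr0// => abx'.
    by apply: abx; rewrite inE.
  have -> : (\int[mu]_(x in obox a b) f x = \int[mu]_(x in H) f x)%E.
    by rewrite [LHS]integral_mkcond [RHS]integral_mkcond fE.
  have izphi : mu.-integrable (obox a b) f.
    apply: (le_integrable mab _ _ izab).
      by apply/measurable_EFinP; exact: measurable_funM.
    move=> x abx; rewrite lee_fin normrM ler_piMr//.
    by have /andP[p0 p1] := boxbump_01 a b (j0 j) x; rewrite ger0_norm.
  have izH : mu.-integrable H f.
    have [_ +] := @integrable_mkcond _ _ _ mu H f (@measurable_half_space R n); apply.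
    by rewrite -fE; have [+ _] := @integrable_mkcond _ _ _ mu _ f mab; apply.
  have := z0 (test_boxbump (j0 j) abH); rewrite /Rintegral => z0j.
  have fin := integrable_fin_num (@measurable_half_space R n) izH.
  by rewrite -(fineK fin) z0j.
move=> c0; apply/esym; exact: (cvg_unique _ (cvg_cst 0%E) c0).
Qed.

Lemma measurable_oboxesE : @measurable _ 'rV[R]_n.+1 = <<s @oboxes R n >>.
Proof.
apply/seteqP; split; first exact: measurable_sub_oboxes.
apply: smallest_sub; first exact: sigma_algebra_measurable.
by move=> _ [a [b ->]]; exact: measurable_obox.
Qed.

(** The sets on whose intersection with the box [z] has integral 0 form a Dynkin system that
    contains all boxes, which are stable under intersection and generate the Borel sets. *)
Lemma ae_obox0 a b : cbox a b `<=` H -> ae_eq mu (obox a b) (EFin \o z) (cst 0%E).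
Proof.
move=> abH; have izab := iz_obox abH; have mab := measurable_obox a b.
have izS (E : set Rn) : measurable E -> E `<=` obox a b ->
    mu.-integrable E (EFin \o z).
  by move=> mE Eab; exact: (integrableS mab mE Eab izab).
pose P (A : set Rn) := (\int[mu]_(x in A `&` obox a b) (z x)%:E = 0)%E.
have PA A : measurable A -> P A.
  move=> mA; have : <<s @oboxes R n >> A by rewrite -measurable_oboxesE.
  move: A {mA}; apply: dynkin_induction.
  - exact: measurable_oboxesE.
  - exact: setI_closed_oboxes.
  - by rewrite /P setTI; exact: integral_obox0.
  - move=> A [a' [b' ->]]; rewrite /P setI_obox; apply: integral_obox0 => x xab.
    apply: abH => i; have := xab i; rewrite !mxE ge_max le_min.
    by move=> /andP[/andP[_ ->] /andP[_ ->]].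
  - move=> A mA; rewrite /P => A0.
    have := integral_obox0 abH.
    have {1}-> : obox a b = (A `&` obox a b) `|` (~` A `&` obox a b).
      by rewrite -setIUl setUv setTI.
    rewrite integral_setU ?A0 ?add0e//.
    + exact: measurableI.
    + by apply: measurableI => //; exact: measurableC.
    + by rewrite -setIUl setUv setTI; exact: (measurable_int _ izab).
    + by apply/disj_setPS => x [[Ax _] [nAx _]]; exact: nAx.
  - move=> F mF tF PF; rewrite /P setI_bigcupl integral_bigcup.
    + by apply: eseries0 => k _ _; exact: PF.
    + by apply: trivIset_setIr.
    + by move=> k; exact: measurableI.
    + apply: izS; last by apply: bigcup_sub => k _; exact: subIsetr.
      by apply: bigcup_measurable => k _; exact: measurableI.
apply: integral_ae_eq => // E Eab mE; rewrite integral0.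
by have := PA E mE; rewrite /P setIidl.
Qed.

(** Countably many boxes exhaust the half-space. *)
Lemma du_bois_reymond : {ae mu, forall x, H x -> z x = 0}.
Proof.
have [a [b [abH Hab]]] := @half_space_boxes R n.
have Q k : {ae mu, forall x, obox (a k) (b k) x -> z x = 0}.
  by apply: filterS (ae_obox0 (abH k)) => x /= + abx => /(_ abx) [].
have : {ae mu, forall x (k : nat), obox (a k) (b k) x -> z x = 0}.
  exact: ae_foralln.
by apply: filterS => x zx /Hab[k /zx].
Qed.

End du_bois_reymond.

Arguments leb : simpl never.

(** * Weak derivatives *)

Section weak_derivatives.
Variables (R : realType) (n : nat).
Local Notation "'Rn'" := 'rV[R]_n.+1.
Local Notation H := (@half_space R n).
Local Notation mu := (leb R n.+1).
Local Notation mH := (@measurable_half_space R n).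
Implicit Types (f g : Rn -> R[i]) (s : seq 'I_n.+1) (phi : Rn -> R).

Lemma derive_outside (K : set Rn) phi (i : 'I_n.+1) : compact K ->
  (forall x, ~ K x -> phi x = 0) -> forall x, ~ K x -> 'D_('e_i) phi x = 0.
Proof.
move=> cK phi0 x Kx; have cl : closed K := compact_closed (@norm_hausdorff R Rn) cK.
have NE : \near x, phi x = cst 0 x.
  have : nbhs x (~` K) by apply: open_nbhs_nbhs; split=> //; exact: closed_openC.
  by apply: filterS => y /phi0.
by rewrite (near_eq_derive _ NE) derive_cst.
Qed.

(** What is used of the derivatives of test functions. *)
Definition compactly_supported phi := continuous phi /\
  exists K : set Rn, [/\ compact K, K `<=` H & forall x, ~ K x -> phi x = 0].

Lemma test_pderivs s phi : test_fun H phi -> compactly_supported (pderivs s phi).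
Proof.
move=> [sm [K [cK KH] phi0]]; split; first by case: (sm s).
exists K; split=> //; elim: s => [//|i s IH] /= x Kx.
exact: (derive_outside i cK IH Kx).
Qed.

Lemma compactly_supported_bound phi : compactly_supported phi ->
  exists2 M : R, 0 < M & forall x, `|phi x| <= M.
Proof.
move=> [cphi [K [cK KH phi0]]].
have /compact_bounded[M [_ HM]] : compact (phi @` K).
  by apply: continuous_compact => //; exact: continuous_subspaceT.
exists (`|M| + 1) => [|x]; first by rewrite ltr_wpDl.
have Mlt : M < `|M| + 1 by rewrite (le_lt_trans (ler_norm M))// ltrDl.
have [Kx|Kx] := pselect (K x); first by apply: (HM _ Mlt); exists x.
by rewrite phi0// normr0 addr_ge0.
Qed.

Lemma integrable_test (z : Rn -> R) phi : compactly_supported phi ->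
  (forall K : set Rn, compact K -> K `<=` H -> mu.-integrable K (EFin \o z)) ->
  mu.-integrable H (fun x => (z x * phi x)%:E).
Proof.
move=> bphi iz; have [M M0 HM] := compactly_supported_bound bphi.
have [cphi [K [cK KH phi0]]] := bphi.
have mK := compact_measurable_rV cK; have izK := iz K cK KH.
have mz : measurable_fun K z by have /measurable_EFinP := measurable_int _ izK.
have mphi : measurable_fun K phi.
  by apply: (measurable_funS measurableT) => //; exact: continuous_measurable_rV.
pose f x := (z x * phi x)%:E.
have iK : mu.-integrable K f.
  have iM : mu.-integrable K (fun x => (M%:E * (z x)%:E)%E) by exact: integrableZl.
  apply: (le_integrable mK _ _ iM).
    by apply/measurable_EFinP; exact: measurable_funM.
  by move=> x Kx; rewrite lee_fin !normrM mulrC ler_wpM2r// (le_trans (HM x))// ler_norm.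
have fE : f \_ K = f \_ H.
  apply/funext => x; rewrite /patch; case: ifPn => [/[!inE] Kx|/negP Kx].
    by rewrite ifT// inE; exact: KH.
  by case: ifP => // _; rewrite /f phi0 ?mulr0// => Kx'; apply: Kx; rewrite inE.
have [_ +] := @integrable_mkcond _ _ _ mu H f mH; apply.
by rewrite -fE; have [+ _] := @integrable_mkcond _ _ _ mu K f mK; apply.
Qed.

Lemma CintegralL (a : R[i]) f g phi : compactly_supported phi ->
  loc_integrable H f -> loc_integrable H g ->
  Cintegral H (fun x => (a *: f + g) x * (phi x)%:C) =
  a * Cintegral H (fun x => f x * (phi x)%:C) + Cintegral H (fun x => g x * (phi x)%:C).
Proof.
move=> bphi lf lg; case: a => ar ai.
have ifr := integrable_test bphi (fun K cK KH => (lf K cK KH).1).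
have ifi := integrable_test bphi (fun K cK KH => (lf K cK KH).2).
have igr := integrable_test bphi (fun K cK KH => (lg K cK KH).1).
have igi := integrable_test bphi (fun K cK KH => (lg K cK KH).2).
have Rint (u : Rn -> R[i]) :
    \int[mu]_(x in H) complex.Re (u x * (phi x)%:C) =
    \int[mu]_(x in H) (complex.Re (u x) * phi x).
  by apply: eq_Rintegral => x _; case: (u x) => ? ? /=; rewrite mulr0 subr0.
have Iint (u : Rn -> R[i]) :
    \int[mu]_(x in H) complex.Im (u x * (phi x)%:C) =
    \int[mu]_(x in H) (complex.Im (u x) * phi x).
  by apply: eq_Rintegral => x _; case: (u x) => ? ? /=; rewrite mulr0 add0r.
have Z (c : R) (u : Rn -> R) : mu.-integrable H (EFin \o u) ->
    mu.-integrable H (EFin \o (fun x => c * u x)).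
  by move=> iu; have := integrableZl mH c iu.
rewrite /Cintegral !Rint !Iint.
apply/eqP; rewrite eq_complex /=; apply/andP; split; apply/eqP.
  rewrite -(RintegralZl ar mH ifr) -(RintegralZl ai mH ifi).
  rewrite -(RintegralB mH (Z ar _ ifr) (Z ai _ ifi)).
  rewrite -(RintegralD mH (integrableB mH (Z ar _ ifr) (Z ai _ ifi)) igr).
  apply: eq_Rintegral => x _ /=; rewrite !fctE /=.
  by case: (f x) (g x) => [? ?] [? ?] /=; ring.
rewrite -(RintegralZl ar mH ifi) -(RintegralZl ai mH ifr).
rewrite -(RintegralD mH (Z ar _ ifi) (Z ai _ ifr)).
rewrite -(RintegralD mH (integrableD mH (Z ar _ ifi) (Z ai _ ifr)) igi).
apply: eq_Rintegral => x _ /=; rewrite !fctE /=.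
by case: (f x) (g x) => [? ?] [? ?] /=; ring.
Qed.

Lemma Cintegral0 phi : Cintegral H (fun x => (0 : Rn -> R[i]) x * (phi x)%:C) = 0.
Proof.
by rewrite /Cintegral /Rintegral !integral0_eq//= => x _; rewrite !mul0r ?subr0 ?addr0.
Qed.

Lemma loc_integrableL (a : R[i]) f g : loc_integrable H f -> loc_integrable H g ->
  loc_integrable H (a *: f + g).
Proof.
move=> lf lg K cK KH; have [fr fi] := lf K cK KH; have [gr gi] := lg K cK KH.
have mK := compact_measurable_rV cK; case: a => ar ai.
have Z (c : R) (u : Rn -> R) : mu.-integrable K (EFin \o u) ->
    mu.-integrable K (fun x => (c * u x)%:E).
  by move=> iu; have := integrableZl mK c iu.
split.
  have := integrableD mK (integrableB mK (Z ar _ fr) (Z ai _ fi)) gr.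
  apply: eq_integrable => // x _ /=.
  by rewrite -EFinB -EFinD !fctE /=; case: (f x) (g x) => [? ?] [? ?].
have := integrableD mK (integrableD mK (Z ar _ fi) (Z ai _ fr)) gi.
apply: eq_integrable => // x _ /=.
by rewrite -!EFinD !fctE /=; case: (f x) (g x) => [? ?] [? ?].
Qed.

Lemma is_weak_derivL (a : R[i]) s f f' g g' : is_weak_deriv H s f f' ->
  is_weak_deriv H s g g' -> is_weak_deriv H s (a *: f + g) (a *: f' + g').
Proof.
move=> [lf lf' Ef] [lg lg' Eg]; split; [exact: loc_integrableL|exact: loc_integrableL|].
move=> phi tphi; have bs := test_pderivs s tphi; have b0 := test_pderivs [::] tphi.
rewrite (CintegralL _ bs lf lg) (CintegralL _ b0 lf' lg') Ef// Eg//=; ring.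
Qed.

(** The difference of two weak derivatives is orthogonal to all test functions. *)
Lemma is_weak_deriv_unique s f g g' : is_weak_deriv H s f g -> is_weak_deriv H s f g' ->
  {ae mu, forall x, H x -> g x = g' x}.
Proof.
move=> Wg Wg'; have := is_weak_derivL (-1) Wg' Wg.
set z := -1 *: g' + g => -[_ lz Ez].
have l0 : loc_integrable H (0 : Rn -> R[i]).
  by move=> K cK _; split; apply: integrable0 => //; exact: compact_measurable_rV.
have E0 phi : test_fun H phi -> Cintegral H (fun x => z x * (phi x)%:C) = 0.
  move=> tphi; have := Ez phi tphi.
  have -> : -1 *: f + f = 0 by rewrite scaleN1r addNr.
  rewrite Cintegral0.
  by move=> /esym/eqP; rewrite mulf_eq0 signr_eq0/= => /eqP.
have zr : {ae mu, forall x, H x -> complex.Re (z x) = 0}.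
  apply: du_bois_reymond => [K cK KH|phi tphi]; first by case: (lz K cK KH).
  apply: etrans (congr1 (@complex.Re R) (E0 phi tphi)).
  by apply: eq_Rintegral => x _; case: (z x) => ? ? /=; rewrite mulr0 subr0.
have zi : {ae mu, forall x, H x -> complex.Im (z x) = 0}.
  apply: du_bois_reymond => [K cK KH|phi tphi]; first by case: (lz K cK KH).
  apply: etrans (congr1 (@complex.Im R) (E0 phi tphi)).
  by apply: eq_Rintegral => x _; case: (z x) => ? ? /=; rewrite mulr0 add0r.
apply: filterS2 zr zi => x zr zi Hx; have {zr} := zr Hx; have {zi} := zi Hx.
have -> : z x = g x - g' x by rewrite /z scaleN1r addrC.
case: (g x) (g' x) => [a b] [c d] /= /eqP; rewrite subr_eq0 => /eqP-> /eqP.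
by rewrite subr_eq0 => /eqP->.
Qed.

Lemma loc_integrable_cmeas f : loc_integrable H f -> cmeas H f.
Proof.
move=> lf.
have [a [b [abH Hab]]] := @half_space_boxes R n.
have HE : H = \bigcup_k cbox (a k) (b k).
  apply/seteqP; split=> [x /Hab[k abx]|x [k _]]; last exact: abH.
  by exists k => // i; have /andP[/ltW-> /ltW->] := abx i.
split; rewrite HE; apply/measurable_fun_bigcup => [k|k].
- exact: measurable_cbox.
- have [/measurable_int/measurable_EFinP + _] := lf _ (@compact_cbox _ _ (a k) (b k)) (@abH k).
  exact.
- exact: measurable_cbox.
- have [_ /measurable_int/measurable_EFinP +] := lf _ (@compact_cbox _ _ (a k) (b k)) (@abH k).
  exact.
Qed.

Lemma loc_integrable_null f : cmeas H f -> {ae mu, forall x, H x -> f x = 0} ->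
  loc_integrable H f.
Proof.
move=> [mr mi] f0 K cK KH; have mK := compact_measurable_rV cK.
have I (u : Rn -> R) : measurable_fun H u -> {ae mu, forall x, H x -> u x = 0} ->
    mu.-integrable K (fun x => (u x)%:E).
  move=> mu_ u0; have muK : measurable_fun K u by exact: (measurable_funS mH KH mu_).
  apply/integrableP; split; first exact/measurable_EFinP.
  rewrite (ae_eq_integral (cst 0%E)) ?integral0 ?ltry//.
    by apply: measurableT_comp => //; exact/measurable_EFinP.
  by apply: filterS u0 => x /= ux Kx; rewrite ux ?normr0//; exact: KH.
by split; apply: I => //; apply: filterS f0 => x /= fx Hx; rewrite fx.
Qed.

(** Null functions are measurable, hence locally integrable, and do not contribute to any of
    the integrals. *)
Lemma is_weak_deriv_null s f : cmeas H f -> {ae mu, forall x, H x -> f x = 0} ->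
  is_weak_deriv H s f 0.
Proof.
move=> mf f0; have lf := loc_integrable_null mf f0; split=> //.
  by move=> K cK _; split; apply: integrable0 => //; exact: compact_measurable_rV.
move=> phi tphi; have [cphi _] := test_pderivs s tphi.
have mphi : measurable_fun H (pderivs s phi).
  by apply: (measurable_funS measurableT) => //; exact: continuous_measurable_rV.
have Z (u : Rn -> R) : measurable_fun H u -> {ae mu, forall x, H x -> u x = 0} ->
    \int[mu]_(x in H) (u x * pderivs s phi x) = 0.
  move=> mu_ u0; rewrite /Rintegral (ae_eq_integral (cst 0%E)) ?integral0//.
  - exact: mH.
  - by apply/measurable_EFinP; exact: measurable_funM.
  - by apply: filterS u0 => x /= ux Hx; rewrite ux ?mul0r.
rewrite Cintegral0 mulr0 /Cintegral; apply/eqP; rewrite eq_complex /=; apply/andP.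
case: mf => mr mi; split; apply/eqP.
  rewrite -[RHS](Z (fun x => complex.Re (f x)))//.
    by apply: eq_Rintegral => x _; case: (f x) => ? ? /=; rewrite mulr0 subr0.
  by apply: filterS f0 => x /= fx Hx; rewrite fx.
rewrite -[RHS](Z (fun x => complex.Im (f x)))//.
  by apply: eq_Rintegral => x _; case: (f x) => ? ? /=; rewrite mulr0 add0r.
by apply: filterS f0 => x /= fx Hx; rewrite fx.
Qed.

End weak_derivatives.

(** * Sobolev spaces on the half-space *)

Section sobolev.
Variables (R : realType) (n : nat) (q : R).
Hypothesis q1 : 1 <= q.
Local Notation "'Rn'" := 'rV[R]_n.+1.
Local Notation H := (@half_space R n).
Local Notation mu := (leb R n.+1).
Local Notation mH := (@measurable_half_space R n).
Local Notation L := (Lq H q).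
Local Notation W m := (Wmq H m q).
Local Notation wd s f := (wderiv H s f).
Implicit Types (f g : Rn -> R[i]) (s : seq 'I_n.+1).

Let sL : seminormed L := seminormed_Lq q1 mH.
Let q0 : 0 < q. Proof. exact: lt_le_trans q1. Qed.

(** On a compact set, which has finite measure, [t <= 1 + t^q] dominates the modulus. *)
Lemma Lq_loc_integrable f : sn_mem L f -> loc_integrable H f.
Proof.
move=> /Lq_memP[cf finf] K cK KH; have mK := compact_measurable_rV cK.
have mm := measurable_modG mH cf.
have I : (\int[mu]_x (modG H f x `^ q)%:E < +oo)%E.
  have fin : Lq_fin H q f \is a fin_num by rewrite ge0_fin_numE// Lq_fin_ge0.
  have : ('N[mu]_(q%:E)[EFin \o modG H f] <= (fine (Lq_fin H q f))%:E)%E.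
    by rewrite -Lq_finE fineK.
  move=> /(Lnorm_leP _ q0 (modG_ge0 _ _) (fine_ge0 (Lq_fin_ge0 _ _ _))) /le_lt_trans.
  by apply; exact: ltry.
pose D x := 1 + modG H f x `^ q.
have mD (E : set Rn) : measurable E -> measurable_fun E D.
  move=> mE; apply: (measurable_funS measurableT) => //; apply: measurable_funD => //.
  exact: measurable_powR_comp.
have iD : mu.-integrable K (EFin \o D).
  apply/integrableP; split; first by apply/measurable_EFinP; exact: mD.
  have D0 x : 0 <= D x by rewrite addr_ge0// powR_ge0.
  under eq_integral => x _ do rewrite /= ger0_norm// EFinD.
  rewrite ge0_integralD//=; last 2 first.
  - by move=> x _; rewrite lee_fin powR_ge0.
  - apply/measurable_EFinP; apply: (measurable_funS measurableT) => //.
    exact: measurable_powR_comp.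
  rewrite integral_cst// mul1e lte_add_pinfty//; first exact: leb_compact_fin.
  apply: le_lt_trans I; apply: ge0_subset_integral => //.
  - by apply/measurable_EFinP; exact: measurable_powR_comp.
  - by move=> x _; rewrite lee_fin powR_ge0.
have dom x : K x -> normc (f x) <= D x.
  move=> Kx; rewrite -[normc _](_ : modG H f x = _); first exact: le_1powR (modG_ge0 _ _ _).
  by rewrite modGE mem_set//; exact: KH.
case: cf => mr mi; split; apply: (le_integrable mK _ _ iD).
- by apply/measurable_EFinP; exact: (measurable_funS mH KH mr).
- move=> x Kx; rewrite /= lee_fin (ger0_norm (_ : 0 <= D x)); last first.
    by rewrite addr_ge0// powR_ge0.
  by apply: le_trans (dom _ Kx); have [] := normc_leD (f x).
- by apply/measurable_EFinP; exact: (measurable_funS mH KH mi).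
- move=> x Kx; rewrite /= lee_fin (ger0_norm (_ : 0 <= D x)); last first.
    by rewrite addr_ge0// powR_ge0.
  by apply: le_trans (dom _ Kx); have [] := normc_leD (f x).
Qed.

Lemma cmeasB f g : cmeas H f -> cmeas H g -> cmeas H (f - g).
Proof. by move=> mf mg; rewrite addrC -scaleN1r; exact: cmeas_lin. Qed.

Lemma Lq_ae_ext f g : cmeas H f -> sn_mem L g -> {ae mu, forall x, H x -> f x = g x} ->
  sn_mem L f /\ sn_eq (f : L) g.
Proof.
move=> mf mg fg; have mfg : cmeas H (f - g) by apply: cmeasB => //; case/Lq_memP: mg.
have fg0 : Lq_fin H q (f - g)%R = 0%E.
  apply/(Lq_null q1 mH mfg); apply: filterS fg => x fgx Hx.
  have -> : (f - g) x = f x - g x by [].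
  by rewrite (fgx Hx) subrr.
have Mfg : sn_mem L (f - g) by apply/Lq_memP; rewrite fg0.
split; first by rewrite -[f](subrK g); exact: (memD sL).
by rewrite /sn_eq /= fg0.
Qed.

Lemma sn_eq_ae f g : sn_mem L f -> sn_mem L g -> sn_eq (f : L) g ->
  {ae mu, forall x, H x -> f x = g x}.
Proof.
move=> mf mg fg; have Mfg : sn_mem L (f - g) by exact: (memB sL).
have cfg : cmeas H (f - g) by case/Lq_memP: Mfg.
have /(Lq_null q1 mH cfg) : Lq_fin H q (f - g)%R = 0%E.
  by rewrite -Lq_normE// fg.
by apply: filterS => x /[apply] /eqP; rewrite [X in X == _]/(f x - g x) subr_eq0 => /eqP.
Qed.

Lemma weak_deriv_sn_eq s f g g' : is_weak_deriv H s f g -> is_weak_deriv H s f g' ->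
  sn_mem L g' -> sn_mem L g /\ sn_eq (g : L) g'.
Proof.
move=> Wg Wg' mg'; apply: Lq_ae_ext => //; last exact: is_weak_deriv_unique Wg Wg'.
by case: Wg => _ lg _; exact: loc_integrable_cmeas.
Qed.

Lemma wderivP s f : (exists2 g, is_weak_deriv H s f g & sn_mem L g) ->
  is_weak_deriv H s f (wd s f) /\ sn_mem L (wd s f).
Proof.
move=> [g Wg mg]; have Ww : is_weak_deriv H s f (wd s f).
  exact: (xgetPex (P := [set g | is_weak_deriv H s f g]) _ (ex_intro _ g Wg)).
by split=> //; case: (weak_deriv_sn_eq Ww Wg mg).
Qed.

(** Being a weak derivative of [f] only depends on the class of [f] up to null functions, and
    equal sets of candidates give the same choice. Replacing functions by equivalent ones
    hence does not change the derivatives in the equations at all. *)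
Lemma wderiv_ext s f g : sn_mem L f -> sn_mem L g -> sn_eq (f : L) g -> wd s f = wd s g.
Proof.
have imp u v : sn_mem L u -> sn_mem L v -> sn_eq (u : L) v -> forall w,
    is_weak_deriv H s u w -> is_weak_deriv H s v w.
  move=> mu_ mv uv w Ww; have mvu : sn_mem L (v - u) by exact: (memB sL).
  have W0 : is_weak_deriv H s (v - u) 0.
    apply: is_weak_deriv_null; first by case/Lq_memP: mvu.
    apply: filterS (sn_eq_ae mu_ mv uv) => x E Hx.
    have -> : (v - u) x = v x - u x by [].
    by rewrite (E Hx) subrr.
  have := is_weak_derivL 1 W0 Ww; rewrite !scale1r add0r.
  by rewrite subrK.
move=> mf mg fg; rewrite /wderiv; congr xget; apply/seteqP; split=> w /=; apply: imp => //.
by apply: (sn_eq_sym sL).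
Qed.

(** The representative chosen by [wderiv] may differ from [f] even when nothing is derived. *)
Lemma wderiv_nil f : sn_mem L f -> sn_mem L (wd [::] f) /\ sn_eq (wd [::] f : L) f.
Proof.
move=> mf; have lf := Lq_loc_integrable mf.
have W0 : is_weak_deriv H [::] f f by split=> // phi _; rewrite expr0 mul1r.
have [Ww mw] := wderivP (ex_intro2 _ _ f W0 mf).
exact: weak_deriv_sn_eq Ww W0 mf.
Qed.

Lemma mem_W_wderiv m s f : sn_mem (W m) f -> (size s <= m)%N ->
  is_weak_deriv H s f (wd s f) /\ sn_mem L (wd s f).
Proof. by move=> [_ Wf] sm; apply: wderivP; exact: Wf. Qed.

Lemma mem_WL m f : sn_mem (W m) f -> sn_mem L f.
Proof. by case. Qed.

Lemma mem_WL_lin m (a : R[i]) f g : sn_mem (W m) f -> sn_mem (W m) g ->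
  sn_mem (W m) (a *: f + g) /\ forall s, (size s <= m)%N ->
    sn_eq (wd s (a *: f + g) : L) (a *: wd s f + wd s g).
Proof.
move=> mf mg; have key s : (size s <= m)%N ->
    is_weak_deriv H s (a *: f + g) (a *: wd s f + wd s g) /\
    sn_mem L (a *: wd s f + wd s g).
  move=> sm; have [[Wf mf'] [Wg mg']] := (mem_W_wderiv mf sm, mem_W_wderiv mg sm).
  by split; [exact: is_weak_derivL|exact: memL].
split; first split.
- by apply: (memL sL); [exact: mem_WL mf|exact: mem_WL mg].
- by move=> s /key[Ws ms]; exists (a *: wd s f + wd s g).
move=> s /key[Ws ms]; have [Ww mw] := wderivP (ex_intro2 _ _ _ Ws ms).
by have [] := weak_deriv_sn_eq Ww Ws ms.
Qed.

Lemma W_normE m f : sn_norm (W m) f =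
  \sum_(k < m.+1) \sum_(t : k.-tuple 'I_n.+1) sn_norm L (wd t f).
Proof. by []. Qed.

Lemma mem_W_term m f (k : nat) (t : k.-tuple 'I_n.+1) : sn_mem (W m) f -> (k < m.+1)%N ->
  sn_mem L (wd t f).
Proof.
rewrite ltnS => mf km; have tm : (size t <= m)%N by rewrite size_tuple.
exact: (mem_W_wderiv mf tm).2.
Qed.

Lemma W_term_ge0 m f (k : nat) (t : k.-tuple 'I_n.+1) : sn_mem (W m) f -> (k < m.+1)%N ->
  0 <= sn_norm L (wd t f).
Proof. by move=> mf km; exact: (norm_ge0 sL (mem_W_term t mf km)). Qed.

Lemma wderiv0 s : sn_mem L (wd s 0) /\ sn_eq (wd s 0 : L) 0.
Proof.
have W0 : is_weak_deriv H s (0 : Rn -> R[i]) 0.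
  by apply: is_weak_deriv_null; [exact: cmeas0|exact: aeW].
have [Ww mw] := wderivP (ex_intro2 _ _ _ W0 (mem0 sL)).
exact: weak_deriv_sn_eq Ww W0 (mem0 sL).
Qed.

Lemma seminormed_Wmq m : seminormed (W m).
Proof.
have m0 : sn_mem (W m) 0.
  have mL0 := mem0 sL; split=> // s _; exists 0 => //.
  apply: is_weak_deriv_null; first exact: cmeas0.
  exact: aeW.
have tm (k : 'I_m.+1) (t : k.-tuple 'I_n.+1) : (size t <= m)%N.
  by rewrite size_tuple -ltnS.
have Lt f (k : 'I_m.+1) (t : k.-tuple 'I_n.+1) : sn_mem (W m) f -> sn_mem L (wd t f).
  by move=> mf; exact: (mem_W_term t mf (ltn_ord k)).
split.
- exact: m0.
- by move=> a f g mf mg; exact: (mem_WL_lin a mf mg).1.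
- move=> f mf; rewrite W_normE; apply: sumr_ge0 => k _; apply: sumr_ge0 => t _.
  exact: (W_term_ge0 t mf (ltn_ord k)).
- move=> f g mf mg; rewrite !W_normE -big_split; apply: ler_sum => k _.
  rewrite -big_split; apply: ler_sum => t _; have [mL E] := mem_WL_lin 1 mf mg.
  have := E t (tm k t); rewrite !scale1r in mL * => Et.
  have [[a1 a2] a3] := ((Lt _ k t mf, Lt _ k t mg), Lt _ k t mL).
  apply: le_trans (normD sL a1 a2).
  exact: (le_norm_eq sL a3 (memD sL a1 a2) Et).
move=> a f mf; rewrite !W_normE mulr_sumr; apply: eq_bigr => k _.
rewrite mulr_sumr; apply: eq_bigr => t _; have [mL E] := mem_WL_lin a mf m0.
have := E t (tm k t); rewrite addr0 in mL * => Et.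
have [mf' [mz z0]] := (Lt _ k t mf, wderiv0 t).
have maf : sn_mem L (a *: wd t f) by exact: (memZ sL).
rewrite -(normZ sL a mf') (norm_eq sL (Lt _ k t mL) (memD sL maf mz) Et).
apply: (norm_eq sL (memD sL maf mz) maf).
have -> : a *: wd t f = a *: wd t f + 0 by rewrite addr0.
apply: (sn_eqD sL _ _ mz (mem0 sL) _ z0); rewrite ?addr0; [exact: maf|exact: maf|].
exact: (sn_eq_refl sL).
Qed.

Let sW m : seminormed (W m) := seminormed_Wmq m.

Lemma W_ext m f g : sn_mem (W m) f -> sn_mem (W m) g -> sn_eq (f : W m) g ->
  sn_eq (f : L) g.
Proof.
move=> mf mg fg; have mfg : sn_mem (W m) (f - g) by exact: (memB (sW m)).
have mL := mem_WL mfg; have [m1 E1] := wderiv_nil mL.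
rewrite /sn_eq -(norm_eq sL m1 mL E1).
have := fg; rewrite /sn_eq W_normE => /eqP; rewrite psumr_eq0; last first.
  by move=> k _; apply: sumr_ge0 => t _; exact: (W_term_ge0 t mfg (ltn_ord k)).
move=> /allP/(_ ord0); rewrite mem_index_enum => /(_ isT)/=.
rewrite psumr_eq0; last first.
  by move=> t _; exact: (W_term_ge0 t mfg).
by move=> /allP/(_ [tuple]); rewrite mem_index_enum => /(_ isT)/eqP.
Qed.

Lemma bl_wderiv m s : (size s <= m)%N ->
  bounded_linear (fun f : W m => wd s f : L).
Proof.
move=> sm; split=> [f mf|a f g mf mg|]; first by case: (mem_W_wderiv mf sm).
  by have [_ +] := mem_WL_lin a mf mg; apply.
exists 1 => f mf; rewrite mul1r W_normE.
have ge0 (k : 'I_m.+1) : 0 <= \sum_(t : k.-tuple 'I_n.+1) sn_norm L (wd t f).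
  by apply: sumr_ge0 => t _; exact: (W_term_ge0 t mf (ltn_ord k)).
have sm1 : (size s < m.+1)%N by rewrite ltnS.
rewrite (bigD1 (Ordinal sm1))//= -[leLHS]addr0; apply: lerD; last first.
  by apply: sumr_ge0 => k _; exact: ge0.
rewrite (bigD1 (in_tuple s))//= lerDl; apply: sumr_ge0 => t _.
exact: (W_term_ge0 t mf sm1).
Qed.

Lemma bl_WW m m' : (m' <= m)%N -> bounded_linear (fun f : W m => f : W m').
Proof.
move=> mm; have sub f : sn_mem (W m) f -> sn_mem (W m') f.
  by move=> [mf Wf]; split=> // s sm; exact: (Wf s (leq_trans sm mm)).
split=> // [a f g mf mg|].
  exact: (sn_eq_refl (sW m')).
exists 1 => f mf; rewrite mul1r !W_normE.
pose F k := \sum_(t : k.-tuple 'I_n.+1) sn_norm L (wd t f).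
rewrite -(big_mkord xpredT F) -[leRHS](big_mkord xpredT F).
rewrite (@big_cat_nat _ _ _ m'.+1 0 m.+1)//= lerDl big_nat; apply: sumr_ge0 => k /andP[_ km].
by apply: sumr_ge0 => t _; exact: (W_term_ge0 t mf km).
Qed.

Lemma bl_WL m : bounded_linear (fun f : W m => f : L).
Proof.
split=> [f|a f g mf mg|]; first exact: mem_WL.
  exact: (sn_eq_refl sL).
have [M M0 HM] := bl_bound (sW m) (@bl_wderiv m [::] isT).
exists M => f mf; have [m1 E1] := wderiv_nil (mem_WL mf).
rewrite -(norm_eq sL m1 (mem_WL mf) E1); exact: HM.
Qed.

Lemma W1_norm f : sn_mem (W 1) f ->
  sn_norm (W 1) f = sn_norm L f + \sum_i sn_norm L (wd [:: i] f).
Proof.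
move=> mf; have [m1 E1] := wderiv_nil (mem_WL mf).
rewrite W_normE big_ord_recr big_ord1 /=; congr (_ + _).
  rewrite (big_pred1 [tuple]); last by move=> t; rewrite [t]tuple0; exact/esym/eqxx.
  exact: (norm_eq sL m1 (mem_WL mf) E1).
rewrite (reindex (fun i : 'I_n.+1 => [tuple i])) //=.
exists (fun t : 1.-tuple _ => thead t) => t _ //.
by apply/val_inj; case: t => -[|x []].
Qed.

End sobolev.

(** * Products of seminormed spaces *)

Section products.
Variables (R : realType) (X Y Z : snSpace R).
Hypotheses (sX : seminormed X) (sY : seminormed Y) (sZ : seminormed Z).

Lemma seminormed_prod : seminormed (Y \xs Z).
Proof.
split.
- by split; exact: mem0.
- by move=> a f g [f1 f2] [g1 g2]; split; exact: memL.
- by move=> f [f1 f2]; rewrite addr_ge0// norm_ge0.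
- move=> f g [f1 f2] [g1 g2]; rewrite /= addrACA.
  by apply: lerD; exact: normD.
- by move=> a f [f1 f2]; rewrite /= mulrDr !normZ.
Qed.

Lemma sn_eq_prod (f g : Y \xs Z) : sn_mem (Y \xs Z) f -> sn_mem (Y \xs Z) g ->
  sn_eq f g <-> sn_eq f.1 g.1 /\ sn_eq f.2 g.2.
Proof.
move=> [f1 f2] [g1 g2]; rewrite /sn_eq /=; split=> [/eqP|[-> ->]]; last by rewrite addr0.
rewrite paddr_eq0; first by move=> /andP[/eqP-> /eqP->].
- by apply: norm_ge0 => //; exact: (memB sY).
- by apply: norm_ge0 => //; exact: (memB sZ).
Qed.

Lemma bl_pair (S : X -> Y) (T : X -> Z) : bounded_linear S -> bounded_linear T ->
  bounded_linear (fun f => (S f, T f) : Y \xs Z).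
Proof.
move=> bS bT; split=> [f mf|a f g mf mg|].
- by split; [exact: bl_mem|exact: bl_mem].
- have mL : sn_mem X (a *: f + g) by exact: (memL sX).
  by rewrite /sn_eq /= !bl_lin// addr0.
- have [M _ HM] := bl_bound sX bS; have [M' _ HM'] := bl_bound sX bT.
  by exists (M + M') => f mf; rewrite /= mulrDl lerD ?HM ?HM'.
Qed.

Lemma bl_fst : bounded_linear (fun f : Y \xs Z => f.1).
Proof.
split=> [f []//|a f g [f1 f2] [g1 g2]|].
  exact: (sn_eq_refl sY).
by exists 1 => f [f1 f2]; rewrite mul1r /= lerDl norm_ge0.
Qed.

Lemma bl_snd : bounded_linear (fun f : Y \xs Z => f.2).
Proof.
split=> [f []//|a f g [f1 f2] [g1 g2]|].
  exact: (sn_eq_refl sZ).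
by exists 1 => f [f1 f2]; rewrite mul1r /= lerDr norm_ge0.
Qed.

Lemma bl_0 : bounded_linear (fun _ : X => 0 : Y).
Proof.
split=> [f mf|a f g mf mg|]; first exact: mem0.
  by rewrite scaler0 addr0; exact: sn_eq_refl.
by exists 0 => f mf; rewrite norm0// mul0r.
Qed.

Lemma bl_id : bounded_linear (fun f : X => f).
Proof.
split=> [//|a f g mf mg|]; first exact: (sn_eq_refl sX).
by exists 1 => f mf; rewrite mul1r.
Qed.

Lemma summable_prod (V : set Y) (V' : set Z) : V `<=` sn_mem Y -> V' `<=` sn_mem Z ->
  summable_in V -> summable_in V' ->
  summable_in (X := Y \xs Z) [set f | V f.1 /\ V' f.2].
Proof.
move=> VY VZ HV HV' x C Vx nx.
have [s ms [K Hs]] : exists2 s, sn_mem Y s & exists K, forall n,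
    sn_norm Y (s - \sum_(k < n) (x k).1) <= K / 2 ^+ n.
  apply: (HV (fun k => (x k).1) C) => k; first by case: (Vx k).
  apply: le_trans (nx k); rewrite /= lerDl norm_ge0//; apply: VZ; by case: (Vx k).
have [s' ms' [K' Hs']] : exists2 s, sn_mem Z s & exists K, forall n,
    sn_norm Z (s - \sum_(k < n) (x k).2) <= K / 2 ^+ n.
  apply: (HV' (fun k => (x k).2) C) => k; first by case: (Vx k).
  apply: le_trans (nx k); rewrite /= lerDr norm_ge0//; apply: VY; by case: (Vx k).
exists (s, s') => //; exists (K + K') => n; rewrite mulrDl.
have -> : \sum_(k < n) x k = (\sum_(k < n) (x k).1, \sum_(k < n) (x k).2).
  by elim/big_ind3: _ => // [? ? ? ? ? ? -> ->|i _]//; case: (x i).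
exact: lerD (Hs n) (Hs' n).
Qed.

(** For components that vanish identically. *)
Lemma summable_0 : summable_in (X := Y) [set 0].
Proof.
move=> x C x0 nx; exists 0; first exact: mem0.
exists 0 => n; rewrite big1 => [|k _]; last exact: x0.
by rewrite subrr norm0// mul0r.
Qed.

End products.

Section powers.
Variables (R : realType) (X Y : snSpace R) (I : finType).
Hypotheses (sX : seminormed X) (sY : seminormed Y).

Lemma seminormed_pow : seminormed (sn_pow I Y).
Proof.
split.
- by move=> i; exact: mem0.
- by move=> a f g mf mg i; exact: memL.
- by move=> f mf; apply: sumr_ge0 => i _; exact: norm_ge0.
- by move=> f g mf mg; rewrite /= -big_split; apply: ler_sum => i _; exact: normD.
- by move=> a f mf; rewrite /= mulr_sumr; apply: eq_bigr => i _; exact: normZ.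
Qed.

Lemma bl_fun (S : I -> X -> Y) : (forall i, bounded_linear (S i)) ->
  bounded_linear (fun f => (fun i => S i f) : sn_pow I Y).
Proof.
move=> bS; split=> [f mf i|a f g mf mg|]; first exact: bl_mem.
  by rewrite /sn_eq /= big1// => i _; exact: bl_lin.
have /choice[M HM] : forall i, exists M : R, forall f, sn_mem X f ->
    sn_norm Y (S i f) <= M * sn_norm X f by move=> i; case: (bS i).
by exists (\sum_i M i) => f mf; rewrite mulr_suml; apply: ler_sum => i _; exact: HM.
Qed.

Lemma summable_pow (V : set Y) : V `<=` sn_mem Y -> summable_in V ->
  summable_in (X := sn_pow I Y) [set f | forall i, V (f i)].
Proof.
move=> VY HV x C Vx nx.
have ex i : exists s : Y, sn_mem Y s /\ exists K, forall n,
    sn_norm Y (s - \sum_(k < n) x k i) <= K / 2 ^+ n.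
  have [|k|s ms Hs] := HV (fun k => x k i) C; last by exists s.
    by move=> k; exact: Vx.
  apply: le_trans (nx k); rewrite /= (bigD1 i)//= lerDl.
  by apply: sumr_ge0 => j _; apply: norm_ge0 => //; apply: VY; exact: Vx.
have [s Hs] := choice ex.
have [K HK] := choice (fun i => (Hs i).2).
exists (s : sn_pow I Y); first by move=> i; case: (Hs i).
exists (\sum_i K i) => n; rewrite mulr_suml; apply: ler_sum => i _.
have -> : (s - \sum_(k < n) x k : sn_pow I Y) i = s i - \sum_(k < n) x k i.
  by rewrite [LHS]/(s i - _); congr (_ - _); rewrite fct_sumE.
exact: HK.
Qed.

Lemma bl_proj i : bounded_linear (fun f : sn_pow I Y => f i).
Proof.
split=> [f //|a f g mf mg|]; first exact: (sn_eq_refl sY).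
exists 1 => f mf; rewrite mul1r /= (bigD1 i)//= lerDl.
by apply: sumr_ge0 => j _; exact: norm_ge0.
Qed.

End powers.

(** * Sectors and square roots *)

Section sectors.
Variable R : realType.
Implicit Types (l h z : R[i]).

Lemma abs_carg z : z != 0 -> `|carg z| = acos (complex.Re z / normc z) /\
  -1 <= complex.Re z / normc z <= 1.
Proof.
rewrite -normc_gt0 => z0.
have H : -1 <= complex.Re z / normc z <= 1.
  by rewrite -ler_norml normrM normfV (gtr0_norm z0) ler_pdivrMr// mul1r;
    have [] := normc_leD z.
split=> //; rewrite /carg; have a0 := acos_ge0 H.
by case: ifP => _; rewrite ?normrN ger0_norm.
Qed.

(** The cosine decreases on [[0, pi]]: this turns the bound on the argument, a discontinuous
    function, into a strict inequality between continuous ones. *)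
Lemma sectorE (sigma delta : R) l : 0 <= delta -> 0 < sigma < pi ->
  sector sigma delta l <-> cos (pi - sigma) * normc l < complex.Re l /\ delta < normc l.
Proof.
move=> d0 /andP[s0 spi].
have spi' : pi - sigma \in `[0, pi]%R by rewrite in_itv/=; apply/andP; split; lra.
suff H : delta < normc l -> (`|carg l| < pi - sigma) = (cos (pi - sigma) * normc l < complex.Re l).
  by split=> -[H1 H2]; split=> //; move: H1; rewrite H.
move=> dl; have l0 : 0 < normc l by exact: le_lt_trans dl.
have lne : l != 0 by rewrite -normc_gt0.
have [-> H] := abs_carg lne.
have aI : acos (complex.Re l / normc l) \in `[0, pi]%R.
  by rewrite in_itv/= acos_ge0//= acos_lepi.
have -> : (acos (complex.Re l / normc l) < pi - sigma) =
    (cos (pi - sigma) < cos (acos (complex.Re l / normc l))).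
  exact/esym/ltr_cos.
by rewrite acosK ?in_itv//= ltr_pdivlMr.
Qed.

Lemma normcB_ge z h : normc z - normc h <= normc (z + h).
Proof.
rewrite lerBlDr; have := le_normcD (z + h) (- h).
by rewrite addrK normcN.
Qed.

Lemma sector_open (sigma delta : R) : 0 <= delta -> 0 < sigma < pi ->
  openC (sector sigma delta).
Proof.
move=> d0 spi l; rewrite sectorE// => -[H1 H2].
set c := cos _ in H1; have c1 : 0 < 1 + `|c| by rewrite ltr_wpDr.
pose s := complex.Re l - c * normc l.
have s0 : 0 < s by rewrite subr_gt0.
exists (Num.min (s / (1 + `|c|)) (normc l - delta)).
  by rewrite lt_min divr_gt0//= subr_gt0.
move=> h; rewrite lt_min ltr_pdivlMr// => /andP[hs hd]; rewrite sectorE//; split; last first.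
  by apply: lt_le_trans (normcB_ge l h); move: hd; lra.
rewrite -/c raddfD /=; have [Rh _] := normc_leD h.
have R1 : - normc h <= complex.Re h by move: Rh; rewrite ler_norml => /andP[].
have C1 : c * normc (l + h) <= c * normc l + `|c| * normc h.
  rewrite -lerBlDl -mulrBr (le_trans (ler_norm _))// normrM ler_wpM2l//.
  rewrite ler_norml; apply/andP; split.
    by have := normcB_ge l h; lra.
  by have := le_normcD l h; lra.
by move: hs s0 R1 C1; rewrite /s mulrDr mulr1 (mulrC (normc h)); lra.
Qed.

Lemma sub_sector (sigma delta delta' : R) : delta <= delta' ->
  sector sigma delta' `<=` sector sigma delta.
Proof. by move=> dd l [H1 H2]; split=> //; exact: le_lt_trans H2. Qed.

Lemma sqr_normc_sqrtc l : normc (sqrtc l) ^+ 2 = normc l.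
Proof. by rewrite expr2 -normcM -expr2 sqr_sqrtc. Qed.

Lemma Re_sqrtc_ge0 l : 0 <= complex.Re (sqrtc l).
Proof. by case: l => a b; rewrite /sqrtc /=; exact: sqrtr_ge0. Qed.

(** The sector avoids the cut [l <= 0] of the principal branch. *)
Lemma Re_sqrtc_gt0 (sigma delta : R) l : 0 <= delta -> 0 < sigma < pi ->
  sector sigma delta l -> 0 < complex.Re (sqrtc l).
Proof.
move=> d0 spi; rewrite sectorE// => -[H1 H2].
have l0 : 0 < normc l by exact: le_lt_trans H2.
have c1 : -1 < cos (pi - sigma).
  have /andP[s0 sp] := spi.
  have i1 : pi - sigma \in `[0, pi]%R by rewrite in_itv/=; apply/andP; split; lra.
  have i2 : pi \in `[0, pi : R]%R by rewrite in_itv/= pi_ge0 lexx.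
  by rewrite -cospi ltr_cos//; lra.
have : 0 < normc l + complex.Re l.
  have : -1 * normc l < cos (pi - sigma) * normc l by rewrite ltr_pM2r.
  by move: H1; lra.
case: l {H1 H2 l0} => a b /= H; rewrite /sqrtc /= sqrtr_gt0.
by rewrite divr_gt0.
Qed.

Lemma normc_le_Re z (r : R) : r <= complex.Re z -> r <= normc z.
Proof.
by move=> /le_trans; apply; apply: le_trans (ler_norm _) _; have [] := normc_leD z.
Qed.

Lemma normc_2 : normc (2 : R[i]) = 2.
Proof. by rewrite -[2 in LHS]/(2%:R) -(rmorph_nat (real_complex R)) normc_real normr_nat. Qed.

(** With [s = sqrt l] and [S = sqrt (l + h)] the remainder is [- h^2 / (2 s (S + s)^2)]; the
    denominator is bounded below since real parts of roots are positive and add up. *)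
Lemma cderiv_sqrtc (sigma delta : R) : 0 <= delta -> 0 < sigma < pi ->
  cderiv_on (sector sigma delta) (@sqrtc R) (fun l => (2 * sqrtc l)^-1).
Proof.
move=> d0 spi l Ul e e0; set s := sqrtc l; set r := complex.Re s.
have r0 : 0 < r by exact: Re_sqrtc_gt0 Ul.
exists (e * (2 * r ^+ 3)) => [|h /andP[h0 he]].
  by rewrite mulr_gt0// mulr_gt0// exprn_gt0.
set S := sqrtc (l + h).
have Ss : r <= normc (S + s).
  by apply: normc_le_Re; rewrite raddfD /= lerDr Re_sqrtc_ge0.
have s1 : r <= normc s by exact: normc_le_Re.
have Ssn : S + s != 0 by rewrite -normc_gt0 (lt_le_trans r0).
have sn : s != 0 by rewrite -normc_gt0 (lt_le_trans r0).
have hE : h = (S - s) * (S + s) by rewrite -subr_sqr !sqr_sqrtc addrC addKr.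
have n2 := normc_2.
have two0 : (2 : R[i]) != 0 by rewrite pnatr_eq0.
have -> : S - s - h * (2 * s)^-1 = - (h * h) / (2 * s * (S + s) ^+ 2).
  by rewrite {1 2 3}hE; field; rewrite sn Ssn.
have D0 : 0 < normc (2 * s * (S + s) ^+ 2).
  by rewrite normc_gt0 !mulf_neq0 ?expf_neq0.
rewrite normcM normcV normcN normcM ler_pdivrMr//.
rewrite (mulrC e) -[leRHS]mulrA ler_pM2l//.
apply: le_trans (ltW he) _; rewrite ler_pM2l//.
rewrite expr2 !normcM n2 -[leRHS]mulrA ler_pM2l// exprS expr2.
have r0' := ltW r0; apply: ler_pM => //; first exact: mulr_ge0.
exact: ler_pM.
Qed.

Lemma cderiv_id (U : set R[i]) : cderiv_on U id (fun=> 1).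
Proof.
move=> l Ul e e0; exists 1 => // h /andP[h0 _].
have -> : id (l + h) - id l - h * 1 = 0 by rewrite /=; ring.
by rewrite normc0 mulr_ge0// ltW.
Qed.

Lemma cderiv_inv (U : set R[i]) (s s' : R[i] -> R[i]) : cderiv_on U s s' ->
  (forall l, U l -> s l != 0) ->
  cderiv_on U (fun l => (s l)^-1) (fun l => - s' l / s l ^+ 2).
Proof.
move=> ds s0 l Ul e e0; have sl := s0 _ Ul; have ns : 0 < normc (s l) by rewrite normc_gt0.
have ns' := normc_ge0 (s' l); set k := normc (s' l) + 1.
have k0 : 0 < k by rewrite ltr_wpDl.
pose e1 := e * normc (s l) ^+ 2 / 4.
have e10 : 0 < e1 by rewrite divr_gt0// mulr_gt0// exprn_gt0.
have [r1 r10 H1] := ds _ Ul 1 ltr01; have [r2 r20 H2] := ds _ Ul _ e10.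
pose r3 := normc (s l) / (2 * k).
have r30 : 0 < r3 by rewrite divr_gt0// mulr_gt0.
pose r4 := e * normc (s l) ^+ 3 / (4 * k ^+ 2).
have r40 : 0 < r4 by rewrite divr_gt0// mulr_gt0// exprn_gt0.
exists (Num.min (Num.min r1 r2) (Num.min r3 r4)) => [|h].
  by rewrite !lt_min r10 r20 r30.
rewrite !lt_min => /andP[h0 /andP[/andP[hr1 hr2] /andP[hr3 hr4]]].
have {}H1 : normc (s (l + h) - s l - h * s' l) <= normc h.
  by have := H1 h; rewrite h0 hr1 mul1r; apply.
have {}H2 : normc (s (l + h) - s l - h * s' l) <= e1 * normc h.
  by apply: H2; rewrite h0.
set S := s (l + h) in H1 H2 *.
have lip : normc (S - s l) <= k * normc h.
  have -> : S - s l = (S - s l - h * s' l) + h * s' l by rewrite subrK.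
  apply: le_trans (le_normcD _ _) _; rewrite normcM /k mulrDl mul1r addrC.
  by rewrite (mulrC (normc h)); apply: lerD.
have half : normc (s l) / 2 <= normc S.
  have : normc (s l) - normc (S - s l) <= normc S.
    have := normcB_ge (s l) (S - s l).
    by have -> : s l + (S - s l) = S by ring.
  have : k * normc h <= normc (s l) / 2.
    rewrite -ler_pdivlMl// (le_trans (ltW hr3))// /r3.
    by apply: le_of_eq; field; rewrite gt_eqF.
  by move: lip; lra.
have S0 : S != 0 by rewrite -normc_gt0 (lt_le_trans _ half)// divr_gt0.
have -> : S^-1 - (s l)^-1 - h * (- s' l / s l ^+ 2) =
  (- s l * (S - s l - h * s' l) + h * s' l * (S - s l)) / (S * s l ^+ 2).
  by field; rewrite S0 sl.
have D0 : 0 < normc (S * s l ^+ 2) by rewrite normc_gt0 mulf_neq0 ?expf_neq0.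
rewrite normcM normcV ler_pdivrMr//.
have D1 : normc (s l) ^+ 3 / 2 <= normc (S * s l ^+ 2).
  rewrite [normc (S * _)]normcM expr2 normcM.
  have -> : normc (s l) ^+ 3 / 2 = normc (s l) / 2 * (normc (s l) * normc (s l)) by ring.
  by rewrite ler_pM2r// mulr_gt0.
apply: (@le_trans _ _ (e * normc h * (normc (s l) ^+ 3 / 2))); last first.
  by rewrite ler_pM2l// mulr_gt0.
apply: le_trans (le_normcD _ _) _; rewrite !normcM normcN.
have B1 : normc (s l) * normc (S - s l - h * s' l) <= e * normc h * (normc (s l) ^+ 3 / 4).
  apply: (@le_trans _ _ (normc (s l) * (e1 * normc h))); first by rewrite ler_pM2l.
  by apply: le_of_eq; rewrite /e1; field.
have B2 : normc h * normc (s' l) * normc (S - s l) <= e * normc h * (normc (s l) ^+ 3 / 4).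
  apply: (@le_trans _ _ (normc h * k * (k * r4))).
    apply: ler_pM => //; [by rewrite mulr_ge0// ltW|exact: normc_ge0| |].
      by rewrite ler_pM2l// lerDl.
    by apply: le_trans lip _; rewrite ler_pM2l// ltW.
  by apply: le_of_eq; rewrite /r4; field; rewrite gt_eqF.
by apply: le_trans (lerD B1 B2) _; apply: le_of_eq; field.
Qed.

End sectors.

Lemma sigma_w_ge0 (R : realType) (mu nu kappa : R) : 0 <= sigma_w mu nu kappa.
Proof.
rewrite /sigma_w; case: ifPn => // e; set z := (_ +i* _).
have z0 : z != 0.
  rewrite eq_complex /= negb_and sqrtr_eq0 -ltNge normr_gt0.
  by apply/orP; right; apply: contraNneq e => ->.
have [_ zI] := abs_carg z0; rewrite /carg ifT; first exact: acos_ge0.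
exact: sqrtr_ge0.
Qed.

(** * Scaled operator families *)

Section scaled.
Variables (R : realType) (X Y Z : snSpace R).
Hypotheses (sX : seminormed X) (sY : seminormed Y) (sZ : seminormed Z).
Variable U : set R[i].
Hypothesis oU : openC U.

Lemma deriv_on_bl (T : Y -> Z) (S S' : R[i] -> X -> Y) : bounded_linear T ->
  deriv_on U S S' -> deriv_on U (fun l f => T (S l f)) (fun l f => T (S' l f)).
Proof.
move=> bT HS; have [mS mS'] := deriv_on_maps HS.
have H := deriv_on_comp sX sY sZ oU (deriv_on_cst sY sZ (U := U) bT) HS.
apply: deriv_on_ext H => // l f Ul mf.
have m1 := bl_mem bT (mS _ _ Ul mf); have m2 := bl_mem bT (mS' _ _ Ul mf).
by split=> //; rewrite ?add0r; exact: (sn_eq_refl sZ).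
Qed.

Lemma deriv_on_scaled (s s' : R[i] -> R[i]) (T : Y -> Z) (S S' : R[i] -> X -> Y) :
  cderiv_on U s s' -> bounded_linear T -> deriv_on U S S' ->
  deriv_on U (fun l f => s l *: T (S l f))
    (fun l f => s' l *: T (S l f) + s l *: T (S' l f)).
Proof.
move=> ds bT HS.
exact: (deriv_on_comp sX sZ sZ oU (deriv_on_scal sZ ds) (deriv_on_bl bT HS)).
Qed.

Variables (p : R) (p1 : 1 <= p).

Lemma Rbd_scaled (s : R[i] -> R[i]) (T : Y -> Z) (S : R[i] -> X -> Y) (a k c : R) :
  bounded_linear T -> 0 <= k -> (forall f, sn_mem Y f -> sn_norm Z (T f) <= k * sn_norm Y f) ->
  0 < a -> (forall l, U l -> normc (s l) <= a) ->
  maps_on U S -> Rbd p U S c ->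
  Rbd p U (fun l f => s l *: T (S l f)) (2 * a * (k * c)).
Proof.
move=> bT k0 Tk a0 sa mS bS; apply: (Rbd_scal p1 sZ) => //.
  by move=> l f Ul mf; apply: (bl_mem bT); exact: mS.
exact: (Rbd_comp k0 mS (Rbd_cst p1 sY sZ (U := U) bT k0 Tk) bS).
Qed.

(** Here [l s'(l)] is of the order of [s(l)], as for powers of [l]. *)
Lemma Rbd_scaled_deriv (s s' : R[i] -> R[i]) (T : Y -> Z) (S S' : R[i] -> X -> Y)
    (a k c : R) :
  bounded_linear T -> 0 <= k -> (forall f, sn_mem Y f -> sn_norm Z (T f) <= k * sn_norm Y f) ->
  0 < a -> (forall l, U l -> normc (s l) <= a) -> (forall l, U l -> normc (l * s' l) <= a) ->
  deriv_on U S S' -> Rbd p U S c -> Rbd p U (fun l f => l *: S' l f) c ->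
  Rbd p U (fun l f => l *: (s' l *: T (S l f) + s l *: T (S' l f)))
    (2 * a * (k * c) + 2 * a * (k * c)).
Proof.
move=> bT k0 Tk a0 sa sa' HS bS bS'; have [mS mS'] := deriv_on_maps HS.
have mlS' : maps_on U (fun l f => l *: S' l f).
  by move=> l f Ul mf; apply: (memZ sY); exact: mS'.
have mTS : maps_on U (fun l f => T (S l f)).
  by move=> l f Ul mf; apply: (bl_mem bT); exact: mS.
have mTS' : maps_on U (fun l f => T (S' l f)).
  by move=> l f Ul mf; apply: (bl_mem bT); exact: mS'.
have mTlS' : maps_on U (fun l f => T (l *: S' l f)).
  by move=> l f Ul mf; apply: (bl_mem bT); exact: mlS'.
have b1 := Rbd_scaled bT k0 Tk a0 sa' mS bS.
have b2 := Rbd_scaled bT k0 Tk a0 sa mlS' bS'.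
have m1 : maps_on U (fun l f => (l * s' l) *: T (S l f)).
  by move=> l f Ul mf; apply: (memZ sZ); exact: mTS.
have m2 : maps_on U (fun l f => s l *: T (l *: S' l f)).
  by move=> l f Ul mf; apply: (memZ sZ); exact: mTlS'.
have m3 : maps_on U (fun l f => l *: (s' l *: T (S l f) + s l *: T (S' l f))).
  by move=> l f Ul mf; have := mTS l f Ul mf; have := mTS' l f Ul mf => *; memt.
have m12 : maps_on U (fun l f => (l * s' l) *: T (S l f) + s l *: T (l *: S' l f)).
  by move=> l f Ul mf; apply: (memD sZ); [exact: m1|exact: m2].
apply: (Rbd_ext sZ m12 m3 _ (Rbd_add p1 sZ m1 m2 b1 b2)) => l f Ul mf.
have t1 := mTS l f Ul mf; have t2 := mTS' l f Ul mf; have t3 := mTlS' l f Ul mf.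
have -> : l *: (s' l *: T (S l f) + s l *: T (S' l f)) =
    (l * s' l) *: T (S l f) + s l *: (l *: T (S' l f)) by lmodR.
apply: (sn_eqD sZ); [by memt|by memt|by memt|by memt|exact: (sn_eq_refl sZ)|].
have t4 : sn_mem Z (l *: T (S' l f)) by memt.
exact: (sn_eqZ sZ (s l) t3 t4 (bl_Z sY sZ l bT (mS' l f Ul mf))).
Qed.

End scaled.

(** * The lower-order terms as a perturbation *)

Section sn_eq_components.
Variables (R : realType) (X Y : snSpace R) (I : finType).

Lemma sn_eq_pair (f f' : X) (g g' : Y) : sn_eq f f' -> sn_eq g g' ->
  sn_eq ((f, g) : X \xs Y) (f', g').
Proof. by rewrite /sn_eq /= => -> ->; rewrite addr0. Qed.

Lemma sn_eq_fun (f g : sn_pow I X) : (forall i, sn_eq (f i) (g i)) -> sn_eq f g.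
Proof. by move=> fg; rewrite /sn_eq /= big1// => i _; exact: fg. Qed.

End sn_eq_components.

Section sqrt_families.
Variables (R : realType) (X Y Z : snSpace R).
Hypotheses (sX : seminormed X) (sY : seminormed Y) (sZ : seminormed Z).
Variables (U : set R[i]) (s' : R[i] -> R[i]).
Hypotheses (oU : openC U) (ds : cderiv_on U (@sqrtc R) s').

(** The operators [Sl] and [Tl] depend on [l] through such combinations. *)
Lemma Hol_sqrt_family (C1 C2 C3 : Y -> Z) (D : R[i] -> Y -> Z) (A : R[i] -> X -> Y) :
  bounded_linear C1 -> bounded_linear C2 -> bounded_linear C3 ->
  (forall l y, D l y = C1 y + (sqrtc l *: C2 y + l *: C3 y)) ->
  Hol U A -> Hol U (fun l f => D l (A l f)).
Proof.
move=> b1 b2 b3 DE /Hol_deriv_on HA.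
have -> : (fun l f => D l (A l f)) =
    (fun l f => C1 (A l f) + (sqrtc l *: C2 (A l f) + l *: C3 (A l f))).
  by apply/funext => l; apply/funext => f; exact: DE.
apply: deriv_on_Hol (deriv_on_add sX sZ oU (deriv_on_bl sX sY sZ oU b1 HA)
  (deriv_on_add sX sZ oU (deriv_on_scaled sX sY sZ oU ds b2 HA)
    (deriv_on_scaled sX sY sZ oU (@cderiv_id R U) b3 HA))).
Qed.

End sqrt_families.

Section model.
Variables (R : realType) (n : nat) (q gamma : R).
Hypothesis q1 : 1 <= q.
Local Notation "'Rn'" := 'rV[R]_n.+1.
Local Notation H := (@half_space R n).
Local Notation mH := (@measurable_half_space R n).
Local Notation L := (Lq H q).
Local Notation W m := (Wmq H m q).
Local Notation wd s f := (wderiv H s f).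
Local Notation X := (fXq H q).
Local Notation vI := 'I_n.+1.
Local Notation mI := ('I_n.+1 * 'I_n.+1)%type.
Local Notation tI := ('I_n.+1 * 'I_n.+1 * 'I_n.+1)%type.
Local Notation no := (@normal R n).
Local Notation g_ := (gamma%:C : R[i]).

Let sL : seminormed L := seminormed_Lq q1 mH.
Let sW m : seminormed (W m) := seminormed_Wmq n q1 m.
Let sP (I : finType) : seminormed (sn_pow I L) := seminormed_pow I sL.

Lemma seminormed_fXq : seminormed X.
Proof. have sv := sP vI; have sM := sP mI.
exact: (seminormed_prod (seminormed_prod (seminormed_prod (seminormed_prod
  (seminormed_prod (seminormed_prod (sW 1) sv) sM) sv) sM) sv) sL). Qed.

Lemma seminormed_fAq : seminormed (fAq H q).
Proof.
exact: (seminormed_prod (seminormed_prod (sP tI)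
  (sP mI)) (sW 1)).
Qed.

Lemma seminormed_fBq : seminormed (fBq H q).
Proof.
exact: (seminormed_prod (seminormed_prod (sP tI)
  (sP mI)) (sP vI)).
Qed.

(** [Fl] applied to the lower-order terms [(0, gamma grad rho, - gamma n rho, 0)] is the sum of
    this part, which contains first derivatives of [rho], and of [sqrt l] times the next one,
    which does not differentiate [rho]. *)
Definition lot_grad (rho : W 1) : X :=
  (0, fun i => g_ *: wd [:: i] rho, fun ij => (- (g_ * no ij.2)) *: wd [:: ij.1] rho,
   0, 0, 0, 0).

Definition lot_bdry (rho : W 1) : X :=
  (0, 0, 0, fun i => (- (g_ * no i)) *: (rho : L), 0, 0, 0).

Lemma bl_lot_grad : bounded_linear lot_grad.
Proof.
have bw (a : R[i]) i : bounded_linear (fun f : W 1 => a *: (wd [:: i] f : L)).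
  by apply: (bl_scale (sW 1) sL); exact: bl_wderiv.
have b0 (Y : snSpace R) (sY : seminormed Y) := bl_0 (W 1) sY.
have bv : bounded_linear (fun f : W 1 => (fun i => g_ *: wd [:: i] f) : sn_pow vI L).
  exact: (@bl_fun R (W 1) L vI (fun i f => g_ *: wd [:: i] f) (fun i => bw g_ i)).
have bm : bounded_linear (fun f : W 1 =>
    (fun ij => (- (g_ * no ij.2)) *: wd [:: ij.1] f) : sn_pow mI L).
  exact: (@bl_fun R (W 1) L mI (fun ij f => (- (g_ * no ij.2)) *: wd [:: ij.1] f)
    (fun ij => bw (- (g_ * no ij.2)) ij.1)).
exact: (bl_pair (sW 1) (bl_pair (sW 1) (bl_pair (sW 1) (bl_pair (sW 1) (bl_pair (sW 1)
  (bl_pair (sW 1) (b0 _ (sW 1)) bv) bm) (b0 _ (sP vI))) (b0 _ (sP mI))) (b0 _ (sP vI)))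
  (b0 _ sL)).
Qed.

Lemma bl_lot_bdry : bounded_linear lot_bdry.
Proof.
have b0 (Y : snSpace R) (sY : seminormed Y) := bl_0 (W 1) sY.
have bv : bounded_linear (fun f : W 1 => (fun i => (- (g_ * no i)) *: (f : L)) : sn_pow vI L).
  apply: (@bl_fun R (W 1) L vI (fun i f => (- (g_ * no i)) *: (f : L))) => i.
  by apply: (bl_scale (sW 1) sL); exact: bl_WL.
exact: (bl_pair (sW 1) (bl_pair (sW 1) (bl_pair (sW 1) (bl_pair (sW 1) (bl_pair (sW 1)
  (bl_pair (sW 1) (b0 _ (sW 1)) (b0 _ (sP vI))) (b0 _ (sP mI))) bv) (b0 _ (sP mI)))
  (b0 _ (sP vI))) (b0 _ sL)).
Qed.

(** Only the last component of the normal contributes: the bounds below do not depend on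
    the dimension. *)
Lemma sum_normal (x : R) : \sum_(j < n.+1) normc (- (g_ * no j)) * x = `|gamma| * x.
Proof.
rewrite -mulr_suml (bigD1 ord_max) //= big1 => [|j jm]; rewrite /normal.
  by rewrite eqxx mulrN1 opprK normc_real addr0.
by rewrite (negbTE jm) mulr0 oppr0 normc0.
Qed.

Lemma norm_lot_grad rho : sn_mem (W 1) rho ->
  sn_norm X (lot_grad rho) <= 2 * `|gamma| * sn_norm (W 1) rho.
Proof.
move=> mrho; have mw i : sn_mem L (wd [:: i] rho).
  exact: (@mem_W_wderiv R n q q1 1 [:: i] rho mrho isT).2.
have -> : sn_norm X (lot_grad rho) = sn_norm (W 1) 0 +
   \sum_i sn_norm L (g_ *: wd [:: i] rho) +
   \sum_ij sn_norm L ((- (g_ * no ij.2)) *: wd [:: ij.1] rho) + sn_norm (sn_pow vI L) 0 +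
   sn_norm (sn_pow mI L) 0 + sn_norm (sn_pow vI L) 0 + sn_norm L 0 by [].
rewrite (norm0 (sW 1)) !(norm0 (sP _)) (norm0 sL) add0r !addr0.
have -> : \sum_i sn_norm L (g_ *: wd [:: i] rho) =
    `|gamma| * \sum_i sn_norm L (wd [:: i] rho).
  by rewrite mulr_sumr; apply: eq_bigr => i _; rewrite (normZ sL)// normc_real.
have -> : \sum_ij sn_norm L ((- (g_ * no ij.2)) *: wd [:: ij.1] rho) =
    `|gamma| * \sum_i sn_norm L (wd [:: i] rho).
  rewrite -(pair_bigA _ (fun i j => sn_norm L ((- (g_ * no j)) *: wd [:: i] rho))) /=.
  rewrite mulr_sumr; apply: eq_bigr => i _; rewrite -sum_normal.
  by apply: eq_bigr => j _; exact: (normZ sL _ (mw i)).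
rewrite -mulrDl -mulr2n -[_ *+ 2]mulr_natl; apply: ler_wpM2l; first by rewrite mulr_ge0.
by rewrite (W1_norm q1 mrho) lerDr; apply: (norm_ge0 sL); exact: mem_WL mrho.
Qed.

Lemma norm_lot_bdry rho : sn_mem (W 1) rho ->
  sn_norm X (lot_bdry rho) <= `|gamma| * sn_norm (W 1) rho.
Proof.
move=> mrho; have mL := mem_WL mrho.
have -> : sn_norm X (lot_bdry rho) = sn_norm (W 1) 0 + sn_norm (sn_pow vI L) 0 +
   sn_norm (sn_pow mI L) 0 + \sum_i sn_norm L ((- (g_ * no i)) *: (rho : L)) +
   sn_norm (sn_pow mI L) 0 + sn_norm (sn_pow vI L) 0 + sn_norm L 0 by [].
rewrite (norm0 (sW 1)) !(norm0 (sP _)) (norm0 sL) !add0r !addr0.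
have -> : \sum_i sn_norm L ((- (g_ * no i)) *: (rho : L)) = `|gamma| * sn_norm L rho.
  by rewrite -sum_normal; apply: eq_bigr => i _; exact: (normZ sL _ mL).
apply: ler_wpM2l => //; rewrite (W1_norm q1 mrho) lerDl.
apply: sumr_ge0 => i _; apply: (norm_ge0 sL).
exact: (@mem_W_wderiv R n q q1 1 [:: i] rho mrho isT).2.
Qed.

Let sX : seminormed X := seminormed_fXq.
Let sV m : seminormed (vec n (W m)) := seminormed_pow _ (sW m).

Lemma seminormed_Xq : seminormed (Xq H q).
Proof.
exact: (seminormed_prod (seminormed_prod (seminormed_prod (sW 1) (sP vI)) (sV 1)) (sW 2)).
Qed.

Let sXq := seminormed_Xq.

Lemma Hol_Sl (U : set R[i]) s' (A : R[i] -> X -> W 3) : openC U ->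
  cderiv_on U (@sqrtc R) s' -> Hol U A -> Hol U (fun l f => Sl l (A l f)).
Proof.
move=> oU ds.
have b0 (Y : snSpace R) (sY : seminormed Y) := bl_0 (W 3) sY.
have b1 : bounded_linear (fun f : W 3 =>
    (fun ijk => wd [:: ijk.1.1; ijk.1.2; ijk.2] f) : sn_pow tI L).
  by apply: (@bl_fun R (W 3) L tI (fun ijk f => wd [:: ijk.1.1; ijk.1.2; ijk.2] f)) => ijk;
    exact: bl_wderiv.
have b2 : bounded_linear (fun f : W 3 =>
    (fun ij => wd [:: ij.1; ij.2] f) : sn_pow mI L).
  by apply: (@bl_fun R (W 3) L mI (fun ij f => wd [:: ij.1; ij.2] f)) => ij;
    exact: bl_wderiv.
have b3 : bounded_linear (fun f : W 3 => f : W 1) by exact: bl_WW.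
apply: (Hol_sqrt_family sX (sW 3) seminormed_fAq oU ds
  (bl_pair (sW 3) (bl_pair (sW 3) b1 (b0 _ (sP mI))) (b0 _ (sW 1)))
  (bl_pair (sW 3) (bl_pair (sW 3) (b0 _ (sP tI)) b2) (b0 _ (sW 1)))
  (bl_pair (sW 3) (bl_pair (sW 3) (b0 _ (sP tI)) (b0 _ (sP mI))) b3)) => l f.
set x1 := (fun ijk => _) : sn_pow tI L; set x2 := (fun ij => _) : sn_pow mI L.
rewrite -[RHS]/(x1 + (sqrtc l *: 0 + l *: 0), 0 + (sqrtc l *: x2 + l *: 0),
  0 + (sqrtc l *: 0 + l *: (f : W 1))).
by rewrite !scaler0 !addr0 !add0r.
Qed.

Lemma Hol_Tl (U : set R[i]) s' (B : R[i] -> X -> vec n (W 2)) : openC U ->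
  cderiv_on U (@sqrtc R) s' -> Hol U B -> Hol U (fun l f => Tl l (B l f)).
Proof.
move=> oU ds.
have b0 (Y : snSpace R) (sY : seminormed Y) := bl_0 (vec n (W 2)) sY.
have bw s i : (size s <= 2)%N ->
    bounded_linear (fun u : vec n (W 2) => wd s (u i) : L).
  by move=> s2; apply: (bl_comp (sV 2) (sW 2) sL (bl_wderiv q1 s2)); exact: bl_proj.
have b1 : bounded_linear (fun u : vec n (W 2) =>
    (fun ijk => wd [:: ijk.1.1; ijk.1.2] (u ijk.2)) : sn_pow tI L).
  by apply: (@bl_fun R (vec n (W 2)) L tI
    (fun ijk u => wd [:: ijk.1.1; ijk.1.2] (u ijk.2))) => ijk; exact: bw.
have b2 : bounded_linear (fun u : vec n (W 2) =>
    (fun ij => wd [:: ij.1] (u ij.2)) : sn_pow mI L).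
  by apply: (@bl_fun R (vec n (W 2)) L mI (fun ij u => wd [:: ij.1] (u ij.2))) => ij;
    exact: bw.
have b3 : bounded_linear (fun u : vec n (W 2) => u : sn_pow vI L).
  apply: (@bl_fun R (vec n (W 2)) L vI (fun i u => u i)) => i.
  by apply: (bl_comp (sV 2) (sW 2) sL (bl_WL n q1 2)); exact: bl_proj.
apply: (Hol_sqrt_family sX (sV 2) seminormed_fBq oU ds
  (bl_pair (sV 2) (bl_pair (sV 2) b1 (b0 _ (sP mI))) (b0 _ (sP vI)))
  (bl_pair (sV 2) (bl_pair (sV 2) (b0 _ (sP tI)) b2) (b0 _ (sP vI)))
  (bl_pair (sV 2) (bl_pair (sV 2) (b0 _ (sP tI)) (b0 _ (sP mI))) b3)) => l u.
set x1 := (fun ijk => _) : sn_pow tI L; set x2 := (fun ij => _) : sn_pow mI L.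
rewrite -[RHS]/(x1 + (sqrtc l *: 0 + l *: 0), 0 + (sqrtc l *: x2 + l *: 0),
  0 + (sqrtc l *: 0 + l *: (u : sn_pow vI L))).
by rewrite !scaler0 !addr0 !add0r.
Qed.

Lemma bl_Fl l : bounded_linear (fun F : Xq H q => Fl l F : X).
Proof.
pose s1 := seminormed_prod (sW 1) (sP vI); pose s2 := seminormed_prod s1 (sV 1).
have p3 : bounded_linear (fun F : Xq H q => F.2) := bl_snd s2 (sW 2).
have p012 : bounded_linear (fun F : Xq H q => F.1) := bl_fst s2 (sW 2).
have p01 : bounded_linear (fun F : Xq H q => F.1.1) :=
  bl_comp sXq s2 s1 (bl_fst s1 (sV 1)) p012.
have p2 : bounded_linear (fun F : Xq H q => F.1.2) :=
  bl_comp sXq s2 (sV 1) (bl_snd s1 (sV 1)) p012.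
have p0 : bounded_linear (fun F : Xq H q => F.1.1.1) :=
  bl_comp sXq s1 (sW 1) (bl_fst (sW 1) (sP vI)) p01.
have p1 : bounded_linear (fun F : Xq H q => F.1.1.2) :=
  bl_comp sXq s1 (sP vI) (bl_snd (sW 1) (sP vI)) p01.
have p2i i : bounded_linear (fun F : Xq H q => F.1.2 i) :=
  bl_comp sXq (sV 1) (sW 1) (bl_proj (I := vI) (sW 1) i) p2.
have c3 : bounded_linear (fun F : Xq H q =>
    (fun ij => wd [:: ij.1] (F.1.2 ij.2)) : sn_pow mI L).
  apply: (@bl_fun R (Xq H q) L mI (fun ij F => wd [:: ij.1] (F.1.2 ij.2))) => ij.
  exact: (bl_comp sXq (sW 1) sL (@bl_wderiv R n q q1 1 [:: ij.1] isT) (p2i ij.2)).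
have c4 : bounded_linear (fun F : Xq H q => sqrtc l *: (F.1.2 : sn_pow vI L)).
  apply: (bl_scale sXq (sP vI)); apply: (@bl_fun R (Xq H q) L vI (fun i F => F.1.2 i)) => i.
  exact: (bl_comp sXq (sW 1) sL (bl_WL n q1 1) (p2i i)).
have c5 : bounded_linear (fun F : Xq H q =>
    (fun ij => wd [:: ij.1; ij.2] F.2) : sn_pow mI L).
  apply: (@bl_fun R (Xq H q) L mI (fun ij F => wd [:: ij.1; ij.2] F.2)) => ij.
  exact: (bl_comp sXq (sW 2) sL (@bl_wderiv R n q q1 2 [:: ij.1; ij.2] isT) p3).
have c6 : bounded_linear (fun F : Xq H q =>
    (fun i => wd [:: i] (sqrtc l *: F.2)) : sn_pow vI L).
  apply: (@bl_fun R (Xq H q) L vI (fun i F => wd [:: i] (sqrtc l *: F.2))) => i.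
  apply: (bl_comp sXq (sW 2) sL (@bl_wderiv R n q q1 2 [:: i] isT)).
  exact: (bl_scale sXq (sW 2) (sqrtc l) p3).
have c7 : bounded_linear (fun F : Xq H q => l *: (F.2 : L)).
  apply: (bl_scale sXq sL).
  exact: (bl_comp sXq (sW 2) sL (bl_WL n q1 2) p3).
have -> : (fun F : Xq H q => Fl l F : X) = (fun F =>
  (F.1.1.1, F.1.1.2, fun ij => wd [:: ij.1] (F.1.2 ij.2), sqrtc l *: (F.1.2 : sn_pow vI L),
   fun ij => wd [:: ij.1; ij.2] F.2, fun i => wd [:: i] (sqrtc l *: F.2), l *: (F.2 : L))).
  by apply/funext => -[[[d f] g] h].
exact: (bl_pair sXq (bl_pair sXq (bl_pair sXq (bl_pair sXq (bl_pair sXq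
  (bl_pair sXq p0 p1) c3) c4) c5) c6) c7).
Qed.

(** The terms with [gamma], moved to the right-hand side. *)
Definition lot (rho : W 3) : Xq H q :=
  (0, fun i => g_ *: @grad R n rho i, fun i => (- (g_ * no i)) *: (rho : W 1), 0).

Lemma mem_lot rho : sn_mem (W 3) rho -> sn_mem (Xq H q) (lot rho).
Proof.
move=> m3; have m1 : sn_mem (W 1) rho := bl_mem (bl_WW n q1 (m := 3) (m' := 1) isT) m3.
split; last exact: (mem0 (sW 2)).
split; first split; first exact: (mem0 (sW 1)).
  by move=> i; apply: (memZ sL); exact: (@mem_W_wderiv R n q q1 3 [:: i] rho m3 isT).2.
by move=> i; exact: (memZ (sW 1)).
Qed.

(** [Fl] on lower-order terms, written in terms of [l rho]: the norm of [l rho] is what the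
    operators for [gamma = 0] control, and the factors [1 / l] and [1 / sqrt l] make the
    perturbation small. *)
Definition lotF (l : R[i]) (rho : W 1) : X :=
  l^-1 *: lot_grad (l *: rho) + (sqrtc l)^-1 *: lot_bdry (l *: rho).

Lemma bl_lotF l : bounded_linear (lotF l).
Proof.
have bs : bounded_linear (fun f : W 1 => l *: f).
  by apply: (bl_scale (sW 1) (sW 1)); exact: (bl_id (sW 1)).
apply: (bl_add (sW 1) sX); apply: (bl_scale (sW 1) sX).
  exact: (bl_comp (sW 1) (sW 1) sX bl_lot_grad bs).
exact: (bl_comp (sW 1) (sW 1) sX bl_lot_bdry bs).
Qed.

(** Equality fails literally because the representatives chosen by [wderiv] need not be linear
    in the function. *)
Lemma Fl_lot l rho : l != 0 -> sn_mem (W 3) rho -> sn_eq (Fl l (lot rho) : X) (lotF l rho).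
Proof.
move=> l0 m3; have s0 : sqrtc l != 0 by rewrite sqrtc_eq0.
have m1 : sn_mem (W 1) rho := bl_mem (bl_WW n q1 (m := 3) (m' := 1) isT) m3.
have lE : sqrtc l = (sqrtc l)^-1 * l by rewrite -{3}(sqr_sqrtc l) expr2 mulKf.
have bw i := @bl_wderiv R n q q1 1 [:: i] isT.
have mw i := bl_mem (bw i) m1.
have key (a : R[i]) i : sn_eq (a *: wd [:: i] rho : L) (l^-1 *: (a *: wd [:: i] (l *: rho))).
  have -> : a *: wd [:: i] rho = (l^-1 * a) *: (l *: wd [:: i] rho).
    by rewrite scalerA mulrAC mulVf// mul1r.
  have -> : l^-1 *: (a *: wd [:: i] (l *: rho)) = (l^-1 * a) *: wd [:: i] (l *: rho).
    by rewrite scalerA.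
  have mlw : sn_mem L (l *: wd [:: i] rho) by exact: (memZ sL).
  have mwl : sn_mem L (wd [:: i] (l *: rho)) by apply: (bl_mem (bw i)); exact: (memZ (sW 1)).
  apply: (sn_eqZ sL) => //; apply: (sn_eq_sym sL) => //.
  exact: (bl_Z (sW 1) sL l (bw i) m1).
have bwZ (a : R[i]) i : sn_eq (wd [:: i] (a *: rho) : L) (a *: wd [:: i] rho).
  exact: (bl_Z (sW 1) sL a (bw i) m1).
pose a := l^-1; pose b := (sqrtc l)^-1.
pose F1 : sn_pow vI L := fun i => g_ *: wd [:: i] (l *: rho).
pose F2 : sn_pow mI L := fun ij => (- (g_ * no ij.2)) *: wd [:: ij.1] (l *: rho).
pose F3 : sn_pow vI L := fun i => (- (g_ * no i)) *: (l *: rho : L).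
have -> : lotF l rho = (0, a *: F1, a *: F2, b *: F3, 0, 0, 0) :> X.
  rewrite -[LHS]/(a *: 0 + b *: 0, a *: F1 + b *: 0, a *: F2 + b *: 0, a *: 0 + b *: F3,
    a *: 0 + b *: 0, a *: 0 + b *: 0, a *: 0 + b *: 0).
  by rewrite !scaler0 !addr0 !add0r.
apply: sn_eq_pair; first apply: sn_eq_pair; first apply: sn_eq_pair; first apply: sn_eq_pair;
  first apply: sn_eq_pair; first apply: sn_eq_pair.
- exact: (sn_eq_refl (sW 1)).
- by apply: sn_eq_fun => i; exact: key.
- apply: sn_eq_fun => -[i j] /=.
  have m2 : sn_mem (W 1) ((- (g_ * no j)) *: rho) by exact: (memZ (sW 1)).
  apply: (sn_eq_trans sL _ _ _ (bwZ (- (g_ * no j)) i) (key _ i)).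
  + exact: (bl_mem (bw i) m2).
  + exact: (memZ sL).
  + by apply: (memZ sL); apply: (memZ sL); apply: (bl_mem (bw i)); exact: (memZ (sW 1)).
- apply: sn_eq_fun => i.
  have -> : (b *: F3) i = (sqrtc l *: (fun i => (- (g_ * no i)) *: (rho : L))) i.
    rewrite -[LHS]/(b *: ((- (g_ * no i)) *: (l *: (rho : L)))).
    rewrite -[RHS]/(sqrtc l *: ((- (g_ * no i)) *: (rho : L))).
    by rewrite !scalerA; congr (_ *: _); rewrite [in RHS]lE -/b; ring.
  exact: (sn_eq_refl sL).
- by apply: sn_eq_fun => ij; exact: (wderiv0 q1 [:: ij.1; ij.2]).2.
- by apply: sn_eq_fun => i; rewrite scaler0; exact: (wderiv0 q1 [:: i]).2.
- by rewrite scaler0; exact: (sn_eq_refl sL).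
Qed.

(** The range of the perturbation: its first component vanishes, so that Neumann series are
    summed in [L_q]. *)
Definition zero_first : set X :=
  [set 0] `*` sn_mem (sn_pow vI L) `*` sn_mem (sn_pow mI L) `*` sn_mem (sn_pow vI L)
    `*` sn_mem (sn_pow mI L) `*` sn_mem (sn_pow vI L) `*` sn_mem L.

Lemma zero_firstP f : sn_mem X f -> f.1.1.1.1.1.1 = 0 -> zero_first f.
Proof. by case: f => [[[[[[x0 x1] x2] x3] x4] x5] x6] [[[[[[m0 m1] m2] m3] m4] m5] m6] /= ->. Qed.

Lemma zero_first_mem : zero_first `<=` sn_mem X.
Proof.
move=> [[[[[[x0 x1] x2] x3] x4] x5] x6] [[[[[[/= -> m1] m2] m3] m4] m5] m6].
by do 6! split=> //; exact: (mem0 (sW 1)).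
Qed.

Lemma summable_zero_first : summable_in zero_first.
Proof.
have step (Y Z : snSpace R) (V : set Y) : seminormed Y -> seminormed Z ->
    V `<=` sn_mem Y /\ summable_in V -> summable_in (sn_mem Z) ->
    V `*` sn_mem Z `<=` sn_mem (Y \xs Z) /\ summable_in (X := Y \xs Z) (V `*` sn_mem Z).
  move=> sY sZ [VY cV] cZ; split; first by move=> f [/VY].
  by apply: (summable_prod sY sZ VY) => //.
have rL : summable_in (sn_mem L) := riesz_fischer q1 mH.
have rP (I : finType) : summable_in (sn_mem (sn_pow I L)).
  by apply: (summable_pow (I := I) sL _ rL).
have h0 : [set (0 : W 1)] `<=` sn_mem (W 1) /\ summable_in [set (0 : W 1)].
  by split; [move=> _ ->; exact: (mem0 (sW 1))|exact: (summable_0 (sW 1))].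
pose s1 := seminormed_prod (sW 1) (sP vI); pose s2 := seminormed_prod s1 (sP mI).
pose s3 := seminormed_prod s2 (sP vI); pose s4 := seminormed_prod s3 (sP mI).
pose s5 := seminormed_prod s4 (sP vI).
have h1 := step _ _ _ (sW 1) (sP vI) h0 (rP vI).
have h2 := step _ _ _ s1 (sP mI) h1 (rP mI).
have h3 := step _ _ _ s2 (sP vI) h2 (rP vI).
have h4 := step _ _ _ s3 (sP mI) h3 (rP mI).
have h5 := step _ _ _ s4 (sP vI) h4 (rP vI).
exact: (step _ _ _ s5 sL h5 rL).2.
Qed.

Variables (mu nu kappa : R).
Implicit Types (rho : Rn -> R[i]) (u : vI -> Rn -> R[i]).

Lemma gkop_split f : @gkop R n gamma kappa f = @gkop R n 0 kappa f + g_ *: f.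
Proof.
have C0 : 0%:C = 0 :> R[i] by [].
by rewrite /gkop C0 scale0r add0r addrC.
Qed.

(** Moving the lower-order terms to the data is pure algebra: in the boundary condition, stress
    minus datum is literally the same function for both systems. *)
Lemma solves_lot l (F : Xq H q) rho u :
  solves mu nu gamma kappa l F rho u <-> solves mu nu 0 kappa l (F - lot rho) rho u.
Proof.
case: F => -[[d f] g] h.
have -> : ((d, f, g, h) : Xq H q) - lot rho = (d, f - (fun i => g_ *: @grad R n rho i),
  g - (fun i => (- (g_ * no i)) *: rho), h).
  by rewrite -[in RHS](subr0 d) -[in RHS](subr0 h).
have bE i : \sum_j no j *: stress mu nu gamma kappa rho u i j - g i =
    \sum_j no j *: stress mu nu 0 kappa rho u i j - (g i - (- (g_ * no i)) *: rho).
  have sE j : no j *: stress mu nu gamma kappa rho u i j =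
      no j *: stress mu nu 0 kappa rho u i j - (if i == j then (g_ * no i) *: rho else 0).
    rewrite /stress; case: eqP => [<-|_]; last by rewrite subr0.
    rewrite gkop_split; move: (gkop 0 kappa rho) => K0.
    by rewrite opprD addrA addrA scalerBr scalerA [no i * _]mulrC !addrA.
  have sumE : \sum_j (if i == j then (g_ * no i) *: rho else 0) = (g_ * no i) *: rho.
    by rewrite -big_mkcond (big_pred1 i)// => j; rewrite eq_sym.
  by rewrite (eq_bigr _ (fun j _ => sE j)) sumrB sumE scaleNr opprK opprD addrA addrAC.
have pt (w K G v : Rn -> R[i]) (c : R[i]) x :
    (w + (K + c *: G)) x = v x <-> (w + K) x = (v - c *: G) x.
  rewrite -[(w + (K + _)) x]/(w x + (K x + c * G x)) -[(w + K) x]/(w x + K x).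
  rewrite -[(v - _) x]/(v x - c * G x) addrA; split=> [<-|->]; first by rewrite addrK.
  by rewrite subrK.
split=> -[e1 e2 e3 e4]; (split; [exact: e1| | |exact: e4]).
- move=> i; apply: filterS (e2 i) => x E Hx.
  by move: (E Hx); rewrite (gkop_split (grad rho i)) => E'; exact: ((pt _ _ _ _ _ _).1 E').
- by move=> i; rewrite /eq_bdry -[X in _ - X]/(g i - _) -bE; exact: e3.
- move=> i; apply: filterS (e2 i) => x E Hx.
  by rewrite (gkop_split (grad rho i)); exact: ((pt _ _ _ _ _ _).2 (E Hx)).
- by move=> i; rewrite /eq_bdry bE; exact: e3.
Qed.

(** Without lower-order terms the boundary conditions only involve weak derivatives, which do
    not depend on the representatives of [rho] and [u]. *)
Lemma solves_ext l (F : Xq H q) (rho rho' : W 3) (u u' : vec n (W 2)) :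
  sn_mem (W 3) rho -> sn_mem (W 3) rho' -> sn_mem (vec n (W 2)) u -> sn_mem (vec n (W 2)) u' ->
  sn_eq rho rho' -> sn_eq u u' ->
  solves mu nu 0 kappa l F rho u -> solves mu nu 0 kappa l F rho' u'.
Proof.
move=> mr mr' mu_ mu' Er Eu.
have ext m (f g : W m) : sn_mem (W m) f -> sn_mem (W m) g -> sn_eq f g ->
    (forall s, wd s f = wd s g) /\ {ae leb R n.+1, forall x, H x -> f x = g x}.
  move=> mf mg fg; have E := W_ext q1 mf mg fg.
  by split=> [s|]; [exact: (wderiv_ext q1 s (mem_WL mf) (mem_WL mg) E)
    |exact: (sn_eq_ae q1 (mem_WL mf) (mem_WL mg) E)].
have Eui i : sn_eq (u i) (u' i).
  exact: (bl_eq (sV 2) (sW 2) (bl_proj (I := vI) (sW 2) i) mu_ mu' Eu).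
have [dr ar] := ext 3 rho rho' mr mr' Er.
have du i s : wd s (u i) = wd s (u' i) := (ext 2 _ _ (mu_ i) (mu' i) (Eui i)).1 s.
have au i := (ext 2 _ _ (mu_ i) (mu' i) (Eui i)).2.
have gE : @grad R n rho = grad rho' by apply/funext => i; exact: dr.
have vE : @dvg R n u = dvg u' by apply: eq_bigr => j _; exact: du.
have lE i : @lap R n (u i) = lap (u' i) by apply: eq_bigr => j _; rewrite du.
have lrE : @lap R n rho = lap rho' by apply: eq_bigr => j _; rewrite dr.
have DE i j : @Dsym R n u i j = Dsym u' i j by rewrite /Dsym !du.
have C0 : 0%:C = 0 :> R[i] by [].
have kE : @gkop R n 0 kappa rho = gkop 0 kappa rho' by rewrite /gkop C0 !scale0r lrE.
have sE i j : @stress R n mu nu 0 kappa rho u i j = stress mu nu 0 kappa rho' u' i j.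
  by rewrite /stress DE vE kE.
case: F => -[[d f] g] h [e1 e2 e3 e4]; split.
- apply: filterS2 ar e1 => x r1 E Hx; rewrite -(E Hx) vE.
  rewrite -[LHS]/(l * rho' x + dvg u' x) -[RHS]/(l * rho x + dvg u' x).
  by rewrite (r1 Hx).
- move=> i; apply: filterS2 (au i) (e2 i) => x r1 E Hx; rewrite -(E Hx) vE lE gE.
  move: (lap _) (grad _ _) (gkop _ _ _) => w1 w2 w3.
  rewrite -[LHS]/(l * u' i x - mu%:C * w1 x - nu%:C * w2 x + w3 x).
  rewrite -[RHS]/(l * u i x - mu%:C * w1 x - nu%:C * w2 x + w3 x).
  by rewrite (r1 Hx).
- by move=> i; under eq_bigr do rewrite -sE; exact: e3.
- by rewrite -gE; exact: e4.
Qed.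

End model.

(** * The theorem *)

Section main.
Variables (R : realType) (n : nat) (p q mu nu gamma kappa c0 sigma : R).
Hypotheses (p1 : 1 <= p) (q1' : 1 < q) (c00 : 0 < c0) (sigma0 : 0 < sigma < pi).
Local Notation H := (@half_space R n).
Local Notation W m := (Wmq H m q).
Local Notation X := (fXq H q).
Local Notation V m := (vec n (W m)).
Variables (A0 : R[i] -> X -> W 3) (B0 : R[i] -> X -> V 2).
Hypothesis solA : solution_operators mu nu 0 kappa sigma (1 / 2) A0 B0.
Hypothesis bndA : R_bounds_le p sigma (1 / 2) c0 A0 B0.

Let q1 : 1 <= q := ltW q1'.
Let sW m : seminormed (W m) := seminormed_Wmq n q1 m.
Let sV m : seminormed (V m) := seminormed_pow _ (sW m).
Let sX : seminormed X := seminormed_fXq n q1.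
Let sA : seminormed (fAq H q) := seminormed_fAq n q1.
Let sB : seminormed (fBq H q) := seminormed_fBq n q1.

(** The square root of [lambda0]; it bounds [|l|] and [|sqrt l|] from below on [U]. *)
Let La : R := 1 + 24 * `|gamma| * c0.
Let U := sector sigma (La ^+ 2).
Let U1 := sector sigma (1 / 2 : R).

Let La1 : 1 <= La.
Proof. by rewrite lerDl !mulr_ge0// ltW. Qed.

Let La0 : 0 < La. Proof. exact: lt_le_trans La1. Qed.

Let UU1 : U `<=` U1.
Proof. by apply: sub_sector; have := exprn_ege1 2 La1; lra. Qed.

Let oU : openC U.
Proof. by apply: sector_open => //; exact: sqr_ge0. Qed.

Let oU1 : openC U1.
Proof. by apply: sector_open => //; lra. Qed.

Let U_normc l : U l -> La <= normc l.
Proof.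
move=> [_ Ul]; apply: le_trans (ltW Ul); rewrite expr2 -{1}[La]mulr1.
by rewrite ler_pM2l.
Qed.

Let U_neq0 l : U l -> l != 0.
Proof. by move=> /U_normc Ul; rewrite -normc_gt0 (lt_le_trans La0). Qed.

Let U_sqrt l : U l -> La <= normc (sqrtc l).
Proof.
move=> [_ Ul]; have La0' := ltW La0.
by rewrite -(@ler_pXn2r _ 2)// ?nnegrE ?normc_ge0// sqr_normc_sqrtc ltW.
Qed.

Let U_inv l : U l -> normc l^-1 <= La^-1.
Proof.
move=> Ul; have l0 := U_normc Ul.
by rewrite normcV lef_pV2 ?posrE// (lt_le_trans La0).
Qed.

Let U_inv_sqrt l : U l -> normc (sqrtc l)^-1 <= La^-1.
Proof.
move=> Ul; have l0 := U_sqrt Ul.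
by rewrite normcV lef_pV2 ?posrE// (lt_le_trans La0).
Qed.

Let ds1 : cderiv_on U1 (@sqrtc R) (fun l => (2 * sqrtc l)^-1).
Proof. exact: cderiv_sqrtc. Qed.

(** The operators whose R-bounds are known. *)
Let E0 l (f : X) : fAq H q := Sl l (A0 l f).
Let F0 l (f : X) : fBq H q := Tl l (B0 l f).

Let HE1 : Hol U1 E0.
Proof. by case: solA => HA _ _; exact: (Hol_Sl q1 oU1 ds1 HA). Qed.

Let HF1 : Hol U1 F0.
Proof. by case: solA => _ HB _; exact: (Hol_Tl q1 oU1 ds1 HB). Qed.

Let dE : deriv_on U E0 (op_deriv E0) := deriv_on_sub UU1 (Hol_deriv_on HE1).
Let dF : deriv_on U F0 (op_deriv F0) := deriv_on_sub UU1 (Hol_deriv_on HF1).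

Let bE : Rbd p U E0 c0.
Proof. exact: (Rbd_sub UU1 ((R_bound_leP p U1 E0 c00).1 (bndA (leq0n 1)).1)). Qed.

Let bF : Rbd p U F0 c0.
Proof. exact: (Rbd_sub UU1 ((R_bound_leP p U1 F0 c00).1 (bndA (leq0n 1)).2)). Qed.

Let bE' : Rbd p U (fun l f => l *: op_deriv E0 l f) c0.
Proof.
exact: (Rbd_sub UU1 ((R_bound_leP p U1 (fun l f => l *: op_deriv E0 l f) c00).1
  (bndA (leqnn 1)).1)).
Qed.

Let bF' : Rbd p U (fun l f => l *: op_deriv F0 l f) c0.
Proof.
exact: (Rbd_sub UU1 ((R_bound_leP p U1 (fun l f => l *: op_deriv F0 l f) c00).1
  (bndA (leqnn 1)).2)).
Qed.

(** The lower-order operators act on [l rho], the last component of [Sl]. *)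
Let Phi l (f : X) : W 1 := (E0 l f).2.
Let Phi' l (f : X) : W 1 := (op_deriv E0 l f).2.

Let b2 : bounded_linear (fun g : fAq H q => g.2 : W 1).
Proof.
exact: (bl_snd (seminormed_prod (seminormed_pow _ (seminormed_Lq q1 (@measurable_half_space R n)))
  (seminormed_pow _ (seminormed_Lq q1 (@measurable_half_space R n)))) (sW 1)).
Qed.

Let n2 (g : fAq H q) : sn_mem (fAq H q) g -> sn_norm (W 1) g.2 <= 1 * sn_norm (fAq H q) g.
Proof.
move=> [[m1 m2] m3]; have sL := seminormed_Lq q1 (@measurable_half_space R n).
rewrite mul1r; apply: ler_wpDl => //; apply: addr_ge0.
  exact: (norm_ge0 (seminormed_pow _ sL) m1).
exact: (norm_ge0 (seminormed_pow _ sL) m2).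
Qed.

Let dPhi : deriv_on U Phi Phi' := deriv_on_bl sX sA (sW 1) oU b2 dE.

Let mE : maps_on U E0. Proof. by have [] := deriv_on_maps dE. Qed.
Let mE' : maps_on U (fun l f => l *: op_deriv E0 l f).
Proof.
have [_ m'] := deriv_on_maps dE.
by move=> l f Ul mf; apply: (memZ sA); exact: m'.
Qed.

Let bPhi : Rbd p U Phi c0.
Proof.
by rewrite -[c0]mul1r; exact: (Rbd_comp ler01 mE (Rbd_cst p1 sA (sW 1) b2 ler01 n2) bE).
Qed.

Let bPhi' : Rbd p U (fun l f => l *: Phi' l f) c0.
Proof.
by rewrite -[c0]mul1r; exact: (Rbd_comp ler01 mE' (Rbd_cst p1 sA (sW 1) b2 ler01 n2) bE').
Qed.

Let s1' (l : R[i]) : R[i] := - 1 / l ^+ 2.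
Let s2' (l : R[i]) : R[i] := - (2 * sqrtc l)^-1 / sqrtc l ^+ 2.

Let ds1' : cderiv_on U (fun l => l^-1) s1'.
Proof. by apply: (cderiv_inv (@cderiv_id R U)) => l; exact: U_neq0. Qed.

Let ds2' : cderiv_on U (fun l => (sqrtc l)^-1) s2'.
Proof.
apply: (cderiv_inv (s := @sqrtc R) (s' := fun l => (2 * sqrtc l)^-1)).
  exact: (cderiv_sqrtc (sqr_ge0 _) sigma0).
by move=> l Ul; rewrite sqrtc_eq0; exact: U_neq0.
Qed.

Let U_s1' l : U l -> normc (l * s1' l) <= La^-1.
Proof.
move=> Ul; have l0 := U_neq0 Ul; have -> : l * s1' l = - l^-1 by rewrite /s1'; field.
by rewrite normcN; exact: U_inv.
Qed.

Let U_s2' l : U l -> normc (l * s2' l) <= La^-1.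
Proof.
move=> Ul; have l0 := U_neq0 Ul; have s0 : sqrtc l != 0 by rewrite sqrtc_eq0.
have -> : l * s2' l = (- 2^-1) * (sqrtc l)^-1.
  by rewrite /s2' -{1}(sqr_sqrtc l); field.
rewrite normcM normcN; apply: le_trans (_ : 1 * normc (sqrtc l)^-1 <= _).
  apply: ler_wpM2r; first exact: normc_ge0.
  by rewrite normcV normc_2; lra.
by rewrite mul1r; exact: U_inv_sqrt.
Qed.

Let T l (f : X) : X := l^-1 *: lot_grad gamma (Phi l f) + (sqrtc l)^-1 *: lot_bdry gamma (Phi l f).
Let T' l (f : X) : X :=
  (s1' l *: lot_grad gamma (Phi l f) + l^-1 *: lot_grad gamma (Phi' l f)) +
  (s2' l *: lot_bdry gamma (Phi l f) + (sqrtc l)^-1 *: lot_bdry gamma (Phi' l f)).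

Let bG := bl_lot_grad n gamma q1.
Let bD := bl_lot_bdry n gamma q1.
Let nG := @norm_lot_grad R n q gamma q1.
Let nD := @norm_lot_bdry R n q gamma q1.

Let d1 := deriv_on_scaled sX (sW 1) sX oU ds1' bG dPhi.
Let d2 := deriv_on_scaled sX (sW 1) sX oU ds2' bD dPhi.

Let dT : deriv_on U T T' := deriv_on_add sX sX oU d1 d2.

Let mPhi : maps_on U Phi. Proof. by have [] := deriv_on_maps dPhi. Qed.

Let Lai0 : 0 < La^-1. Proof. by rewrite invr_gt0. Qed.
Let g0 : 0 <= `|gamma|. Proof. exact: normr_ge0. Qed.
Let g20 : 0 <= 2 * `|gamma|. Proof. exact: mulr_ge0. Qed.

(* The constant 24 comes from the R-bound of [l T' l]: the two pieces of [T] have norms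
   [2 |gamma|] and [|gamma|], each has two terms by the product rule, and complex factors cost
   a factor 2 in R-bounds. *)
Let La_absorb : 12 * (La^-1 * (`|gamma| * c0)) <= 2^-1.
Proof.
have -> : 12 * (La^-1 * (`|gamma| * c0)) = 12 * `|gamma| * c0 / La by field; rewrite gt_eqF.
by rewrite ler_pdivrMr// /La; lra.
Qed.

Let bT : Rbd p U T 2^-1.
Proof.
have [m1 _] := deriv_on_maps d1; have [m2 _] := deriv_on_maps d2.
apply: (Rbd_le (c := 2 * La^-1 * (2 * `|gamma| * c0) + 2 * La^-1 * (`|gamma| * c0))).
  apply: le_trans La_absorb.
  have h : 0 <= La^-1 * (`|gamma| * c0) by rewrite !mulr_ge0// ltW.
  by move: h; lra.
apply: (Rbd_add p1 sX m1 m2).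
  exact: (Rbd_scaled (sW 1) sX p1 bG g20 nG Lai0 U_inv mPhi bPhi).
exact: (Rbd_scaled (sW 1) sX p1 bD g0 nD Lai0 U_inv_sqrt mPhi bPhi).
Qed.

Let bT' : Rbd p U (fun l f => l *: T' l f) 2^-1.
Proof.
have [_ m1] := deriv_on_maps d1; have [_ m2] := deriv_on_maps d2.
have k1 := Rbd_scaled_deriv (sW 1) sX p1 bG g20 nG Lai0 U_inv U_s1' dPhi bPhi bPhi'.
have k2 := Rbd_scaled_deriv (sW 1) sX p1 bD g0 nD Lai0 U_inv_sqrt U_s2' dPhi bPhi bPhi'.
have M1 : maps_on U (fun l f =>
    l *: (s1' l *: lot_grad gamma (Phi l f) + l^-1 *: lot_grad gamma (Phi' l f)) : X).
  by move=> l f Ul mf; apply: (memZ sX); exact: m1.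
have M2 : maps_on U (fun l f =>
    l *: (s2' l *: lot_bdry gamma (Phi l f) + (sqrtc l)^-1 *: lot_bdry gamma (Phi' l f)) : X).
  by move=> l f Ul mf; apply: (memZ sX); exact: m2.
have k := Rbd_add p1 sX M1 M2 k1 k2.
have E : (fun l f => l *: T' l f) = (fun l f =>
    l *: (s1' l *: lot_grad gamma (Phi l f) + l^-1 *: lot_grad gamma (Phi' l f)) +
    l *: (s2' l *: lot_bdry gamma (Phi l f) + (sqrtc l)^-1 *: lot_bdry gamma (Phi' l f)) : X).
  by apply/funext => l; apply/funext => f; rewrite -scalerDr.
rewrite E; apply: Rbd_le k; apply: le_trans La_absorb.
by apply: le_of_eq; ring.
Qed.

Let normT l f : U l -> sn_mem X f -> sn_norm X (T l f) <= 2^-1 * sn_norm X f.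
Proof. by have [mT _] := deriv_on_maps dT; exact: (Rbd_norm p1 sX sX mT bT). Qed.

(** The inverse of [1 + T l], chosen for each [l] and [f]. *)
Let J l (f : X) : X := xget 0 [set g | sn_mem X g /\ sn_eq (g + T l g) f].

Let JP l f : U l -> sn_mem X f -> sn_mem X (J l f) /\ sn_eq (J l f + T l (J l f)) f.
Proof.
move=> Ul mf; have bTl := (dT Ul).1.
have [g mg Eg] : exists2 g, sn_mem X g & sn_eq (g + T l g) f.
  apply: (neumann sX (@zero_first_mem R n q q1) (@summable_zero_first R n q q1) bTl _
    (fun f => normT Ul) mf).
  move=> h mh; apply: zero_firstP; first exact: (bl_mem bTl).
  by rewrite -[LHS]/(l^-1 *: 0 + (sqrtc l)^-1 *: 0 : W 1) !scaler0 addr0.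
exact: (xgetPex (P := [set g | sn_mem X g /\ sn_eq (g + T l g) f]) 0
  (ex_intro _ g (conj mg Eg))).
Qed.

Let mJ : maps_on U J. Proof. by move=> l f Ul mf; case: (JP Ul mf). Qed.
Let JE l f : U l -> sn_mem X f -> sn_eq (J l f + T l (J l f)) f.
Proof. by move=> Ul mf; case: (JP Ul mf). Qed.

Let sXq : seminormed (Xq H q) := seminormed_Xq n q1.

(** Moving the lower-order terms to the data acts on the level of [fXq] as [- lotF], and
    [lotF l (A0 l f)] is [T l f]. *)
Lemma Fl_sub_lot l F (rho : W 3) : U l -> sn_mem (Xq H q) F -> sn_mem (W 3) rho ->
  sn_eq (Fl l (F - lot gamma rho) : X) (Fl l F - lotF gamma l rho).
Proof.
move=> Ul mF mr; have bFl := bl_Fl n q1 l; have mlot := mem_lot gamma q1 mr.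
have mr1 : sn_mem (W 1) rho := bl_mem (bl_WW n q1 (m := 3) (m' := 1) isT) mr.
have ml := bl_mem (bl_lotF n gamma q1 l) mr1.
have [mFl mFlot] := (bl_mem bFl mF, bl_mem bFl mlot).
have mD : sn_mem X (Fl l (F - lot gamma rho)) by apply: (bl_mem bFl); exact: (memB sXq).
have m1 : sn_mem X (Fl l F - Fl l (lot gamma rho)) by exact: (memB sX).
have m2 : sn_mem X (Fl l F - lotF gamma l rho) by exact: (memB sX).
have E1 : sn_eq (Fl l (F - lot gamma rho) : X) (Fl l F - Fl l (lot gamma rho)).
  exact: (bl_sub bFl mF mlot).
have E2 : sn_eq (- Fl l (lot gamma rho) : X) (- lotF gamma l rho).
  exact: (sn_eqN sX mFlot ml (Fl_lot gamma q1 (U_neq0 Ul) mr)).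
exact: (sn_eq_trans sX mD m1 m2 E1
  (sn_eqD sX mFl mFl (memN sX mFlot) (memN sX ml) (sn_eq_refl sX _) E2)).
Qed.

(** For [h = J (Fl l F)] the density [A0 l h] turns the data [F] into [F - lot (A0 l h)], which
    [Fl l] maps to [Fl l F - T l h], that is to [h]: so [A0 l h] and [B0 l h] solve the system
    without lower-order terms for these data. Conversely any solution for [F] yields data [k]
    with [k + T l k = Fl l F], and [1 + T l] is injective. *)
Lemma unique_solution_perturbed l (F : Xq H q) : sn_mem (Xq H q) F -> U l ->
  unique_solution mu nu gamma kappa l F (A0 l (J l (Fl l F))) (B0 l (J l (Fl l F))).
Proof.
move=> mF Ul; have [HA HB Hsol] := solA; have U1l := UU1 Ul.
have [bA bB] := ((HA l U1l).1, (HB l U1l).1).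
have bFl := bl_Fl n q1 l; have mK := bl_mem bFl mF.
have [] := JP Ul mK; set K := Fl l F in mK *; set h := J l K => mh Eh.
have [mr mu_] := (bl_mem bA mh, bl_mem bB mh).
have blot : bounded_linear (fun rho : W 3 => lotF gamma l (rho : W 1)).
  exact: (bl_comp (sW 3) (sW 1) sX (bl_lotF n gamma q1 l) (bl_WW n q1 (m := 3) (m' := 1) isT)).
have mT f : sn_mem X f -> sn_mem X (T l f) := fun mf => bl_mem (dT Ul).1 mf.
have TE f : T l f = lotF gamma l (A0 l f) by [].
(* the system for [gamma = 0] with the lower-order terms of [rho] among the data *)
have mG rho : sn_mem (W 3) rho -> sn_mem (Xq H q) (F - lot gamma rho).
  by move=> m; exact: (memB sXq mF (mem_lot gamma q1 m)).
have solG rho (m : sn_mem (W 3) rho) := Hsol _ _ (mG rho m) U1l.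
have mKG rho (m : sn_mem (W 3) rho) := bl_mem bFl (mG rho m).
split; first by split.
- have EG : sn_eq (Fl l (F - lot gamma (A0 l h)) : X) h.
    have mlr := bl_mem blot mr.
    apply: (sn_eq_trans sX (mKG _ mr) _ mh (Fl_sub_lot Ul mF mr)); first exact: (memB sX).
    have mhT : sn_mem X (h + T l h) by exact: (memD sX mh (mT h mh)).
    have E1 : h + T l h - lotF gamma l (A0 l h) = h by rewrite TE; lmodR.
    rewrite -[X in sn_eq _ X]E1.
    exact: (sn_eqD sX mK mhT (memN sX mlr) (memN sX mlr) (sn_eq_sym sX mhT mK Eh)
      (sn_eq_refl sX _)).
  have [_ s0 _] := solG _ mr; apply/(solves_lot gamma).
  apply: (solves_ext q1 _ _ _ _ _ _ s0) => //.
  + exact: (bl_mem bA (mKG _ mr)).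
  + exact: (bl_mem bB (mKG _ mr)).
  + exact: (bl_eq sX (sW 3) bA (mKG _ mr) mh EG).
  + exact: (bl_eq sX (sV 2) bB (mKG _ mr) mh EG).
- move=> rho' u' [mr' mu'] /(solves_lot gamma) s'.
  have [[mr1 mu1] _ /(_ rho' u' (conj mr' mu') s')] := solG _ mr'.
  set k := Fl l (F - lot gamma rho') in mr1 mu1 *.
  have mk : sn_mem X k := mKG _ mr'.
  move=> /(sn_eq_prod (sW 3) (sV 2)) [//|//|Er Eu]; rewrite /= in Er Eu.
  have F1 : sn_eq (T l k) (lotF gamma l rho').
    have mk1 := bl_mem blot mr1; have mk2 := bl_mem blot mr'.
    exact: (sn_eq_sym sX mk2 mk1 (bl_eq (sW 3) sX blot mr' mr1 Er)).
  have mlr := bl_mem blot mr'; have mKl := memB sX mK mlr.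
  have mkT := memD sX mk (mT k mk); have mhT := memD sX mh (mT h mh).
  have F2 : sn_eq (k + T l k) K.
    have E1 : K - lotF gamma l rho' + lotF gamma l rho' = K by lmodR.
    rewrite -[X in sn_eq _ X]E1.
    exact: (sn_eqD sX mk mKl (mT k mk) mlr (Fl_sub_lot Ul mF mr') F1).
  have kh : sn_eq k h.
    apply: (IT_inj sX dT normT Ul mk mh).
    exact: (sn_eq_trans sX mkT mK mhT F2 (sn_eq_sym sX mhT mK Eh)).
  apply: sn_eq_pair.
  + exact: (sn_eq_trans (sW 3) mr' mr1 mr Er (bl_eq sX (sW 3) bA mk mh kh)).
  + exact: (sn_eq_trans (sV 2) mu' mu1 mu_ Eu (bl_eq sX (sV 2) bB mk mh kh)).
Qed.

Lemma perturbed_operators :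
  exists (A : R[i] -> X -> W 3) (B : R[i] -> X -> V 2),
    solution_operators mu nu gamma kappa sigma (La ^+ 2) A B /\
    R_bounds_le p sigma (La ^+ 2) (4 * c0) A B.
Proof.
have [HA HB _] := solA; have c0' := ltW c00.
have dA := deriv_on_sub UU1 (Hol_deriv_on HA); have dB := deriv_on_sub UU1 (Hol_deriv_on HB).
exists (fun l f => A0 l (J l f)), (fun l f => B0 l (J l f)); split; first split.
- exact: (Hol_perturbed p1 sX (sW 3) oU dT bT mJ JE dA).
- exact: (Hol_perturbed p1 sX (sV 2) oU dT bT mJ JE dB).
- by move=> F l mF Ul; exact: unique_solution_perturbed.
have c4 : 0 < 4 * c0 by exact: mulr_gt0.
have c24 : 2 * c0 <= 4 * c0 by lra.
case=> [_|[_|//]]; split.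
- apply/(R_bound_leP p U _ c4); apply: Rbd_le c24 _.
  exact: (Rbd_perturbed p1 sX dT bT mJ JE c0' bE).
- apply/(R_bound_leP p U _ c4); apply: Rbd_le c24 _.
  exact: (Rbd_perturbed p1 sX dT bT mJ JE c0' bF).
- apply/(R_bound_leP p U _ c4).
  exact: (Rbd_perturbed_deriv p1 sX sA oU dT bT bT' mJ JE dE c0' bE bE').
- apply/(R_bound_leP p U _ c4).
  exact: (Rbd_perturbed_deriv p1 sX sB oU dT bT bT' mJ JE dF c0' bF bF').
Qed.

End main.

(* The space dimension is N = n.+1. *)
Theorem theorem1p5 (R : realType) :
  exists Lambda : R -> R -> R -> R,
  forall (n : nat) (p q mu nu gamma kappa sigma_star : R)
    (c : R -> R -> R -> R) (sigma : R),
    (2 <= n.+1)%N -> 1 <= p -> 1 < q ->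
    0 < mu -> 0 < nu -> 0 < kappa ->
    eta_w mu nu kappa != 0 -> kappa != mu * nu ->
    gamma0_constants n p mu nu kappa sigma_star c ->
    sigma_star < sigma < pi / 2 ->
    let c0 := c q (1 / 2) sigma in
    let lambda0 := Lambda c0 q gamma in
    1 <= lambda0 /\
    exists (A : R[i] -> fXq (@half_space R n) q -> Wmq (@half_space R n) 3 q)
      (B : R[i] -> fXq (@half_space R n) q -> vec n (Wmq (@half_space R n) 2 q)),
      solution_operators mu nu gamma kappa sigma lambda0 A B /\
      R_bounds_le p sigma lambda0 (4 * c0) A B.
Proof.
exists (fun c0 q gamma => (1 + 24 * `|gamma| * c0) ^+ 2).
move=> n p q mu nu gamma kappa sigma_star c sigma _ p1 q1 mu0 nu0 kappa0 _ _.
move=> [/andP[sw _] Hc] ss c0 lambda0.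
have half0 : 0 < 1 / 2 :> R by lra.
have [c00 [A0 [B0 [solA bndA]]]] := Hc q (1 / 2) sigma q1 half0 ss.
split.
  apply: exprn_ege1; rewrite lerDl; apply: mulr_ge0; last exact: ltW.
  exact: mulr_ge0.
have sigma0 : 0 < sigma < pi.
  have /andP[ss1 ss2] := ss; have pi0 := pi_gt0 R.
  have := sigma_w_ge0 mu nu kappa; move=> w0.
  by apply/andP; split; lra.
exact: (perturbed_operators gamma p1 q1 c00 sigma0 solA bndA).
Qed.
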